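(* (1) For $n\ge2$, $a=(a_1,\dots,a_n)\in\mathbb C^n$ and $a'=(a'_1,\dots,a'_{n-1})\in\mathbb C^{n-1}$, $$I_{n,n-1;a,a'}(s)=\prod_{1\le j\le n,\,1\le k\le n-1}\Gamma_{\mathbb R}(s+a_j+a'_k).$$ (2) For $a,a'\in\mathbb C^n$, $$I_{n,n;a,a'}(s)=\prod_{1\le j\le n,\,1\le k\le n}\Gamma_{\mathbb R}(s+a_j+a'_k).$$
   Context: $\Gamma_{\mathbb R}(s)=\pi^{-s/2}\Gamma(s/2)$. For $a\in\mathbb C^k$: $|a|=\sum a_j$, $\widetilde a_j=a_{j+1}+a_1/(k-1)$; $\alpha[y_1,\dots,y_k]=\mathrm{diag}(y_1\cdots y_k,\dots,y_k)$. Define $\widehat W^A_{1,(a_1)}(\alpha[y_1])=y_1^{a_1}$, $\widehat W^A_{2,(a_1,a_2)}(\alpha[y_1,1])=2y_1^{(a_1+a_2)/2}K_{(a_1-a_2)/2}(2\pi y_1)$, for $k\ge3$ $$\widehat W^A_{k,a}(\alpha[y_1,\dots,y_{k-1},1])=\int_{(\mathbb R_+)^{k-1}}\widehat W^A_{k-1,\widetilde a}\Big(\alpha\Big[y_2\sqrt{\tfrac{t_2}{t_1}},\dots,y_{k-1}\sqrt{\tfrac{t_{k-1}}{t_{k-2}}},1\Big]\Big)\Big[\prod_{j=1}^{k-1}e^{-(\pi y_j)^2t_j-1/t_j}(\pi y_j)^{(k-j)a_1/(k-1)}t_j^{ka_1/(2(k-1))}\Big](\pi t_{k-1})^{-|a|/2}\prod\frac{dt_j}{t_j},$$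 $\widehat W^A_{k,a}(\alpha[y_1,\dots,y_k])=y_k^{|a|}\widehat W^A_{k,a}(\alpha[y_1,\dots,y_{k-1},1])$, and $W^A_{k,a}(\alpha[y])=\prod_jy_j^{j(k-j)/2}\widehat W^A_{k,a}(\alpha[y])$ (the class one Whittaker function of $GL_k(\mathbb R)$ with parameter $a$, restricted to positive diagonal matrices). The archimedean Rankin–Selberg zeta integrals $I_{n,m;a,a'}(s)=Z(s,W^A_{n,a},\overline W^A_{m,a'})$ are, with the paper's normalization of measures, given by $I_{n,n;a,a'}(s)=2^n\int_{(\mathbb R_+)^n}e^{-\pi y_n^2}W^A_{n,a}(\alpha[y])W^A_{n,a'}(\alpha[y])\prod_{j=1}^ny_j^{js-j(n-j)}\frac{dy_j}{y_j}$, and for $m<n$, $I_{n,m;a,a'}(s)=2^m\int_{(\mathbb R_+)^m}W^A_{n,a}(\alpha[y_1,\dots,y_m,1,\dots,1])W^A_{m,a'}(\alpha[y_1,\dots,y_m])\prod_{j=1}^my_j^{j(s-(n-m)/2)-j(m-j)}\frac{dy_j}{y_j}$. Identities are meant where the integrals converge (and by meromorphic continuation). *)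

(* Defs.v *)
From HB Require Import structures.
From mathcomp Require Import all_boot all_order all_algebra.
From mathcomp Require Import all_classical all_reals all_analysis.
From mathcomp Require Import complex.

Set Implicit Arguments.
Unset Strict Implicit.
Unset Printing Implicit Defensive.

Import Order.TTheory GRing.Theory Num.Theory.
Import numFieldNormedType.Exports.

Local Open Scope classical_set_scope.
Local Open Scope ring_scope.

(* Indices are shifted by one: the coordinate y_j of a tuple y is
   [tnth y i] with j = i.+1. *)

(* x ^ z = exp (z log x); only meaningful for x > 0. *)
Definition cpow (R : realType) (x : R) (z : R[i]) : R[i] :=
  ((expR (complex.Re z * ln x))%:C *
   (cos (complex.Im z * ln x) +i* sin (complex.Im z * ln x)))%C.

(* Integrability in the sense of Lebesgue, i.e. absolute convergence. *)
Definition cintegrable (d : measure_display) (T : measurableType d)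
    (R : realType) (mu : {measure set T -> \bar R}) (D : set T) (f : T -> R[i]) : Prop :=
  mu.-integrable D (fun x => (complex.Re (f x))%:E) /\
  mu.-integrable D (fun x => (complex.Im (f x))%:E).

Definition cintegral (d : measure_display) (T : measurableType d)
    (R : realType) (mu : {measure set T -> \bar R}) (D : set T) (f : T -> R[i]) : R[i] :=
  (\int[mu]_(x in D) (complex.Re (f x)) +i*
   \int[mu]_(x in D) (complex.Im (f x)))%C.

(* The n-fold product measure on T^n: T^0 is a point of mass 1, and
   T^(n+1) = T x T^n. *)
Fixpoint power_measure (d : measure_display) (T : measurableType d)
    (R : realType) (mu : set T -> \bar R) (n : nat) :
    set (n.-tuple T) -> \bar R :=
  match n return set (n.-tuple T) -> \bar R with
  | 0 => dirac ([tuple] : 0.-tuple T)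
  | p.+1 => pushforward (mu \x @power_measure _ T R mu p)%E
              (fun z : T * p.-tuple T => [tuple of z.1 :: z.2])
  end.

Section power_measure_cons.
Context (d : measure_display) (T : measurableType d) (R : realType) (p : nat).
Variable mu : {sigma_finite_measure set T -> \bar R}.
Variable nu : {sigma_finite_measure set (p.-tuple T) -> \bar R}.

Let c (z : T * p.-tuple T) : p.+1.-tuple T := [tuple of z.1 :: z.2].
Let u (t : p.+1.-tuple T) : T * p.-tuple T := (thead t, [tuple of behead t]).

Let cK z : u (c z) = z.
Proof. by case: z => x t; congr pair; apply/val_inj. Qed.

Let mc : measurable_fun [set: T * p.-tuple T] c.
Proof.
by apply: measurable_cons; [exact: measurable_fst|exact: measurable_snd].
Qed.

Let mu_ : measurable_fun [set: p.+1.-tuple T] u.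
Proof.
apply/measurable_fun_pairP; split; first exact: measurable_tnth.
exact: measurable_behead.
Qed.

Let P := pushforward (mu \x nu)%E c.

Let P0 : P set0 = 0%E.
Proof. by rewrite /P /pushforward preimage_set0 measure0. Qed.

Let P_ge0 A : (0 <= P A)%E.
Proof. exact: measure_ge0. Qed.

Let P_sigma_additive : semi_sigma_additive P.
Proof.
move=> F mF tF mUF; rewrite /P /pushforward preimage_bigcup.
apply: measure_semi_sigma_additive.
- by move=> n; rewrite -[X in measurable X]setTI; exact: mc.
- apply/trivIsetP => /= i j _ _ ij; rewrite -preimage_setI.
  by move/trivIsetP : tF => /(_ _ _ _ _ ij) ->//; rewrite preimage_set0.
- by rewrite -preimage_bigcup -[X in measurable X]setTI; exact: mc.
Qed.

HB.instance Definition _ :=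
  isMeasure.Build _ _ _ P P0 P_ge0 P_sigma_additive.

Let P_sigma_finite : sigma_finite setT P.
Proof.
have /sigma_finiteP[F [TF ndF Foo]] := sigma_finiteT mu.
have /sigma_finiteP[G [TG ndG Goo]] := sigma_finiteT nu.
exists (fun n => u @^-1` (F n `*` G n)).
  apply/seteqP; split => // t _.
  have [i _ Fi] : (\bigcup_i F i) (u t).1 by rewrite -TF.
  have [j _ Gj] : (\bigcup_i G i) (u t).2 by rewrite -TG.
  exists (maxn i j) => //; split.
  - by move: Fi; exact/subsetPset/ndF/leq_maxl.
  - by move: Gj; exact/subsetPset/ndG/leq_maxr.
move=> k; have [mF Fk] := Foo k; have [mG Gk] := Goo k; split.
  by rewrite -[X in measurable X]setTI; apply: mu_ => //; exact: measurableX.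
rewrite /P /pushforward (_ : c @^-1` _ = F k `*` G k).
  by rewrite product_measure1E// lte_mul_pinfty// ge0_fin_numE.
apply/funext => z; change ((F k `*` G k) (u (c z)) = (F k `*` G k) z).
by rewrite cK.
Qed.

HB.instance Definition _ :=
  Measure_isSigmaFinite.Build _ _ _ P P_sigma_finite.

Lemma power_measure_cons :
  exists m : {sigma_finite_measure set (p.+1.-tuple T) -> \bar R},
    m = pushforward (mu \x nu)%E
          (fun z : T * p.-tuple T => [tuple of z.1 :: z.2]) :> (set _ -> _).
Proof. by exists P. Qed.

End power_measure_cons.

Section power_measure_measure.
Context (d : measure_display) (T : measurableType d) (R : realType).
Variables (mu : {sigma_finite_measure set T -> \bar R}) (n : nat).

Lemma power_measureP :
  exists m : {sigma_finite_measure set (n.-tuple T) -> \bar R},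
    m = @power_measure _ T R mu n :> (set _ -> _).
Proof.
elim: n => [|p [nu /= nuE]]; first by exists (dirac ([tuple] : 0.-tuple T)).
by have [m mE] := power_measure_cons mu nu; exists m; rewrite mE /= -nuE.
Qed.

Let power_measure0 : @power_measure _ T R mu n set0 = 0%E.
Proof. by have [m <-] := power_measureP. Qed.

Let power_measure_ge0 A : (0 <= @power_measure _ T R mu n A)%E.
Proof. by have [m <-] := power_measureP. Qed.

Let power_measure_sigma_additive :
  semi_sigma_additive (@power_measure _ T R mu n).
Proof.
by have [m <-] := power_measureP; exact: measure_semi_sigma_additive.
Qed.

HB.instance Definition _ := isMeasure.Build _ _ _ (@power_measure _ T R mu n)
  power_measure0 power_measure_ge0 power_measure_sigma_additive.

Let power_measure_sigma_finite : sigma_finite setT (@power_measure _ T R mu n).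
Proof. by have [m <-] := power_measureP; exact: sigma_finiteT. Qed.

HB.instance Definition _ := Measure_isSigmaFinite.Build _ _ _
  (@power_measure _ T R mu n) power_measure_sigma_finite.

End power_measure_measure.

Definition lebesgue_tuple (R : realType) (n : nat) :
    {sigma_finite_measure set (n.-tuple (measurableTypeR R)) -> \bar R} :=
  @power_measure _ _ R (@lebesgue_measure R) n.

Definition positive_orthant (R : realType) (n : nat) : set (n.-tuple R) :=
  [set y | forall i, 0 < tnth y i].

Definition Euler_integral (R : realType) (z : R[i]) : R[i] :=
  cintegral (@lebesgue_measure R) `]0, +oo[
    (fun t => cpow t z * ((expR (- t) / t)%:C)%C).

(* The Gamma function on C: Euler's integral if Re z > 0, and
   Gamma(z + N) / (z (z + 1) ... (z + N - 1)) otherwise, where N is the least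
   natural number with Re (z + N) > 0. At the poles 0, -1, -2, ... the
   denominator vanishes and the value is the conventional x / 0 = 0. *)
Definition Gamma (R : realType) (z : R[i]) : R[i] :=
  let N := if 0 < complex.Re z then 0%N
           else (Num.truncn (- complex.Re z)).+1 in
  Euler_integral (z + N%:R) / \prod_(i < N) (z + i%:R).

Definition GammaR (R : realType) (s : R[i]) : R[i] :=
  cpow pi (- s / 2) * Gamma (s / 2).

(* K_nu(x) = 1/2 int_0^oo exp (- x (t + 1/t) / 2) t^nu dt/t, for x > 0. *)
Definition besselK (R : realType) (nu : R[i]) (x : R) : R[i] :=
  2^-1 * cintegral (@lebesgue_measure R) `]0, +oo[
    (fun t => cpow t nu * ((expR (- (x / 2) * (t + t^-1)) / t)%:C)%C).

(* A positive diagonal k x k matrix is uniquely of the form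
   alpha[y_1, ..., y_k] = diag (y_1 ... y_k, ..., y_k), and the functions
   below take (y_1, ..., y_k) as argument. *)

(* |a| = a_1 + ... + a_k, without absolute values. *)
Definition par_sum (R : realType) (k : nat) (a : k.-tuple R[i]) : R[i] :=
  \sum_(i < k) tnth a i.

(* tilde a_j = a_(j+1) + a_1 / (k - 1), for a in C^k with k = m + 1. *)
Definition par_tilde (R : realType) (m : nat) (a : m.+1.-tuple R[i]) :
    m.-tuple R[i] :=
  [tuple tnth a (lift ord0 i) + tnth a ord0 / m%:R | i < m].

(* [hatW1 a y] = hat W_(k,a) (alpha[y_1, ..., y_(k-1), 1]) with k = m + 1.
   In the successor case k = p + 2; the branch p = 0 is the K-Bessel formula
   for k = 2, and the other one is the recursion for k >= 3, in which
   widen_ord (leqnSn p) i and lift ord0 i stand for the consecutive indices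
   j and j + 1. *)
Fixpoint hatW1 (R : realType) (m : nat) :
    m.+1.-tuple R[i] -> m.-tuple R -> R[i] :=
  match m return m.+1.-tuple R[i] -> m.-tuple R -> R[i] with
  | 0 => fun _ _ => 1
  | p.+1 => fun a y =>
    let a1 := tnth a ord0 in
    if p is 0 then
      let a2 := tnth a ord_max in
      let y1 := tnth y ord0 in
      2 * cpow y1 ((a1 + a2) / 2) * besselK ((a1 - a2) / 2) (2 * pi * y1)
    else
      cintegral (@lebesgue_tuple R p.+1) (@positive_orthant R p.+1)
        (fun t =>
          @hatW1 R p (par_tilde a)
            [tuple tnth y (lift ord0 i) *
               Num.sqrt (tnth t (lift ord0 i) /
                         tnth t (widen_ord (leqnSn p) i)) | i < p] *
          (\prod_(i < p.+1)
             ((((expR (- (pi * tnth y i) ^+ 2 * tnth t i - (tnth t i)^-1))%:C)%C) *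
              cpow (pi * tnth y i) ((p.+2 - i.+1)%:R * a1 / p.+1%:R) *
              cpow (tnth t i) (p.+2%:R * a1 / (2 * p.+1%:R)))) *
          cpow (pi * tnth t ord_max) (- par_sum a / 2) *
          \prod_(i < p.+1) (((tnth t i)^-1)%:C)%C)
  end.

(* hat W_(k,a) (alpha[y_1, ..., y_k]); for k = 1 this is y_1 ^ a_1. *)
Definition hatW (R : realType) (k : nat) :
    k.-tuple R[i] -> k.-tuple R -> R[i] :=
  match k return k.-tuple R[i] -> k.-tuple R -> R[i] with
  | 0 => fun _ _ => 1
  | m.+1 => fun a y =>
    cpow (tnth y ord_max) (par_sum a) *
    hatW1 a [tuple tnth y (widen_ord (leqnSn m) i) | i < m]
  end.

Definition whittaker (R : realType) (k : nat) (a : k.-tuple R[i])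
    (y : k.-tuple R) : R[i] :=
  (\prod_(i < k) cpow (tnth y i) ((i.+1 * (k - i.+1))%:R / 2)) * hatW a y.

(* Integrand of I_(n,n;a,a')(s) with respect to Lebesgue measure dy, for
   n >= 1; [last 1 y] is then y_n. *)
Definition RS_integrand_eq (R : realType) (n : nat) (a a' : n.-tuple R[i])
    (s : R[i]) (y : n.-tuple R) : R[i] :=
  ((expR (- pi * last 1 y ^+ 2))%:C)%C * whittaker a y * whittaker a' y *
  \prod_(i < n)
    (cpow (tnth y i) (i.+1%:R * s - (i.+1 * (n - i.+1))%:R) *
     (((tnth y i)^-1)%:C)%C).

(* alpha[y_1, ..., y_m, 1, ..., 1] for m <= n. *)
Definition pad1 (R : realType) (m n : nat) (y : m.-tuple R) : n.-tuple R :=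
  [tuple nth 1 y i | i < n].

(* Integrand of I_(n,m;a,a')(s) with respect to dy, for m < n. *)
Definition RS_integrand_lt (R : realType) (n m : nat) (a : n.-tuple R[i])
    (a' : m.-tuple R[i]) (s : R[i]) (y : m.-tuple R) : R[i] :=
  whittaker a (pad1 n y) * whittaker a' y *
  \prod_(i < m)
    (cpow (tnth y i)
       (i.+1%:R * (s - (n - m)%:R / 2) - (i.+1 * (m - i.+1))%:R) *
     (((tnth y i)^-1)%:C)%C).

Definition RS_converges_eq (R : realType) (n : nat) (a a' : n.-tuple R[i])
    (s : R[i]) : Prop :=
  cintegrable (@lebesgue_tuple R n) (@positive_orthant R n)
    (RS_integrand_eq a a' s).

Definition RS_integral_eq (R : realType) (n : nat) (a a' : n.-tuple R[i])
    (s : R[i]) : R[i] :=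
  2 ^+ n * cintegral (@lebesgue_tuple R n) (@positive_orthant R n)
             (RS_integrand_eq a a' s).

Definition RS_converges_lt (R : realType) (n m : nat) (a : n.-tuple R[i])
    (a' : m.-tuple R[i]) (s : R[i]) : Prop :=
  cintegrable (@lebesgue_tuple R m) (@positive_orthant R m)
    (RS_integrand_lt a a' s).

Definition RS_integral_lt (R : realType) (n m : nat) (a : n.-tuple R[i])
    (a' : m.-tuple R[i]) (s : R[i]) : R[i] :=
  2 ^+ m * cintegral (@lebesgue_tuple R m) (@positive_orthant R m)
             (RS_integrand_lt a a' s).

(* Near z0, F (z) = g (z) / (z - z0)^N for z <> z0, with g holomorphic in a
   neighbourhood of z0; derivability is over the field C. *)
Definition meromorphic_at (R : realType) (F : R[i] -> R[i]) (z0 : R[i]) :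
    Prop :=
  exists (N : nat) (g : R[i]^o -> R[i]^o),
    (\forall z \near (z0 : R[i]^o), derivable g z 1) /\
    (\forall z \near (z0 : R[i]^o)^', F z = g z / (z - z0) ^+ N).

(* The identity I(s) = F(s) holds at every s where the integral I(s)
   converges, which includes a right half-plane, and F is meromorphic on C:
   thus F is the meromorphic continuation of I. *)
Definition identity_and_continuation (R : realType) (converges : R[i] -> Prop)
    (I F : R[i] -> R[i]) : Prop :=
  [/\ forall s, converges s -> I s = F s,
      exists sigma : R, forall s, sigma < complex.Re s -> converges s
    & forall z, meromorphic_at F z].

(* Main.v *)
Require Import Defs.
From HB Require Import structures.
From mathcomp Require Import all_boot all_order all_algebra.
From mathcomp Require Import all_classical all_reals all_analysis.
From mathcomp Require Import complex measurable_realfun ring lra.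

(* In logarithmic coordinates the recursion for the Whittaker functions is the
   Givental recursion: with [gam c = int exp (c x - pi e^x) dx], so that
   [GammaR s = gam (s / 2)], and [u_j = 2 (log y_j + ... + log y_k)], one has
   [hatW_(k,a) (y) = Phi (a / 2) u], where [Phi b u] integrates the kernel
   [lam b_1 u x] against [Phi (b_2, ...) x]. The kernel [qk c] (Baxter's
   Q-operator) exchanges with [lam b] up to the factor [gam (c + b)], since both
   sides split into one-dimensional integrals that match under a reflection;
   hence [Phi b] is an eigenfunction of [qk c] with eigenvalue
   [prod_k gam (c + b_k)]. Unfolding one step of one of the two Whittaker
   functions in a Rankin-Selberg integral turns [lam] and the weight
   [|det|^s] into [qk], so the integral for (n+1, n) is such a product times the
   one for (n, n), and that one a product times the one for (n, n-1). Integrals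
   of absolute values are treated first, by Tonelli.
   Convergence at [s] forces all [Re (s + a_j + a'_k)] to be positive: otherwise
   the integrals would stay bounded near the rightmost pole of the product of
   Gamma factors, which has no zeros. *)

Set Implicit Arguments.
Unset Strict Implicit.
Unset Printing Implicit Defensive.
Import Order.TTheory GRing.Theory Num.Theory.
Import numFieldNormedType.Exports.
Local Open Scope classical_set_scope.
Local Open Scope ring_scope.

(** No asymptotics of Whittaker functions enter. The majorants [PhiR], with real parameters and
    values in [[0, +oo]], obey the same identities as [Phi]; their integrals are thus computed
    exactly, which settles convergence and licenses every exchange of complex integrals. In the
    exchange of kernels each coordinate [x] of the middle variable occurs in an exponent
    [p x - pi (A e^x + D e^(-x))]. Its integral is a K-Bessel function and the reflection is
    [K_p = K_(-p)]. The coefficients on the two sides agree up to an index shift, and the coordinate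
    left over has [D = 0], so that it contributes a Gamma factor. The two types of integral
    alternate because [y_n = 1] means that the last coordinate of [u] is 0: the last term of [lamE]
    is then [e^(v_n)], which is the exponent of the Gaussian of the equal rank integral up to the
    factor [- pi]; read backwards, that Gaussian completes [lam] to a kernel [qk]. The absence of
    zeros of [gam] is used as a lower bound that is uniform near the pole. It comes from the
    functional equation and an estimate far to the right, where rotating the integrand by a phase
    makes its real part large. *)

Local Notation re := complex.Re.
Local Notation im := complex.Im.
Local Notation normc := ComplexField.Normc.normc.

(** * Complex-valued functions and integrals *)

Section complex_exponential.
Context {R : realType}.
Local Notation C := R[i].
Implicit Types (z w : C) (x y : R).

Lemma ReM z w : re (z * w) = re z * re w - im z * im w.
Proof. by case: z; case: w. Qed.

Lemma ImM z w : im (z * w) = re z * im w + im z * re w.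
Proof. by case: z => a b; case: w => c d /=; rewrite (mulrC b). Qed.

Lemma ReD z w : re (z + w) = re z + re w.
Proof. by case: z; case: w. Qed.

Lemma ImD z w : im (z + w) = im z + im w.
Proof. by case: z; case: w. Qed.

Lemma ReN z : re (- z) = - re z.
Proof. by case: z. Qed.

Lemma ImN z : im (- z) = - im z.
Proof. by case: z. Qed.

Lemma complexP z w : re z = re w -> im z = im w -> z = w.
Proof. by case: z => a b; case: w => c d /= -> ->. Qed.

Lemma RCM x y : ((x * y)%:C = x%:C * y%:C)%C.
Proof. exact: rmorphM. Qed.

Lemma RCD x y : ((x + y)%:C = x%:C + y%:C)%C.
Proof. exact: rmorphD. Qed.

Lemma RCN x : ((- x)%:C = - x%:C)%C.
Proof. exact: rmorphN. Qed.

Lemma RCnat n : ((n%:R : R)%:C = n%:R)%C.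
Proof. exact: rmorph_nat. Qed.

Lemma RCV x : ((x^-1)%:C = (x%:C)^-1)%C.
Proof. exact: fmorphV. Qed.

Lemma Re_half z : re (z / 2) = re z / 2.
Proof. by rewrite -[2 in LHS]RCnat -RCV ReM /= mulr0 subr0. Qed.

Lemma RCsum (I : Type) (r : seq I) (P : pred I) (F : I -> R) :
  ((\sum_(i <- r | P i) F i)%:C = \sum_(i <- r | P i) (F i)%:C)%C.
Proof. exact: rmorph_sum. Qed.

Lemma norm_normc z : (`|z| = (normc z)%:C)%C.
Proof. by []. Qed.

Lemma normc_mul z w : normc (z * w) = normc z * normc w.
Proof. exact: ComplexField.Normc.normcM. Qed.

Lemma normcD_le z w : normc (z + w) <= normc z + normc w.
Proof. exact: le_normcD. Qed.

Lemma normc_ge0 z : 0 <= normc z.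
Proof. by case: z => a b /=; exact: sqrtr_ge0. Qed.

Lemma normc_opp z : normc (- z) = normc z.
Proof. exact: normcN. Qed.

Lemma normc_eq0 z : (normc z == 0) = (z == 0).
Proof.
apply/eqP/eqP => [/ComplexField.Normc.eq0_normc//|->].
by rewrite /= expr0n /= addr0 sqrtr0.
Qed.

Lemma normc_inv z : normc z^-1 = (normc z)^-1.
Proof. exact: ComplexField.Normc.normcV. Qed.

Lemma normc_real x : normc (x%:C)%C = `|x|.
Proof. by rewrite /= expr0n /= addr0 sqrtr_sqr. Qed.

Lemma normRe_le z : `|re z| <= normc z.
Proof. by case: z => a b /=; rewrite -sqrtr_sqr ler_wsqrtr // lerDl sqr_ge0. Qed.

Lemma normIm_le z : `|im z| <= normc z.
Proof. by case: z => a b /=; rewrite -sqrtr_sqr ler_wsqrtr // lerDr sqr_ge0. Qed.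

Lemma normc_le z : normc z <= `|re z| + `|im z|.
Proof.
case: z => a b /=.
rewrite -[leRHS]ger0_norm ?addr_ge0// -sqrtr_sqr ler_wsqrtr// sqrrD.
rewrite -(real_normK (num_real a)) -(real_normK (num_real b)) lerD2r lerDl.
by rewrite mulrn_wge0 // mulr_ge0.
Qed.

Lemma normc_prod (I : Type) (r : seq I) (P : pred I) (F : I -> C) :
  normc (\prod_(i <- r | P i) F i) = \prod_(i <- r | P i) normc (F i).
Proof.
apply: (big_morph (@ComplexField.Normc.normc R)) => [z w|]; first exact: normc_mul.
by rewrite -[1 in LHS]/((1 : R)%:C)%C normc_real normr1.
Qed.

(** Powers, Gaussians and kernels are all written as one [cexp], so that identities between them
    become ring identities between exponents. *)
Definition cexp z : C := ((expR (re z))%:C *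
  (cos (im z) +i* sin (im z)))%C.

Lemma cexpD z w : cexp (z + w) = cexp z * cexp w.
Proof.
rewrite /cexp ReD ImD expRD cosD sinD RCM.
rewrite mulrACA; congr (_ * _).
by apply: complexP; rewrite ?ReM ?ImM//= addrC.
Qed.

Lemma cexp_real x : cexp (x%:C)%C = ((expR x)%:C)%C.
Proof. by rewrite /cexp /= cos0 sin0 -[(1 +i* 0)%C]/(1 : C) mulr1. Qed.

Lemma cexp0 : cexp 0 = 1.
Proof. by rewrite -[0]/((0 : R)%:C)%C cexp_real expR0. Qed.

Lemma Re_cexp z : re (cexp z) = expR (re z) * cos (im z).
Proof. by rewrite /cexp ReM /= mul0r subr0. Qed.

Lemma Im_cexp z : im (cexp z) = expR (re z) * sin (im z).
Proof. by rewrite /cexp ImM /= mul0r addr0. Qed.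

Lemma normc_cexp z : normc (cexp z) = expR (re z).
Proof.
by rewrite /cexp normc_mul normc_real ger0_norm ?expR_ge0//= cos2Dsin2 sqrtr1 mulr1.
Qed.

Lemma cexp_sum (I : Type) (r : seq I) (P : pred I) (F : I -> C) :
  cexp (\sum_(i <- r | P i) F i) = \prod_(i <- r | P i) cexp (F i).
Proof. by apply: (big_morph cexp) => [z w|]; [exact: cexpD|exact: cexp0]. Qed.

Lemma cpowE x z : cpow x z = cexp (z * ((ln x)%:C)%C).
Proof. by rewrite /cpow /cexp ReM ImM /= !mulr0 subr0 add0r. Qed.

Lemma cpow_expR x z : cpow (expR x) z = cexp (z * (x%:C)%C).
Proof. by rewrite cpowE expRK. Qed.

End complex_exponential.
Arguments cexp {R}.

(** * Measurability of complex-valued functions *)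

Section complex_measurable.
Context d (T : measurableType d) {R : realType}.
Local Notation C := R[i].
Implicit Types f g : T -> C.

Definition cmeas f := measurable_fun setT (fun x => re (f x)) /\
  measurable_fun setT (fun x => im (f x)).

Lemma cmeas_cst c : cmeas (fun=> c).
Proof. by split; exact: measurable_cst. Qed.

Lemma cmeasD f g : cmeas f -> cmeas g -> cmeas (fun x => f x + g x).
Proof.
move=> [mf1 mf2] [mg1 mg2]; split.
  under eq_fun do rewrite ReD; exact: measurable_funD.
under eq_fun do rewrite ImD; exact: measurable_funD.
Qed.

Lemma cmeasM f g : cmeas f -> cmeas g -> cmeas (fun x => f x * g x).
Proof.
move=> [mf1 mf2] [mg1 mg2]; split.
  under eq_fun do rewrite ReM; by apply: measurable_funB; exact: measurable_funM.
under eq_fun do rewrite ImM; by apply: measurable_funD; exact: measurable_funM.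
Qed.

Lemma cmeas_real (h : T -> R) : measurable_fun setT h -> cmeas (fun x => (h x)%:C)%C.
Proof. by move=> mh; split => //=; exact: measurable_cst. Qed.

Lemma cmeasN f : cmeas f -> cmeas (fun x => - f x).
Proof.
move=> mf; under eq_fun do rewrite -mulN1r.
by apply: cmeasM => //; exact: cmeas_cst.
Qed.

Lemma cmeas_cexp f : cmeas f -> cmeas (fun x => cexp (f x)).
Proof.
move=> [mf1 mf2]; split.
  under eq_fun do rewrite Re_cexp; apply: measurable_funM.
    exact: measurableT_comp (@measurable_expR R) mf1.
  by apply: measurableT_comp mf2; apply: continuous_measurable_fun; exact: continuous_cos.
under eq_fun do rewrite Im_cexp; apply: measurable_funM.
  exact: measurableT_comp (@measurable_expR R) mf1.
by apply: measurableT_comp mf2; apply: continuous_measurable_fun; exact: continuous_sin.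
Qed.

Lemma cmeas_prod (I : Type) (r : seq I) (P : pred I) (F : I -> T -> C) :
  (forall i, cmeas (F i)) -> cmeas (fun x => \prod_(i <- r | P i) F i x).
Proof.
move=> mF; elim: r => [|i r IH].
  by under eq_fun do rewrite big_nil; exact: cmeas_cst.
under eq_fun do rewrite big_cons; case: (P i) => //.
exact: cmeasM.
Qed.

Lemma measurable_normc f : cmeas f -> measurable_fun setT (fun x => normc (f x)).
Proof.
move=> [mf1 mf2].
rewrite (_ : (fun x => _) = (fun x => Num.sqrt (re (f x) ^+ 2 + im (f x) ^+ 2))).
  apply: (@measurableT_comp _ _ _ _ _ _ (@Num.sqrt R)) => /=.
    by apply: continuous_measurable_fun; exact: sqrt_continuous.
  by apply: measurable_funD; apply: measurable_funX.
by apply/funext => x; case: (f x).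
Qed.

End complex_measurable.

Lemma cmeas_comp d d' (T : measurableType d) (T' : measurableType d') (R : realType)
    (f : T' -> R[i]) (phi : T -> T') :
  cmeas f -> measurable_fun setT phi -> cmeas (fun x => f (phi x)).
Proof.
move=> [mf1 mf2] mphi; split.
  exact: (measurableT_comp mf1 mphi).
exact: (measurableT_comp mf2 mphi).
Qed.

(** * Complex integrals and domination *)

Section complex_integral.
Context d (T : measurableType d) {R : realType} (mu : {measure set T -> \bar R}).
Local Notation C := R[i].
Implicit Types (f g : T -> C) (D : set T).

Lemma eq_cintegral D f g : (forall x, D x -> f x = g x) ->
  cintegral mu D f = cintegral mu D g.
Proof.
move=> fg; rewrite /cintegral; congr (_ +i* _)%C; apply: eq_Rintegral => x /[!inE] Dx;
  by rewrite fg.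
Qed.

Lemma cintegrableTP f : cintegrable mu setT f <->
  cmeas f /\ (\int[mu]_x (normc (f x))%:E < +oo)%E.
Proof.
split=> [[/integrableP[m1 i1] /integrableP[m2 i2]]|[[m1 m2] i]].
  have cf : cmeas f by split; exact/measurable_EFinP.
  split => //.
  apply: (@le_lt_trans _ _ (\int[mu]_x (`|(re (f x))%:E| + `|(im (f x))%:E|))%E).
    apply: ge0_le_integral => //.
    - by move=> x _; rewrite lee_fin normc_ge0.
    - by apply/measurable_EFinP; exact: measurable_normc.
    - by apply: emeasurable_funD; exact: measurableT_comp.
    - by move=> x _; rewrite -EFinD lee_fin normc_le.
  rewrite ge0_integralD//; first exact: lte_add_pinfty.
  - exact: measurableT_comp.
  - exact: measurableT_comp.
split; apply/integrableP; split; try exact/measurable_EFinP.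
  apply: le_lt_trans i; apply: ge0_le_integral => //.
  - by apply: measurableT_comp => //; exact/measurable_EFinP.
  - by apply/measurable_EFinP; exact: measurable_normc.
  - by move=> x _; rewrite lee_fin normRe_le.
apply: le_lt_trans i; apply: ge0_le_integral => //.
- by apply: measurableT_comp => //; exact/measurable_EFinP.
- by apply/measurable_EFinP; exact: measurable_normc.
- by move=> x _; rewrite lee_fin normIm_le.
Qed.

(** The majorant has values in [\bar R] because the functions [PhiR] used for it are extended-real
    integrals. *)
Lemma cintegrable_dom f (g : T -> \bar R) : cmeas f -> measurable_fun setT g ->
  (forall x, ((normc (f x))%:E <= g x)%E) -> (\int[mu]_x g x < +oo)%E ->
  cintegrable mu setT f.
Proof.
move=> mf mg fg ig; apply/cintegrableTP; split => //.
apply: le_lt_trans ig; apply: ge0_le_integral => //.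
- by move=> x _; rewrite lee_fin normc_ge0.
- by apply/measurable_EFinP; exact: measurable_normc.
Qed.

Lemma cintegrableZl c f : cintegrable mu setT f -> cintegrable mu setT (fun x => c * f x).
Proof.
move=> /cintegrableTP[mf fi]; apply/cintegrableTP; split.
  by apply: cmeasM => //; exact: cmeas_cst.
under eq_integral do rewrite normc_mul EFinM.
rewrite ge0_integralZl//.
- by apply: lte_mul_pinfty => //; rewrite lee_fin normc_ge0.
- by apply/measurable_EFinP; exact: measurable_normc.
- by move=> x _; rewrite lee_fin normc_ge0.
- by rewrite lee_fin normc_ge0.
Qed.

Lemma cintegrableD f g : cintegrable mu setT f -> cintegrable mu setT g ->
  cintegrable mu setT (fun x => f x + g x).
Proof.
move=> [f1 f2] [g1 g2]; split.
  apply: eq_integrable (integrableD measurableT f1 g1) => // x _ /=.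
  by rewrite ReD.
apply: eq_integrable (integrableD measurableT f2 g2) => // x _ /=.
by rewrite ImD.
Qed.

Lemma cintegralD f g : cintegrable mu setT f -> cintegrable mu setT g ->
  cintegral mu setT (fun x => f x + g x) = cintegral mu setT f + cintegral mu setT g.
Proof.
move=> [f1 f2] [g1 g2]; apply: complexP => /=.
  rewrite -RintegralD//; apply: eq_Rintegral => x _; by rewrite ReD.
rewrite -RintegralD//; apply: eq_Rintegral => x _; by rewrite ImD.
Qed.

Lemma cintegralZl c f : cintegrable mu setT f ->
  cintegral mu setT (fun x => c * f x) = c * cintegral mu setT f.
Proof.
move=> [f1 f2].
have iZ (k : R) (h : T -> R) : mu.-integrable setT (EFin \o h) ->
    mu.-integrable setT (EFin \o (fun x => k * h x)).
  move=> hh; apply: eq_integrable (integrableZl measurableT k hh) => // x _.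
apply: complexP; rewrite ?ReM ?ImM /=.
  under eq_Rintegral do rewrite ReM.
  rewrite RintegralB//; [|exact: iZ|exact: iZ].
  by rewrite !RintegralZl.
under eq_Rintegral do rewrite ImM.
rewrite RintegralD//; [|exact: iZ|exact: iZ].
by rewrite !RintegralZl.
Qed.

Lemma cintegralZr c f : cintegrable mu setT f ->
  cintegral mu setT (fun x => f x * c) = cintegral mu setT f * c.
Proof.
move=> fi; rewrite mulrC -cintegralZl//; apply: eq_cintegral => x _.
by rewrite mulrC.
Qed.

Lemma cintegral_real (h : T -> R) :
  cintegral mu setT (fun x => (h x)%:C)%C = ((\int[mu]_x h x)%:C)%C.
Proof.
rewrite /cintegral /=; congr (_ +i* _)%C.
by rewrite /Rintegral integral0.
Qed.

Lemma normc_cintegral_le f : cmeas f ->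
  ((normc (cintegral mu setT f))%:E <= \int[mu]_x (normc (f x))%:E)%E.
Proof.
move=> mf; case: (ltP (\int[mu]_x (normc (f x))%:E)%E +oo%E); last first.
  by rewrite leye_eq => /eqP ->; rewrite leey.
move=> lty; have fi : cintegrable mu setT f by apply/cintegrableTP.
set I := cintegral mu setT f.
have [/eqP I0|I0] := boolP (I == 0).
  rewrite I0 /= expr0n /= addr0 sqrtr0; apply: integral_ge0 => x _.
  by rewrite lee_fin normc_ge0.
(* The unit number inverse to the phase of [I]: the integral of [c f] is then the real number [|I|],
   which the integral of [|f|] bounds. *)
pose c : C := (conjc I / ((normc I)%:C))%C.
have nI0 : normc I != 0 by rewrite normc_eq0.
have cI : c * I = ((normc I)%:C)%C.
  rewrite /c mulrAC mulrC (mulrC (conjc I)) -sqr_normc norm_normc expr2 mulrA mulVf ?mul1r//.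
  by rewrite -(inj_eq (@complexI R)) in nI0.
have nc : normc c = 1.
  have := congr1 (@ComplexField.Normc.normc R) cI; rewrite normc_mul normc_real ger0_norm ?normc_ge0//.
  by move=> h; apply: (mulIf nI0); rewrite h mul1r.
have cfi := cintegrableZl c fi.
have : re (c * I) = normc I by rewrite cI.
rewrite /I -cintegralZl//= -/I => <-.
case: cfi => cf1 cf2.
rewrite /Rintegral fineK; last exact: integrable_fin_num.
apply: (le_trans (lee_abs _)); apply: (le_trans (le_abse_integral _ _ _)) => //.
  exact: measurable_int cf1.
apply: ge0_le_integral => //.
- by apply: measurableT_comp => //; exact: measurable_int cf1.
- by apply/measurable_EFinP; exact: measurable_normc.
- move=> x _; rewrite lee_fin (le_trans (normRe_le _))// normc_mul nc mul1r //.
Qed.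

End complex_integral.

(** * Fubini for complex-valued functions *)

Section complex_fubini.
Context d1 d2 (T1 : measurableType d1) (T2 : measurableType d2) (R : realType).
Variables (m1 : {sigma_finite_measure set T1 -> \bar R})
  (m2 : {sigma_finite_measure set T2 -> \bar R}).
Variable f : T1 * T2 -> R[i].

(** Holds also where a section fails to be integrable: the integral is [fine] of a difference of two
    Tonelli sections, and these are measurable. *)
Lemma cmeas_cintegral1 : cmeas f -> cmeas (fun x => cintegral m2 setT (fun y => f (x, y))).
Proof.
have H (h : T1 * T2 -> R) : measurable_fun setT h ->
    measurable_fun setT (fun x => Rintegral m2 setT (fun y => h (x, y))).
  move=> mh; apply: measurableT_comp => //.
  have mEh : measurable_fun setT (EFin \o h) by exact/measurable_EFinP.
  rewrite (_ : (fun x => _) = (fubini_F m2 (EFin \o h)^\+ \- fubini_F m2 (EFin \o h)^\-)%E).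
    apply: emeasurable_funB; apply: measurable_fun_fubini_tonelli_F => //.
    - exact: measurable_funepos.
    - exact: measurable_funeneg.
  apply/funext => x; rewrite /= integralE /fubini_F.
  congr (_ - _)%E; apply: eq_integral => y _.
    by rewrite !funeposE.
  by rewrite !funenegE.
move=> [mf1 mf2]; split.
  exact: (H (fun z => re (f z))).
exact: (H (fun z => im (f z))).
Qed.

Lemma cfubini12 : cintegrable (m1 \x m2)%E setT f ->
  cintegral m1 setT (fun x => cintegral m2 setT (fun y => f (x, y))) =
  cintegral (m1 \x m2)%E setT f.
Proof.
have H (h : T1 * T2 -> R) : (m1 \x m2)%E.-integrable setT (fun z => (h z)%:E) ->
    Rintegral m1 setT (fun x => Rintegral m2 setT (fun y => h (x, y))) =
    Rintegral (m1 \x m2)%E setT h.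
  move=> hi; rewrite {1 3}/Rintegral -integral12_prod_meas1//; congr fine.
  (* The inner integral is finite only almost everywhere; on the exceptional null set [fine] returns
     a default value. *)
  apply: ae_eq_integral => //.
  - apply/measurable_EFinP; apply: measurableT_comp => //.
    exact: (measurable_fubini_F hi).
  - exact: (measurable_fubini_F hi).
  - have := ae_integrable1 hi; apply: filterS => x hx _ /=.
    by rewrite /Rintegral fineK//; exact: integrable_fin_num.
move=> [i1 i2]; apply: complexP => /=.
  exact: (H (fun z => re (f z))).
exact: (H (fun z => im (f z))).
Qed.

Lemma cfubini21 : cintegrable (m1 \x m2)%E setT f ->
  cintegral m2 setT (fun y => cintegral m1 setT (fun x => f (x, y))) =
  cintegral (m1 \x m2)%E setT f.
Proof.
have H (h : T1 * T2 -> R) : (m1 \x m2)%E.-integrable setT (fun z => (h z)%:E) ->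
    Rintegral m2 setT (fun y => Rintegral m1 setT (fun x => h (x, y))) =
    Rintegral (m1 \x m2)%E setT h.
  move=> hi; rewrite {1 3}/Rintegral -integral21_prod_meas1//; congr fine.
  apply: ae_eq_integral => //.
  - apply/measurable_EFinP; apply: measurableT_comp => //.
    exact: (measurable_fubini_G hi).
  - exact: (measurable_fubini_G hi).
  - have := ae_integrable2 hi; apply: filterS => x hx _ /=.
    by rewrite /Rintegral fineK//; exact: integrable_fin_num.
move=> [i1 i2]; apply: complexP => /=.
  exact: (H (fun z => re (f z))).
exact: (H (fun z => im (f z))).
Qed.

(** One finite iterated integral of an extended-real majorant suffices, by Tonelli: in this form the
    computations with [PhiR] justify those with [Phi]. *)
Lemma cfubini (g : T1 * T2 -> \bar R) : cmeas f -> measurable_fun setT g ->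
  (forall z, ((normc (f z))%:E <= g z)%E) ->
  (\int[m1]_x \int[m2]_y g (x, y) < +oo)%E ->
  cintegral m1 setT (fun x => cintegral m2 setT (fun y => f (x, y))) =
  cintegral m2 setT (fun y => cintegral m1 setT (fun x => f (x, y))).
Proof.
move=> mf mg fg gi.
have g0 z : (0 <= g z)%E by apply: le_trans (fg z); rewrite lee_fin normc_ge0.
have fi : cintegrable (m1 \x m2)%E setT f.
  by apply: (cintegrable_dom mf mg fg); rewrite fubini_tonelli1.
by rewrite cfubini12// cfubini21.
Qed.

End complex_fubini.

Section complex_product.
Context d1 d2 (T1 : measurableType d1) (T2 : measurableType d2) (R : realType).
Variables (m1 : {sigma_finite_measure set T1 -> \bar R})
  (m2 : {sigma_finite_measure set T2 -> \bar R}).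

Lemma cintegral_prod (f : T1 -> R[i]) (g : T2 -> R[i]) :
  cintegrable m1 setT f -> cintegrable m2 setT g ->
  cintegrable (m1 \x m2)%E setT (fun z => f z.1 * g z.2) /\
  cintegral (m1 \x m2)%E setT (fun z => f z.1 * g z.2) =
  cintegral m1 setT f * cintegral m2 setT g.
Proof.
move=> fi gi; have /cintegrableTP[mf f_oo] := fi; have /cintegrableTP[mg g_oo] := gi.
have mfg : cmeas (fun z : T1 * T2 => f z.1 * g z.2).
  apply: cmeasM; [exact: (cmeas_comp mf measurable_fst)|exact: (cmeas_comp mg measurable_snd)].
have fgi : cintegrable (m1 \x m2)%E setT (fun z => f z.1 * g z.2).
  apply/cintegrableTP; split => //.
  rewrite fubini_tonelli1/=; last 2 first.
  - by apply/measurable_EFinP; exact: measurable_normc.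
  - by move=> z; rewrite lee_fin normc_ge0.
  rewrite /fubini_F /=.
  under eq_integral => x _.
    under eq_integral do rewrite normc_mul EFinM.
    rewrite ge0_integralZl//; last 3 first.
    - by apply/measurable_EFinP; exact: measurable_normc.
    - by move=> y _; rewrite lee_fin normc_ge0.
    - by rewrite lee_fin normc_ge0.
    over.
  rewrite ge0_integralZr//; last 3 first.
  - by apply/measurable_EFinP; exact: measurable_normc.
  - by move=> y _; rewrite lee_fin normc_ge0.
  - by apply: integral_ge0 => y _; rewrite lee_fin normc_ge0.
  apply: lte_mul_pinfty => //.
  - by apply: integral_ge0 => y _; rewrite lee_fin normc_ge0.
  - by rewrite ge0_fin_numE//; apply: integral_ge0 => y _; rewrite lee_fin normc_ge0.
split => //; rewrite -cfubini12//=.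
rewrite (_ : (fun x => _) = (fun x => f x * cintegral m2 setT g)) ?cintegralZr//.
by apply/funext => x; rewrite cintegralZl.
Qed.

End complex_product.

(** * From substitutions in nonnegative integrals to complex ones *)

Section transfer.
Context d1 d2 (X : measurableType d1) (Y : measurableType d2) (R : realType).
Variables (m1 : {measure set X -> \bar R}) (m2 : {measure set Y -> \bar R}).
Variables (D : set Y) (phi : X -> Y) (w : X -> R).
Hypothesis w0 : forall x, 0 <= w x.
Hypothesis int_phi : forall h : Y -> \bar R, measurable_fun D h ->
  (forall y, 0 <= h y)%E ->
  (\int[m2]_(y in D) h y = \int[m1]_x (h (phi x) * (w x)%:E))%E.

(** As [w >= 0], multiplying by [w] commutes with taking positive and negative parts. *)
Lemma transfer_Rintegral (f : Y -> R) : measurable_fun D f ->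
  \int[m2]_(y in D) f y = \int[m1]_x (f (phi x) * w x).
Proof.
move=> mf; rewrite /Rintegral integralE [in RHS]integralE.
have mEf : measurable_fun D (EFin \o f) by exact/measurable_EFinP.
congr (fine (_ - _)%E).
  rewrite int_phi; [|exact: measurable_funepos|by move=> y; exact: funepos_ge0].
  apply: eq_integral => x _; rewrite !funeposE /= -!EFin_max -EFinM.
  by rewrite maxr_pMl// mul0r.
rewrite int_phi; [|exact: measurable_funeneg|by move=> y; exact: funeneg_ge0].
apply: eq_integral => x _; rewrite !funenegE /= -!EFin_max -EFinM.
by rewrite maxr_pMl// mul0r mulNr.
Qed.

Lemma transfer_integrable (f : Y -> R) : measurable_fun D f ->
  measurable_fun setT (fun x => f (phi x) * w x) ->
  m2.-integrable D (EFin \o f) <->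
  m1.-integrable setT (EFin \o (fun x => f (phi x) * w x)).
Proof.
move=> mf mg.
have mEf : measurable_fun D (EFin \o f) by exact/measurable_EFinP.
have mEg : measurable_fun setT (EFin \o (fun x => f (phi x) * w x)) by exact/measurable_EFinP.
have E : (\int[m2]_(y in D) `|(f y)%:E| = \int[m1]_x `|(f (phi x) * w x)%:E|)%E.
  rewrite int_phi//; last exact: measurableT_comp.
  by apply: eq_integral => x _; rewrite /= -EFinM normrM (ger0_norm (w0 x)).
by split => /integrableP[_ i]; apply/integrableP; split => //; rewrite /= ?E// -E.
Qed.

Lemma transfer_cintegral (f : Y -> R[i]) (g : X -> R[i]) :
  measurable_fun D (fun y => re (f y)) ->
  measurable_fun D (fun y => im (f y)) ->
  cmeas g -> (forall x, g x = f (phi x) * ((w x)%:C)%C) ->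
  cintegral m2 D f = cintegral m1 setT g /\
  (cintegrable m2 D f <-> cintegrable m1 setT g).
Proof.
move=> mf1 mf2 [mg1 mg2] gE.
have g1 : (fun x => re (g x)) = (fun x => re (f (phi x)) * w x).
  by apply/funext => x; rewrite gE ReM /= mulr0 subr0.
have g2 : (fun x => im (g x)) = (fun x => im (f (phi x)) * w x).
  by apply/funext => x; rewrite gE ImM /= mulr0 add0r.
split.
  rewrite /cintegral; congr (_ +i* _)%C.
    by rewrite transfer_Rintegral// g1.
  by rewrite transfer_Rintegral// g2.
rewrite g1 in mg1; rewrite g2 in mg2.
have [h1 h1'] := transfer_integrable mf1 mg1.
have [h2 h2'] := transfer_integrable mf2 mg2.
have e1 : EFin \o (fun x => re (f (phi x)) * w x) = (fun x => (re (g x))%:E).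
  by rewrite -g1.
have e2 : EFin \o (fun x => im (f (phi x)) * w x) = (fun x => (im (g x))%:E).
  by rewrite -g2.
rewrite /cintegrable -e1 -e2; split => -[a b]; split; [exact: h1|exact: h2|exact: h1'|exact: h2'].
Qed.

End transfer.

(** * Changes of variables *)

Section density.
Context d (T : measurableType d) (R : realType) (mu : {measure set T -> \bar R}).
Variable w : T -> R.
Hypotheses (mw : measurable_fun setT w) (w0 : forall x, 0 <= w x).

Definition density (A : set T) : \bar R := (\int[mu]_(x in A) (w x)%:E)%E.

Let density0 : density set0 = 0%E.
Proof. by rewrite /density integral_set0. Qed.

Let density_ge0 A : (0 <= density A)%E.
Proof. by apply: integral_ge0 => x _; rewrite lee_fin. Qed.

Let density_sigma_additive : semi_sigma_additive density.
Proof.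
move=> F mF tF mUF; rewrite /density ge0_integral_bigcup//=.
- by apply: is_cvg_ereal_nneg_natsum_cond => n _ _; exact: density_ge0.
- by apply/measurable_EFinP; exact: measurable_funTS.
- by move=> x _; rewrite lee_fin.
Qed.

HB.instance Definition _ := isMeasure.Build _ _ _ density density0 density_ge0
  density_sigma_additive.

Definition density_measure : {measure set T -> \bar R} := density.

Import HBNNSimple.

Let integral_density_nnsfun (f : {nnsfun T >-> R}) :
  (\int[density]_x (f x)%:E = \int[mu]_x ((f x)%:E * (w x)%:E))%E.
Proof.
have mEw : measurable_fun setT (EFin \o w) by exact/measurable_EFinP.
under [LHS]eq_integral do rewrite fimfunE -fsumEFin//.
rewrite ge0_integral_fsum//; last 2 first.
- by move=> y; exact/measurable_EFinP/measurable_funM.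
- by move=> y x _; rewrite nnfun_muleindic_ge0.
under [RHS]eq_integral => x _.
  rewrite fimfunE -fsumEFin// ge0_mule_fsuml; last first.
    by move=> r; rewrite EFinM nnfun_muleindic_ge0.
  over.
rewrite ge0_integral_fsum//; last 2 first.
- by move=> y; apply: emeasurable_funM => //; exact/measurable_EFinP/measurable_funM.
- by move=> y x _; rewrite mule_ge0// ?lee_fin//; have := nnfun_muleindic_ge0 f y x; rewrite -EFinM.
apply: eq_fsbigr => r /[!inE] -[t _ tr].
have r0 : 0 <= r by rewrite -tr.
rewrite integralZl_indic_nnsfun// integral_indic// setIT.
under [RHS]eq_integral do rewrite EFinM -muleA.
rewrite ge0_integralZl//=; last 2 first.
- apply: emeasurable_funM => //; exact/measurable_EFinP.
- by move=> x _; rewrite mule_ge0// lee_fin.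
congr (_ * _)%E; rewrite /density integral_mkcond; apply: eq_integral => x _.
by rewrite patchE indicE; case: ifP => _; rewrite ?mul1e ?mul0e.
Qed.

Lemma integral_density (h : T -> \bar R) : measurable_fun setT h -> (forall x, 0 <= h x)%E ->
  (\int[density]_x h x = \int[mu]_x (h x * (w x)%:E))%E.
Proof.
move=> mh h0; pose f_ := nnsfun_approx measurableT mh.
have mEw : measurable_fun setT (EFin \o w) by exact/measurable_EFinP.
transitivity (limn (fun n => \int[density]_x (f_ n x)%:E)%E).
  rewrite -monotone_convergence//.
  - apply: eq_integral => y _; apply/esym/cvg_lim => //.
    exact: cvg_nnsfun_approx.
  - by move=> n; exact/measurable_EFinP/measurable_funP.
  - by move=> n y _; rewrite lee_fin.
  - by move=> y _ m n mn; rewrite lee_fin; exact/lefP/nd_nnsfun_approx.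
rewrite [X in limn X](_ : _ =
    (fun n => \int[mu]_x ((f_ n x)%:E * (w x)%:E))%E); last first.
  by apply/funext => n; exact: integral_density_nnsfun.
rewrite -monotone_convergence//.
- apply: eq_integral => x _; apply/cvg_lim => //.
  by apply: cvgeZr => //; exact: cvg_nnsfun_approx.
- by move=> n; apply: emeasurable_funM => //; exact/measurable_EFinP/measurable_funP.
- by move=> n x _; rewrite mule_ge0// lee_fin.
- move=> x _ m n mn; rewrite lee_wpmul2r// ?lee_fin//.
  exact/lefP/nd_nnsfun_approx.
Qed.

End density.

Definition pushforward_measure d1 d2 (X : measurableType d1) (Y : measurableType d2)
    (R : realType) (mu : {measure set X -> \bar R}) (phi : X -> Y)
    (mphi : measurable_fun setT phi) : {measure set Y -> \bar R} :=
  measure_function_pushforward__canonical__measure_function_Measure mu mphi.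

(** * Exponential, affine and reflecting substitutions on the line *)

Section substitution1.
Context {R : realType}.
Local Notation leb := (@lebesgue_measure R).
Local Notation RT := (measurableTypeR R).

Let expR_itv (a b : R) : (\int[leb]_(x in `]a, b]) (expR x)%:E = leb `](expR a), (expR b)])%E.
Proof.
rewrite lebesgue_measure_itv/= lte_fin ltr_expR; case: ifPn => [ab|]; last first.
  rewrite -leNgt => ba; rewrite (_ : `]a, b]%classic = set0) ?integral_set0//.
  by apply/seteqP; split=> x //=; rewrite in_itv/= => /andP[ax xb]; move: (lt_le_trans ax xb); rewrite ltNge ba.
rewrite integral_itv_obnd_cbnd; last first.
  by apply/measurable_EFinP/measurable_funTS; exact: measurable_expR.
rewrite -EFinD; apply: continuous_FTC2 => //.
- by apply: continuous_subspaceT => x; exact: continuous_expR.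
- split.
  + by move=> x _; exact: derivable_expR.
  + by apply: cvg_at_right_filter; exact: continuous_expR.
  + by apply: cvg_at_left_filter; exact: continuous_expR.
- by move=> x _; rewrite derive1E; have /funeqP -> := @derive_expR R.
Qed.

Let D : set R := `]0, +oo[%classic.
(** Discards [t <= 0], where [ln] has a default value. *)
Let pos (t : R) : R := \1_D t.

Let mpos : measurable_fun [set: RT] (pos : RT -> R).
Proof. by apply: measurable_indic; exact: measurable_itv. Qed.

Let pos0 t : 0 <= pos t.
Proof. by rewrite /pos indicE; case: (_ \in _). Qed.

Let mlnT : measurable_fun [set: RT] (@ln R : RT -> RT).
Proof. exact: measurable_ln. Qed.

Let m1 := pushforward_measure (density_measure leb mpos pos0) mlnT.
Let m2 := density_measure leb (@measurable_expR R) (@expR_ge0 R).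

(** Both measures give []a, b]] the length of []e^a, e^b]]: the first because that is the preimage
    under [ln] within [t > 0], the second by the fundamental theorem of calculus. Half-open
    intervals determine the measure. *)
Let m1m2 (A : set RT) : measurable A -> m1 A = m2 A.
Proof.
have m1E a b : m1 `]a, b]%classic = leb `](expR a), (expR b)]%classic.
  rewrite /m1 /= /pushforward /density /pos integral_indic//; last 2 first.
  - by rewrite -[X in measurable X]setTI; apply: mlnT => //; exact: measurable_itv.
  - exact: measurable_itv.
  congr (leb _); apply/seteqP; split=> t /=; rewrite /D /= !in_itv/= ?andbT.
    by case=> t0 /andP[a_t t_b]; rewrite -(lnK t0) ltr_expR ler_expR a_t.
  move=> /andP[a_t t_b]; have t0 := lt_trans (expR_gt0 a) a_t; split => //.
  by move: a_t t_b; rewrite -{1 2}(lnK t0) ltr_expR ler_expR => -> ->.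
apply: (@measure_unique _ R RT (@ocitv R) (fun k => `](- k%:R), k%:R]%classic)
  _ _ _ _ m1 m2) => //.
- exact: ocitvI.
- by move=> i; exact: is_ocitv.
- apply/seteqP; split => // x _; exists (Num.truncn `|x|).+1 => //=.
  have := truncnS_gt `|x|; rewrite in_itv/= ltr_norml => /andP[-> /ltW ->] //.
- by move=> _ [[a b] _ <-]; rewrite m1E /m2 /= /density expR_itv.
- by move=> k; rewrite m1E lebesgue_measure_itv; case: ifP => _; rewrite ltry.
Qed.

Lemma ge0_integral_expR (h : R -> \bar R) : measurable_fun [set: RT] (h : RT -> \bar R) ->
  (forall x, 0 <= h x)%E -> (forall x, x <= 0 -> h x = 0%E) ->
  (\int[leb]_t h t = \int[leb]_x (h (expR x) * (expR x)%:E))%E.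
Proof.
move=> mh h0 hN.
have mhe : measurable_fun [set: RT] ((fun x => h (expR x)) : RT -> \bar R).
  by apply: measurableT_comp => //; exact: measurable_expR.
rewrite -(integral_density leb (@measurable_expR R) (@expR_ge0 R) (h := fun x => h (expR x)))//.
rewrite -[RHS]/(\int[m2]_x _)%E -(@eq_measure_integral _ _ _ _ m2 m1); last first.
  by move=> A mA _; exact: m1m2.
rewrite [RHS](ge0_integral_pushforward mlnT)//.
rewrite preimage_setT [RHS](integral_density leb mpos pos0); last 2 first.
- exact: measurableT_comp mhe mlnT.
- by move=> x; exact: h0.
apply: eq_integral => t _ /=; rewrite /pos indicE mem_setE in_itv/= andbT.
by case: ltP => [t0|t0]; rewrite ?mule1 ?mule0 ?lnK// hN.
Qed.

(** The image of Lebesgue measure under [x |-> a x + b], scaled by [a], gives every interval its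
    length. *)
Lemma ge0_integral_affine (a b : R) (h : R -> \bar R) : 0 < a ->
  measurable_fun [set: RT] (h : RT -> \bar R) -> (forall x, 0 <= h x)%E ->
  (\int[leb]_x h x = \int[leb]_x (h ((a * x + b)%R) * a%:E))%E.
Proof.
move=> a0 mh h0.
have mf : measurable_fun [set: RT] ((fun x => a * x + b) : RT -> RT).
  by apply: measurable_funD => //; exact: measurable_funM.
pose m := mscale (NngNum (ltW a0)) (pushforward_measure leb mf).
have mE (A : set RT) : measurable A -> leb A = m A.
  apply: lebesgue_measure_unique => _ [[x y] _ <-].
  rewrite /m /= /mscale /= /pushforward.
  rewrite (_ : _ @^-1` _ = `]((x - b) / a), ((y - b) / a)]%classic); last first.
    apply/seteqP; split=> t /=; rewrite !in_itv/= ltr_pdivrMr// ler_pdivlMr//.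
      by rewrite ltrBlDr lerBrDr mulrC.
    by rewrite ltrBlDr lerBrDr mulrC.
  rewrite !lebesgue_measure_itv/= !lte_fin ltr_pM2r ?invr_gt0// ltrD2r.
  case: ifP => _; last by rewrite mule0.
  by rewrite -EFinB -EFinM; congr EFin; field; rewrite gt_eqF.
rewrite (@eq_measure_integral _ _ _ _ m leb) => [|A mA _]; last exact: mE.
rewrite ge0_integral_mscale// ge0_integralZr//=; last 2 first.
- exact: measurableT_comp mh mf.
- by rewrite lee_fin ltW.
rewrite muleC; congr (_ * _)%E.
by rewrite [LHS](ge0_integral_pushforward mf).
Qed.

Lemma ge0_integral_reflect (b : R) (h : R -> \bar R) :
  measurable_fun [set: RT] (h : RT -> \bar R) -> (forall x, 0 <= h x)%E ->
  (\int[leb]_x h x = \int[leb]_x h (b - x)%R)%E.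
Proof.
move=> mh h0.
have mN : measurable_fun [set: RT] (-%R : RT -> RT) by [].
rewrite (ge0_integral_affine b ltr01)//.
under eq_integral do rewrite mule1 mul1r.
have mh' : measurable_fun [set: RT] ((fun x => h (x + b)) : RT -> \bar R).
  by apply: measurableT_comp => //; exact: measurable_funD.
transitivity (\int[pushforward_measure leb mN]_x h (x + b)%R)%E.
  apply: (@eq_measure_integral _ _ _ _ (pushforward_measure leb mN) leb) => A mA _.
  by rewrite -[LHS]lebesgue_measureN.
rewrite [LHS](ge0_integral_pushforward mN)//; apply: eq_integral => x _ /=.
by rewrite addrC.
Qed.

End substitution1.

(** * Substitutions on tuples, one coordinate at a time *)

Section tuple_integral.
Context {R : realType}.
Local Notation leb := (@lebesgue_measure R).
Local Notation RT := (measurableTypeR R).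
Local Notation L := (@lebesgue_tuple R).
Local Open Scope ereal_scope.

Definition tcons n (z : RT * n.-tuple RT) : n.+1.-tuple RT := [tuple of z.1 :: z.2].

Lemma measurable_tcons n : measurable_fun setT (@tcons n).
Proof. by apply: measurable_cons; [exact: measurable_fst|exact: measurable_snd]. Qed.

Lemma ge0_integral_tupleS n (f : n.+1.-tuple RT -> \bar R) : measurable_fun setT f ->
  (forall x, 0 <= f x) ->
  \int[L n.+1]_x f x = \int[L n]_y \int[leb]_x f (tcons (x, y)).
Proof.
move=> mf f0; have mc := @measurable_tcons n.
transitivity (\int[pushforward (leb \x L n) (@tcons n)]_x f x); first by [].
rewrite (ge0_integral_pushforward mc)// preimage_setT fubini_tonelli2//=.
exact: measurableT_comp mf mc.
Qed.

Lemma integral_tuple0 (f : 0.-tuple RT -> \bar R) : measurable_fun setT f ->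
  \int[L 0]_x f x = f [tuple].
Proof.
move=> mf; transitivity (\int[dirac ([tuple] : 0.-tuple RT)]_x f x); first by [].
by rewrite integral_dirac// diracT mul1e.
Qed.

Lemma measurable_tuple_section n (f : n.+1.-tuple RT -> \bar R) : measurable_fun setT f ->
  (forall x, 0 <= f x) ->
  measurable_fun setT (fun y : n.-tuple RT => \int[leb]_x f (tcons (x, y))).
Proof.
move=> mf f0.
apply: (@measurable_fun_fubini_tonelli_G _ _ _ _ _ _ (f \o @tcons n)) => //=.
exact: measurableT_comp mf (@measurable_tcons n).
Qed.

Lemma measurable_tuple_section1 n (f : n.+1.-tuple RT -> \bar R) y : measurable_fun setT f ->
  measurable_fun setT (fun x : RT => f (tcons (x, y))).
Proof.
move=> mf; apply: (measurableT_comp mf).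
by apply: (@measurable_cons _ _ _ _ id _ (cst y)) => //; exact: measurable_cst.
Qed.

(** A substitution rule together with its side conditions, in a form that an induction on [n] can
    carry. [D] is the range of each coordinate of [phi], so [H] must vanish as soon as one
    coordinate leaves [D]. *)
Definition subst_on (D : set R) n (phi : n.-tuple RT -> n.-tuple RT)
    (W : n.-tuple RT -> R) :=
  [/\ measurable_fun setT phi, measurable_fun setT W, (forall x, (0 <= W x)%R) &
    forall H : n.-tuple RT -> \bar R, measurable_fun setT H -> (forall y, 0 <= H y) ->
      (forall y, (exists i, ~ D (tnth y i)) -> H y = 0) ->
      \int[L n]_y H y = \int[L n]_x (H (phi x) * (W x)%:E)].

Lemma subst_on0 D (phi : 0.-tuple RT -> 0.-tuple RT) (W : 0.-tuple RT -> R) :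
  W [tuple] = 1%R -> subst_on D phi W.
Proof.
move=> W1.
have E (x : 0.-tuple RT) : x = [tuple] by exact: tuple0.
have E1 : phi = (fun=> [tuple]) by apply/funext => x; rewrite [LHS]E.
have E2 : W = (fun=> 1%R) by apply/funext => x; rewrite (E x).
rewrite E1 E2; split => // H mH H0 _.
rewrite !integral_tuple0//; first by rewrite mule1.
Qed.

(** Triangular substitutions: the new head [psi y x] may depend on the tail [y], over which the
    outer integral runs, so Jacobians multiply. *)
Lemma subst_onS D n (phi : n.-tuple RT -> n.-tuple RT) (W : n.-tuple RT -> R)
    (phi' : n.+1.-tuple RT -> n.+1.-tuple RT) (W' : n.+1.-tuple RT -> R)
    (psi : n.-tuple RT -> RT -> RT) (w : n.-tuple RT -> RT -> R) :
  subst_on D phi W -> measurable_fun setT phi' -> measurable_fun setT W' ->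
  (forall y, measurable_fun setT (psi y)) -> (forall y, measurable_fun setT (w y)) ->
  (forall y x, (0 <= w y x)%R) ->
  (forall x y, phi' (tcons (x, y)) = tcons (psi y x, phi y)) ->
  (forall x y, W' (tcons (x, y)) = (w y x * W y)%R) ->
  (forall y (h : RT -> \bar R), measurable_fun setT h -> (forall x, 0 <= h x) ->
    (forall x, ~ D x -> h x = 0) ->
    \int[leb]_x h x = \int[leb]_x (h (psi y x) * (w y x)%:E)) ->
  subst_on D phi' W'.
Proof.
move=> [mphi mW W0 HW] mphi' mW' mpsi mw w0 phiE WE sub1.
have W'0 x : (0 <= W' x)%R.
  case/tupleP: x => x y; have := WE x y; rewrite /tcons /= => ->.
  by rewrite mulr_ge0.
split => // H mH H0 HD.
have mHW : measurable_fun setT (fun x => H (phi' x) * (W' x)%:E).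
  by apply: emeasurable_funM; [exact: measurableT_comp mH mphi'|exact/measurable_EFinP].
have HW0 x : 0 <= H (phi' x) * (W' x)%:E by rewrite mule_ge0// lee_fin.
rewrite (ge0_integral_tupleS mH H0) (ge0_integral_tupleS mHW HW0).
rewrite (HW (fun y => \int[leb]_x H (tcons (x, y)))); last 3 first.
- exact: measurable_tuple_section.
- by move=> y; exact: integral_ge0.
- move=> y [i Di]; apply: integral0_eq => x _; apply: HD.
  by exists (lift ord0 i); rewrite /tcons tnthS.
apply: eq_integral => y _; rewrite (sub1 y); last 3 first.
- exact: measurable_tuple_section1.
- by move=> x; exact: H0.
- by move=> x Dx; apply: HD; exists ord0; rewrite tnth0.
rewrite -ge0_integralZr//; last 3 first.
- apply: emeasurable_funM; last by apply/measurable_EFinP; exact: mw.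
  exact: measurableT_comp (measurable_tuple_section1 (phi y) mH) (mpsi y).
- by move=> x _; rewrite mule_ge0 ?lee_fin.
- by rewrite lee_fin.
by apply: eq_integral => x _; rewrite phiE WE EFinM muleA.
Qed.

Definition trefl (a : nat -> R) n (x : n.-tuple RT) : n.-tuple RT :=
  [tuple (a i - tnth x i)%R | i < n].

Definition texp n (x : n.-tuple RT) : n.-tuple RT := [tuple expR (tnth x i) | i < n].

Definition tailsum n (x : n.-tuple RT) : n.-tuple RT :=
  [tuple (2 * \sum_(j < n | (i <= j)%N) tnth x j)%R | i < n].

Lemma measurable_trefl a n : measurable_fun setT (@trefl a n).
Proof.
apply/measurable_fun_tnthP => i.
rewrite (_ : _ \o _ = (fun x : n.-tuple RT => a i - tnth x i)%R); last first.
  by apply/funext => x /=; rewrite tnth_mktuple.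
by apply: measurable_funB => //; exact: measurable_tnth.
Qed.

Lemma measurable_texp n : measurable_fun setT (@texp n).
Proof.
apply/measurable_fun_tnthP => i.
rewrite (_ : _ \o _ = (fun x : n.-tuple RT => expR (tnth x i))%R); last first.
  by apply/funext => x /=; rewrite tnth_mktuple.
exact: measurableT_comp (@measurable_expR R) (@measurable_tnth _ _ _ i).
Qed.

Lemma measurable_tailsum n : measurable_fun setT (@tailsum n).
Proof.
apply/measurable_fun_tnthP => i.
rewrite (_ : _ \o _ = (fun x : n.-tuple RT => 2 * \sum_(j < n | (i <= j)%N) tnth x j)%R); last first.
  by apply/funext => x /=; rewrite tnth_mktuple.
apply: measurable_funM => //.
under eq_fun do rewrite big_mkcond.
pose h (j : 'I_n) (x : n.-tuple RT) : R := (if (i <= j)%N then tnth x j else 0)%R.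
apply: (@measurable_sum _ _ _ _ _ _ h) => j; rewrite /h.
by case: (i <= j)%N => //; exact: measurable_tnth.
Qed.

Lemma subst_trefl a n : subst_on setT (@trefl a n) (fun=> 1%R).
Proof.
elim: n a => [|n IH] a; first exact: subst_on0.
apply: (@subst_onS _ _ _ _ _ _ (fun _ x => a 0%N - x)%R (fun _ _ => 1%R) (IH (fun i => a i.+1))) => //.
- exact: measurable_trefl.
- by move=> y; exact: measurable_funB.
- move=> x y; apply/eq_from_tnth => i; rewrite tnth_mktuple.
  case: (unliftP ord0 i) => [j ->|->]; last by rewrite !tnth0.
  by rewrite !tnthS tnth_mktuple.
- by move=> x y; rewrite mulr1.
- move=> y h mh h0 _; under [RHS]eq_integral do rewrite mule1.
  exact: ge0_integral_reflect.
Qed.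

Lemma subst_texp n : subst_on `]0%R, +oo[ (@texp n) (fun x => \prod_(i < n) expR (tnth x i))%R.
Proof.
elim: n => [|n IH]; first by apply: subst_on0; rewrite big_ord0.
apply: (@subst_onS _ _ _ _ _ _ (fun _ x => expR x) (fun _ x => expR x) IH).
- exact: measurable_texp.
- apply: measurable_prod => i _; exact: measurableT_comp (@measurable_expR R) (@measurable_tnth _ _ _ i).
- by move=> y; exact: measurable_expR.
- by move=> y; exact: measurable_expR.
- by move=> y x; exact: expR_ge0.
- move=> x y; apply/eq_from_tnth => i; rewrite tnth_mktuple.
  case: (unliftP ord0 i) => [j ->|->]; last by rewrite !tnth0.
  by rewrite !tnthS tnth_mktuple.
- move=> x y; rewrite big_ord_recl tnth0; congr (_ * _)%R.
  by apply: eq_bigr => i _; rewrite tnthS.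
- move=> y h mh h0 hD; apply: ge0_integral_expR => // x x0.
  by apply: hD; rewrite /= in_itv/= andbT; apply/negP; rewrite -leNgt.
Qed.

(** The map is triangular with diagonal entries 2. This Jacobian is the factor [2 ^ n] in front of
    the Rankin-Selberg integrals. *)
Lemma subst_tailsum n : subst_on setT (@tailsum n) (fun=> (2 ^+ n)%R).
Proof.
elim: n => [|n IH]; first exact: subst_on0.
apply: (@subst_onS _ _ _ _ _ _ (fun y x => 2 * x + 2 * \sum_(j < n) tnth y j)%R (fun _ _ => 2%R) IH) => //.
- exact: measurable_tailsum.
- by move=> y; apply: measurable_funD => //; exact: measurable_funM.
- move=> x y; apply/eq_from_tnth => i; rewrite tnth_mktuple.
  case: (unliftP ord0 i) => [j ->|->].
    rewrite tnthS tnth_mktuple big_mkcond big_ord_recl /= add0r -big_mkcond/=; congr (_ * _)%R.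
    by apply: eq_bigr => k _; rewrite tnthS.
  rewrite !tnth0 big_ord_recl /= tnth0 mulrDr; congr (_ + _ * _)%R.
  by apply: eq_bigr => k _; rewrite tnthS.
- by move=> x y; rewrite exprS.
- by move=> y h mh h0 _; exact: ge0_integral_affine.
Qed.

Lemma measurable_positive_orthant n : measurable (@positive_orthant R n : set (n.-tuple RT)).
Proof.
rewrite (_ : @positive_orthant R n = \bigcap_(i in [set: 'I_n]) ((fun y : n.-tuple RT => tnth y i) @^-1` `]0%R, +oo[)).
  apply: fin_bigcap_measurable => // i _; rewrite -[X in measurable X]setTI.
  by apply: measurable_tnth => //; exact: measurable_itv.
apply/seteqP; split => y /=.
  by move=> yp i _; rewrite /= in_itv/= andbT.
by move=> yp i; have := yp i I; rewrite /= in_itv/= andbT.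
Qed.

Lemma cintegral_trefl a n (f : n.-tuple RT -> R[i]) : cmeas f ->
  cintegral (L n) setT f = cintegral (L n) setT (fun x => f (trefl a x)).
Proof.
move=> mf; have [mp mW W0 HW] := subst_trefl a n.
have tr (h : n.-tuple RT -> \bar R) : measurable_fun setT h -> (forall y, 0 <= h y) ->
    \int[L n]_(y in setT) h y = \int[L n]_x (h (trefl a x) * (1%R)%:E).
  by move=> mh h0; apply: HW => // y [i []].
by apply: (transfer_cintegral W0 tr mf.1 mf.2 (cmeas_comp mf mp) _).1 => x; rewrite mulr1.
Qed.

Lemma cintegral_tailsum n (f : n.-tuple RT -> R[i]) : cmeas f ->
  cintegral (L n) setT f = (cintegral (L n) setT (fun x => f (tailsum x) * ((2 ^+ n)%:C)%C))%R /\
  (cintegrable (L n) setT f <-> cintegrable (L n) setT (fun x => f (tailsum x) * ((2 ^+ n)%:C)%C)%R).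
Proof.
move=> mf; have [mp mW W0 HW] := subst_tailsum n.
have tr (h : n.-tuple RT -> \bar R) : measurable_fun setT h -> (forall y, 0 <= h y) ->
    \int[L n]_(y in setT) h y = \int[L n]_x (h (tailsum x) * ((2 ^+ n)%R)%:E).
  by move=> mh h0; apply: HW => // y [i []].
have mg : cmeas (fun x : n.-tuple RT => f (tailsum x) * ((2 ^+ n)%:C)%C)%R.
  by apply: cmeasM; [exact: cmeas_comp mf mp|exact: cmeas_cst].
exact: (transfer_cintegral W0 tr mf.1 mf.2 mg).
Qed.

(** Measurability of [f] on the orthant is read off from its pullback [g], by composing with the
    coordinatewise logarithm. *)
Lemma cintegral_orthant n (f g : n.-tuple RT -> R[i]) : cmeas g ->
  (forall x, g x = f (texp x) * ((\prod_(i < n) expR (tnth x i))%R%:C)%C)%R ->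
  cintegral (L n) (@positive_orthant R n) f = cintegral (L n) setT g /\
  (cintegrable (L n) (@positive_orthant R n) f <-> cintegrable (L n) setT g).
Proof.
move=> mg gE; have [mp mW W0 HW] := subst_texp n.
have mo := @measurable_positive_orthant n.
pose tln (y : n.-tuple RT) : n.-tuple RT := [tuple ln (tnth y i) | i < n].
have mln : measurable_fun setT tln.
  apply/measurable_fun_tnthP => i.
  rewrite (_ : _ \o _ = (fun x : n.-tuple RT => ln (tnth x i))%R); last first.
    by apply/funext => x /=; rewrite tnth_mktuple.
  exact: measurableT_comp (@measurable_ln R) (@measurable_tnth _ _ _ i).
have tlnK y : positive_orthant y -> texp (tln y) = y.
  move=> yp; apply/eq_from_tnth => i; rewrite !tnth_mktuple lnK//.
  exact: yp.
pose k (x : n.-tuple RT) : R[i] := (g x * (((\prod_(i < n) expR (tnth x i))%R^-1%R)%:C)%C)%R.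
have mk : cmeas k.
  apply: cmeasM => //; apply: cmeas_real; under eq_fun do rewrite -prodfV.
  apply: measurable_prod => i _; under eq_fun do rewrite -expRN.
  apply: (measurableT_comp (@measurable_expR R)).
  by apply: measurableT_comp => //; exact: measurable_tnth.
have fk y : positive_orthant y -> f y = k (tln y).
  move=> yp; rewrite /k gE tlnK// RCV -mulrA mulfV ?mulr1//.
  by rewrite fmorph_eq0 prodf_seq_neq0; apply/allP => i _; rewrite gt_eqF ?expR_gt0.
have mfk := cmeas_comp mk mln.
have mf1 : measurable_fun (@positive_orthant R n) (fun y => re (f y)).
  apply: (@eq_measurable_fun _ _ _ _ _ (fun y => re (k (tln y)))) => [y /[!inE] yp|].
    by rewrite fk.
  by apply: measurable_funTS; exact: mfk.1.
have mf2 : measurable_fun (@positive_orthant R n) (fun y => im (f y)).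
  apply: (@eq_measurable_fun _ _ _ _ _ (fun y => im (k (tln y)))) => [y /[!inE] yp|].
    by rewrite fk.
  by apply: measurable_funTS; exact: mfk.2.
have tr (h : n.-tuple RT -> \bar R) : measurable_fun (@positive_orthant R n) h ->
    (forall y, 0 <= h y) ->
    \int[L n]_(y in @positive_orthant R n) h y =
    \int[L n]_x (h (texp x) * ((\prod_(i < n) expR (tnth x i))%R)%:E).
  move=> mh h0; rewrite integral_mkcond (HW (h \_ (@positive_orthant R n))).
  - apply: eq_integral => x _; rewrite patchE mem_set// => i.
    by rewrite tnth_mktuple expR_gt0.
  - by apply/(measurable_restrictT _ mo).
  - by move=> y; rewrite patchE; case: ifP.
  - move=> y [i Di]; rewrite patchE memNset// => yp; apply: Di.
    by rewrite /= in_itv/= andbT; exact: yp.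
exact: (transfer_cintegral W0 tr mf1 mf2 mg gE).
Qed.

Lemma cintegral_tuple0 (f : 0.-tuple RT -> R[i]) :
  cintegral (L 0) setT f = f [tuple] /\ cintegrable (L 0) setT f.
Proof.
have E : f = (fun=> f [tuple]) by apply/funext => x; rewrite (tuple0 x).
have mf : cmeas f by rewrite E; exact: cmeas_cst.
split.
  by apply: complexP; rewrite /= /Rintegral integral_tuple0//; apply/measurable_EFinP; [exact: mf.1|exact: mf.2].
apply/cintegrableTP; split => //; rewrite integral_tuple0 ?ltry//.
by apply/measurable_EFinP; exact: measurable_normc.
Qed.

(** [F] is indexed by [nat] rather than by ordinals, so that the induction can pass to the shifted
    family. *)
Lemma cintegral_tuple_prod n (F : nat -> R -> R[i]) :
  (forall i, cintegrable leb setT (F i : RT -> R[i])) ->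
  cintegrable (L n) setT (fun x => \prod_(i < n) F i (tnth x i))%R /\
  (cintegral (L n) setT (fun x => \prod_(i < n) F i (tnth x i)) =
  \prod_(i < n) cintegral leb setT (F i))%R.
Proof.
elim: n F => [|n IH] F iF.
  have [-> ?] := @cintegral_tuple0 (fun x => \prod_(i < 0) F i (tnth x i))%R.
  by rewrite !big_ord0.
have [i1 e1] := IH (fun i => F i.+1) (fun i => iF i.+1).
have [i2 e2] := cintegral_prod (iF 0%N) i1.
have mc := @measurable_tcons n.
have tr (h : n.+1.-tuple RT -> \bar R) : measurable_fun setT h -> (forall y, 0 <= h y) ->
    \int[L n.+1]_(y in setT) h y = \int[(leb \x L n)]_x (h (tcons x) * (1%R)%:E).
  move=> mh h0.
  transitivity (\int[pushforward (leb \x L n) (@tcons n)]_x h x); first by [].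
  rewrite (ge0_integral_pushforward mc)// preimage_setT.
  by apply: eq_integral => x _; rewrite mule1.
have mf : cmeas (fun x : n.+1.-tuple RT => \prod_(i < n.+1) F i (tnth x i))%R.
  apply: cmeas_prod => i.
  by apply: cmeas_comp (@measurable_tnth _ _ _ i); case/cintegrableTP: (iF i).
have [mg _] := (cintegrableTP _ _).1 i2.
have gE x : (F 0%N x.1 * \prod_(i < n) F i.+1 (tnth x.2 i) =
   (\prod_(i < n.+1) F i (tnth (tcons x) i)) * ((1%R)%:C)%C)%R.
  rewrite mulr1 big_ord_recl tnth0; congr (_ * _)%R.
  by apply: eq_bigr => i _; rewrite tnthS.
have [-> ->] := @transfer_cintegral _ _ _ _ _ (leb \x L n) (L n.+1) setT (@tcons n) (fun=> 1%R)
  (fun=> ler01) tr _ _ mf.1 mf.2 mg gE.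
by rewrite e2 e1 big_ord_recl.
Qed.

End tuple_integral.

(** * The function gam *)

Section line_integral.
Context {R : realType}.
Local Notation leb := (@lebesgue_measure R).
Local Notation RT := (measurableTypeR R).

Lemma cintegral_shift (b : R) (f : RT -> R[i]) : cmeas f ->
  cintegral leb setT f = cintegral leb setT (fun x => f (x + b)) /\
  (cintegrable leb setT f <-> cintegrable leb setT (fun x => f (x + b))).
Proof.
move=> mf.
have mp : measurable_fun setT ((fun x => x + b) : RT -> RT) by exact: measurable_funD.
have tr (h : RT -> \bar R) : measurable_fun setT h -> (forall y, 0 <= h y)%E ->
    (\int[leb]_(y in setT) h y = \int[leb]_x (h (x + b)%R * (1%R)%:E))%E.
  move=> mh h0; rewrite (ge0_integral_affine b ltr01 mh h0).
  by apply: eq_integral => x _; rewrite mul1r.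
apply: (transfer_cintegral (fun=> ler01) tr mf.1 mf.2 (cmeas_comp mf mp)).
by move=> x; rewrite mulr1.
Qed.

Lemma cintegral_reflect (b : R) (f : RT -> R[i]) : cmeas f ->
  cintegral leb setT f = cintegral leb setT (fun x => f (b - x)) /\
  (cintegrable leb setT f <-> cintegrable leb setT (fun x => f (b - x))).
Proof.
move=> mf.
have mp : measurable_fun setT ((fun x => b - x) : RT -> RT) by exact: measurable_funB.
have tr (h : RT -> \bar R) : measurable_fun setT h -> (forall y, 0 <= h y)%E ->
    (\int[leb]_(y in setT) h y = \int[leb]_x (h (b - x)%R * (1%R)%:E))%E.
  move=> mh h0; rewrite (ge0_integral_reflect b mh h0).
  by apply: eq_integral => x _; rewrite mule1.
apply: (transfer_cintegral (fun=> ler01) tr mf.1 mf.2 (cmeas_comp mf mp)).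
by move=> x; rewrite mulr1.
Qed.

Lemma cintegral_halfline (f g : RT -> R[i]) : cmeas g ->
  (forall x, g x = f (expR x) * ((expR x)%:C)%C) ->
  cintegral leb `]0, +oo[ f = cintegral leb setT g.
Proof.
move=> mg gE.
have mD : measurable (`]0, +oo[%classic : set RT) by exact: measurable_itv.
pose k (x : RT) : R[i] := g x * ((expR (- x))%:C)%C.
have mk : cmeas k.
  apply: cmeasM => //; apply: cmeas_real; apply: measurableT_comp (@measurable_expR R) _.
  exact: measurable_funN.
have fk (y : RT) : 0 < y -> f y = k (ln y).
  move=> y0; rewrite /k gE lnK// -mulrA -RCM expRN lnK// mulfV ?mulr1// ?gt_eqF//.
have mfk := cmeas_comp mk (@measurable_ln R).
have mf1 : measurable_fun (`]0, +oo[%classic : set RT) (fun y => re (f y)).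
  apply: (@eq_measurable_fun _ _ _ _ _ (fun y => re (k (ln y)))) => [y|].
    by rewrite inE/= in_itv/= andbT => y0; rewrite fk.
  by apply: measurable_funTS; exact: mfk.1.
have mf2 : measurable_fun (`]0, +oo[%classic : set RT) (fun y => im (f y)).
  apply: (@eq_measurable_fun _ _ _ _ _ (fun y => im (k (ln y)))) => [y|].
    by rewrite inE/= in_itv/= andbT => y0; rewrite fk.
  by apply: measurable_funTS; exact: mfk.2.
have tr (h : RT -> \bar R) : measurable_fun (`]0, +oo[%classic : set RT) h ->
    (forall y, 0 <= h y)%E ->
    (\int[leb]_(y in `]0%R, +oo[) h y = \int[leb]_x (h (expR x) * (expR x)%:E))%E.
  move=> mh h0; rewrite integral_mkcond (@ge0_integral_expR R (h \_ `]0%R, +oo[)).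
  - by apply: eq_integral => x _; rewrite patchE mem_set//= in_itv/= andbT expR_gt0.
  - by apply/(measurable_restrictT _ mD).
  - by move=> y; rewrite patchE; case: ifP.
  - by move=> y y0; rewrite patchE memNset//= in_itv/= andbT; apply/negP; rewrite -leNgt.
by have [] := @transfer_cintegral _ _ RT RT R leb leb `]0, +oo[ (@expR R) (@expR R)
  (@expR_ge0 R) tr f g mf1 mf2 mg gE.
Qed.

(** Up to the factor [1 / e], the exponential density and its mirror image together majorize the
    integrand. *)
Lemma integrable_expRNabs (e : R) : 0 < e -> (\int[leb]_x (expR (- (e * `|x|)))%:E < +oo)%E.
Proof.
move=> e0; have /integrableP[mp ip] := integrable_exponential_pdf e0.
have mp' : measurable_fun [set: RT] (exponential_pdf e : RT -> R) by exact/measurable_EFinP.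
have mpN : measurable_fun [set: RT] ((fun x => exponential_pdf e (- x)) : RT -> R).
  by apply: measurableT_comp => //; exact: measurable_funN.
have pge x : 0 <= exponential_pdf e x by exact/exponential_pdf_ge0/ltW.
apply: (@le_lt_trans _ _ (\int[leb]_x ((e^-1)%:E * ((exponential_pdf e x)%:E + (exponential_pdf e (- x)%R)%:E)))%E).
  apply: ge0_le_integral => //.
  - apply/measurable_EFinP; apply: (measurableT_comp (@measurable_expR R)).
    apply: measurable_funN; apply: measurable_funM => //; exact: normr_measurable.
  - apply: emeasurable_funM => //; apply: emeasurable_funD; exact/measurable_EFinP.
  - move=> x _; rewrite -EFinD -EFinM lee_fin.
    have pE y : 0 <= y -> exponential_pdf e y = e * expR (- e * y).
      by move=> y0; rewrite exponential_pdfE.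
    rewrite ler_pdivlMl// mulrC.
    have [x0|x0] := leP 0 x.
      by rewrite (pE x)// ger0_norm// mulNr mulrC lerDl.
    rewrite ltr0_norm// mulrN opprK (pE (- x)); last by rewrite oppr_ge0 ltW.
    by rewrite mulrNN (mulrC e (expR _)) lerDr.
rewrite ge0_integralZl//; last 3 first.
- by apply: emeasurable_funD; exact/measurable_EFinP.
- by move=> x _; rewrite -EFinD lee_fin addr_ge0.
- by rewrite lee_fin invr_ge0 ltW.
apply: lte_mul_pinfty => //; first by rewrite lee_fin invr_ge0 ltW.
rewrite ge0_integralD//; try exact/measurable_EFinP.
  have E : (\int[leb]_x (exponential_pdf e x)%:E < +oo)%E.
    apply: le_lt_trans ip; apply: ge0_le_integral => //.
    - by move=> x _; rewrite lee_fin.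
    - exact: measurableT_comp.
    - by move=> x _; rewrite lee_fin ler_norm.
  apply: lte_add_pinfty; first exact: E.
  rewrite (_ : (\int[leb]_x _)%E = (\int[leb]_x (exponential_pdf e x)%:E)%E); first exact: E.
  rewrite [RHS](ge0_integral_reflect 0); [|exact/measurable_EFinP|by move=> x; rewrite lee_fin].
  by apply: eq_integral => x _; rewrite sub0r.
- by move=> x _; rewrite lee_fin.
- by move=> x _; rewrite lee_fin.
Qed.

Lemma cmeas_id_real : cmeas (fun x : RT => (x%:C)%C : R[i]).
Proof. exact: cmeas_real. Qed.

(** For [A, C > 0] its integral over the line is [2 (C / A)^(p / 2) K_p(2 pi sqrt(A C))]; for
    [C = 0] it becomes a Gamma integral. *)
Definition bker (p : R[i]) (A C x : R) : R[i] :=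
  cexp (p * (x%:C)%C - ((pi * (expR x * A + expR (- x) * C))%:C)%C).

Lemma cmeas_bker (p : R[i]) (A C : R) : cmeas (bker p A C : RT -> R[i]).
Proof.
apply: cmeas_cexp; apply: cmeasD.
  by apply: cmeasM; [exact: cmeas_cst|exact: cmeas_id_real].
apply: cmeasN; apply: cmeas_real; apply: measurable_funM => //.
have mN : measurable_fun setT ((fun x => expR (- x)) : RT -> R).
  by apply: measurableT_comp (@measurable_expR R) _; exact: measurable_funN.
have mE : measurable_fun setT ((fun x => expR x) : RT -> R) by exact: measurable_expR.
by apply: measurable_funD; apply: measurable_funM.
Qed.

Lemma normc_bker p A C x : normc (bker p A C x) =
  expR (re p * x - pi * (expR x * A + expR (- x) * C)).
Proof. by rewrite normc_cexp ReD ReN ReM /= mulr0 subr0. Qed.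

Let sqr_le_expR (x : R) : 0 <= x -> x ^+ 2 / 2 <= expR x.
Proof. by move=> x0; have := expR_ge1Dxn 1 x0; rewrite (_ : 2`! = 2%N)//; lra. Qed.

Let quad_le (s k x : R) : 0 < k -> s * x - k * x ^+ 2 <= s ^+ 2 / (4 * k).
Proof.
move=> k0; rewrite ler_pdivlMr ?mulr_gt0//.
by have := sqr_ge0 (s - 2 * k * x); rewrite !sqrrD; nra.
Qed.

(** The modulus is at most [exp (B - e |x|)]: to the right [A e^x] dominates, to the left either
    [C e^(-x)] does or [e^(p x)] decays by itself. *)
Lemma cintegrable_bker (p : R[i]) (A C : R) : 0 < A -> 0 <= C -> (0 < C \/ 0 < re p) ->
  cintegrable leb setT (bker p A C : RT -> R[i]).
Proof.
move=> A0 C0 pC; set r := re p.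
have p0 : 0 < pi :> R := pi_gt0 R.
have [e e0 [B HB]] : exists2 e, 0 < e & exists B, forall x,
    r * x - pi * (expR x * A + expR (- x) * C) <= B - e * `|x|.
  (* With [e^x >= x^2 / 2], the constant is the maximum of [(r + e) x - (pi A / 2) x^2]. *)
  have pos e x : 0 <= x -> r * x - pi * (expR x * A + expR (- x) * C) <=
      (r + e) ^+ 2 / (4 * (pi * A / 2)) - e * x.
    move=> x0; have := quad_le (r + e) x (_ : 0 < pi * A / 2).
    rewrite divr_gt0 ?mulr_gt0// => /(_ isT).
    have := ler_wpM2l (ltW (mulr_gt0 p0 A0)) (sqr_le_expR x0).
    have : 0 <= pi * (expR (- x) * C) by rewrite !mulr_ge0 ?expR_ge0// ltW.
    by set u := _ / (4 * _); lra.
  case: pC => [C0'|r0].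
    exists 1 => //; exists ((r + 1) ^+ 2 / (4 * (pi * A / 2)) + (1 - r) ^+ 2 / (4 * (pi * C / 2))) => x.
    have u0 : 0 <= (r + 1) ^+ 2 / (4 * (pi * A / 2)).
      by rewrite divr_ge0 ?sqr_ge0// !mulr_ge0// ltW// divr_gt0 ?mulr_gt0.
    have v0 : 0 <= (1 - r) ^+ 2 / (4 * (pi * C / 2)).
      by rewrite divr_ge0 ?sqr_ge0// !mulr_ge0// ltW// divr_gt0 ?mulr_gt0.
    have [x0|x0] := leP 0 x.
      by have := pos 1 x x0; rewrite ger0_norm//; lra.
    have y0 : 0 <= - x by rewrite oppr_ge0 ltW.
    have := quad_le (1 - r) (- x) (_ : 0 < pi * C / 2).
    rewrite divr_gt0 ?mulr_gt0// => /(_ isT).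
    have := ler_wpM2l (ltW (mulr_gt0 p0 C0')) (sqr_le_expR y0).
    have : 0 <= pi * (expR x * A) by rewrite !mulr_ge0 ?expR_ge0// ltW.
    rewrite ltr0_norm//; move: u0 v0; set u := _ / (4 * _); set v := _ / (4 * _); lra.
  exists r => //; exists ((r + r) ^+ 2 / (4 * (pi * A / 2))) => x.
  have u0 : 0 <= (r + r) ^+ 2 / (4 * (pi * A / 2)).
    by rewrite divr_ge0 ?sqr_ge0// !mulr_ge0// ltW// divr_gt0 ?mulr_gt0.
  have [x0|x0] := leP 0 x.
    by have := pos r x x0; rewrite ger0_norm//; lra.
  rewrite ltr0_norm// mulrN opprK.
  have : 0 <= pi * (expR x * A + expR (- x) * C).
    by rewrite mulr_ge0 ?(ltW p0)// addr_ge0 ?mulr_ge0 ?expR_ge0 ?(ltW A0).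
  by lra.
apply: (@cintegrable_dom _ RT R leb _ (fun x : RT => (expR B)%:E * (expR (- (e * `|x|)))%:E)%E).
- exact: cmeas_bker.
- apply: emeasurable_funM => //; apply/measurable_EFinP.
  apply: (measurableT_comp (@measurable_expR R)).
  apply: measurable_funN; apply: measurable_funM => //; exact: normr_measurable.
- by move=> x; rewrite normc_bker -EFinM lee_fin -expRD ler_expR.
rewrite ge0_integralZl//.
- by apply: lte_mul_pinfty => //; exact: integrable_expRNabs.
- apply/measurable_EFinP; apply: (measurableT_comp (@measurable_expR R)).
  apply: measurable_funN; apply: measurable_funM => //; exact: normr_measurable.
Qed.

(** With [t = e^x] this is [pi^(-c) Gamma(c)] for [re c > 0]. *)
Definition gam (c : R[i]) : R[i] := cintegral leb setT (bker c 1 0 : RT -> R[i]).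

Lemma cintegrable_gam (c : R[i]) : 0 < re c -> cintegrable leb setT (bker c 1 0 : RT -> R[i]).
Proof. by move=> c0; apply: cintegrable_bker => //; right. Qed.

Lemma cintegral_bker0 (p : R[i]) (A : R) : 0 < A -> 0 < re p ->
  cintegral leb setT (bker p A 0 : RT -> R[i]) = cexp (- p * ((ln A)%:C)%C) * gam p.
Proof.
move=> A0 p0; rewrite /gam -cintegralZl; last exact: cintegrable_gam.
rewrite (cintegral_shift (- ln A) (cmeas_bker p A 0)).1.
apply: eq_cintegral => x _; rewrite /bker -cexpD; congr cexp.
rewrite !mulr0 !addr0 expRD expRN lnK// -mulrA mulVf ?gt_eqF// RCD RCN; ring.
Qed.

(** The reflection [x |-> ln (C / A) - x] interchanges the two terms [A e^x] and [C e^(-x)]; this is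
    the symmetry [K_p = K_(-p)]. *)
Lemma cintegral_bker_reflect (p : R[i]) (A C : R) : 0 < A -> 0 < C ->
  cintegral leb setT (bker p A C : RT -> R[i]) =
  cexp (p * ((ln C - ln A)%:C)%C) * cintegral leb setT (bker (- p) A C : RT -> R[i]).
Proof.
move=> A0 C0; rewrite -cintegralZl; last by apply: cintegrable_bker => //; [exact: ltW|left].
rewrite (cintegral_reflect (ln C - ln A) (cmeas_bker p A C)).1.
apply: eq_cintegral => x _; rewrite /bker -cexpD; congr cexp.
have -> : expR (ln C - ln A - x) * A = expR (- x) * C.
  by rewrite !expRD !expRN !lnK//; field; rewrite !gt_eqF ?expR_gt0.
have -> : expR (- (ln C - ln A - x)) * C = expR x * A.
  by rewrite !expRN !expRD !expRN !lnK//; field; rewrite !gt_eqF ?expR_gt0.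
rewrite (addrC (expR x * A)) !RCD !RCN; ring.
Qed.


(** Stands in for integration by parts with vanishing boundary terms; no limit of [f] at infinity is
    taken. *)
Lemma cintegral_derive0 (f df : R -> R[i]) :
  (forall x : R, is_derive x (1 : R) (fun x : R => re (f x) : R) (re (df x))) ->
  (forall x : R, is_derive x (1 : R) (fun x : R => im (f x) : R) (im (df x))) ->
  continuous (fun x : R => re (df x) : R) ->
  continuous (fun x : R => im (df x) : R) ->
  cintegrable leb setT (f : RT -> R[i]) -> cintegrable leb setT (df : RT -> R[i]) ->
  cintegral leb setT (df : RT -> R[i]) = 0.
Proof.
move=> d1 d2 c1 c2 fi dfi; have [mdf df_oo] := (cintegrableTP _ _).1 dfi.
have [mf _] := (cintegrableTP _ _).1 fi.
pose I01 (t : RT) : R := \1_(`[0, 1]%classic : set R) t.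
have mI01 : measurable_fun [set: RT] I01 by apply: measurable_indic; exact: measurable_itv.
have I01_ge0 t : 0 <= I01 t by rewrite /I01 indicE; case: (_ \in _).
have intI01 : (\int[leb]_t (I01 t)%:E = 1)%E.
  rewrite integral_indic//.
  by rewrite setIT /= lebesgue_measure_itv/= lte_fin ltr01 oppr0 adde0.
have iI01 : leb.-integrable setT (EFin \o I01).
  apply/integrableP; split; first exact/measurable_EFinP.
  by under eq_integral do rewrite /= ger0_norm//; rewrite intI01 ltry.
pose h (z : RT * RT) : R[i] := df (z.1 + z.2) * ((I01 z.2)%:C)%C.
have mh : cmeas h.
  apply: cmeasM.
    apply: (@cmeas_comp _ _ _ _ _ _ (fun z : RT * RT => z.1 + z.2) mdf).
    by apply: measurable_funD; [exact: measurable_fst|exact: measurable_snd].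
  by apply: cmeas_real; exact: measurableT_comp mI01 measurable_snd.
(* The two iterated integrals of [df (x + t)] over [t \in [0, 1]] are
   [int df] and, by translation invariance, [int f - int f]. *)
have FTC (F G : R -> R) (x : R) : (forall x : R, is_derive x (1 : R) F (G x)) -> continuous G ->
    \int[leb]_t (G (x + t) * I01 t) = F (x + 1) - F x.
  move=> dF cG.
  have -> : \int[leb]_t (G (x + t) * I01 t) = \int[leb]_(t in `[0, 1]) G (x + t).
    rewrite [RHS]Rintegral_mkcond; apply: eq_Rintegral => t _.
    by rewrite patchE /I01 indicE; case: ifP => _; rewrite ?mulr1 ?mulr0.
  have dFx (t : R) : is_derive t (1 : R) (fun t : R => F (x + t)) (G (x + t)).
    have := @is_derive1_comp _ F (fun t => x + t) t _ _ (dF (x + t)) (is_deriveD (is_derive_cst x t 1) (is_derive_id t 1)).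
    by rewrite add0r mulr1.
  rewrite /Rintegral (@continuous_FTC2 _ (fun t => G (x + t)) (fun t => F (x + t)))//.
  - by rewrite -EFinB /= addr0.
  - apply: continuous_subspaceT => t; apply: continuous_comp; last exact: cG.
    by apply: continuousD => //; exact: cst_continuous.
  - have cF : continuous (fun t => F (x + t)).
      by move=> t; apply/differentiable_continuous/derivable1_diffP; have [] := dFx t.
    split.
    + by move=> t _; have [] := dFx t.
    + by apply: cvg_at_right_filter; exact: cF.
    + by apply: cvg_at_left_filter; exact: cF.
  - by move=> t _; rewrite derive1E; have [_ ->] := dFx t.
have E1 : cintegral leb setT (fun x => cintegral leb setT (fun t => h (x, t))) = 0.
  have -> : (fun x => cintegral leb setT (fun t => h (x, t))) = (fun x => f (x + 1) + (-1) * f x).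
    apply/funext => x; apply: complexP => /=; rewrite /h /=.
      under eq_Rintegral do rewrite ReM /= mulr0 subr0.
      by rewrite (FTC _ _ _ d1 c1) ReD mulN1r ReN.
    under eq_Rintegral do rewrite ImM /= mulr0 add0r.
    by rewrite (FTC _ _ _ d2 c2) ImD mulN1r ImN.
  have [e1 [i1 _]] := cintegral_shift 1 mf.
  rewrite cintegralD; [|exact: i1|exact: cintegrableZl].
  by rewrite -e1 cintegralZl// mulN1r subrr.
have E2 : cintegral leb setT (fun t => cintegral leb setT (fun x => h (x, t))) =
    cintegral leb setT (df : RT -> R[i]).
  have -> : (fun t => cintegral leb setT (fun x => h (x, t))) =
      (fun t => cintegral leb setT (df : RT -> R[i]) * ((I01 t)%:C)%C).
    apply/funext => t; rewrite /h /=.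
    have [e1 [i1 _]] := cintegral_shift t mdf.
    by rewrite cintegralZr -?e1//; exact: i1.
  have iC : cintegrable leb setT (fun t => ((I01 t)%:C)%C : R[i]).
    by split => //=; exact: integrable0.
  by rewrite cintegralZl// cintegral_real /Rintegral intI01 mulr1.
rewrite -E2 -E1; apply/esym.
apply: (@cfubini _ _ RT RT R leb leb h (fun z => (normc (h z))%:E)) => //.
  by apply/measurable_EFinP; exact: measurable_normc.
rewrite (@fubini_tonelli _ _ RT RT R leb leb (fun z => (normc (h z))%:E)); last 2 first.
- by apply/measurable_EFinP; exact: measurable_normc.
- by move=> z; rewrite lee_fin normc_ge0.
have mn : measurable_fun [set: RT] (fun x : RT => (normc (df x))%:E).
  by apply/measurable_EFinP; exact: measurable_normc.
have -> : (\int[leb]_y \int[leb]_x (normc (h (x, y)))%:E =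
    \int[leb]_y ((\int[leb]_x (normc (df x))%:E) * (I01 y)%:E))%E.
  apply: eq_integral => t _; rewrite /h /=.
  under eq_integral do rewrite normc_mul normc_real (ger0_norm (I01_ge0 t)) EFinM.
  rewrite ge0_integralZr//; last 3 first.
  - by apply: (measurableT_comp mn); exact: measurable_funD.
  - by move=> x _; rewrite lee_fin normc_ge0.
  - by rewrite lee_fin.
  congr (_ * _)%E; rewrite [RHS](ge0_integral_affine t ltr01)//.
    by apply: eq_integral => x _; rewrite mule1 mul1r.
  by move=> x; rewrite lee_fin normc_ge0.
rewrite ge0_integralZl//; last 3 first.
- exact/measurable_EFinP.
- by move=> x _; rewrite lee_fin.
- by apply: integral_ge0 => x _; rewrite lee_fin normc_ge0.
by rewrite intI01 mule1.
Qed.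

(** The derivative of [bker c 1 0] is [(c - pi e^x) bker c 1 0 = c bker c 1 0 - pi bker (c + 1) 1
    0], and its integral vanishes. *)
Lemma gamD1 (c : R[i]) : 0 < re c -> gam (c + 1) = c / (pi%:C)%C * gam c.
Proof.
move=> c0; set a := re c; set b := im c.
have p0 : (pi%:C)%C != 0 :> R[i] by rewrite fmorph_eq0 gt_eqF// pi_gt0.
pose df x : R[i] := c * bker c 1 0 x - (pi%:C)%C * bker (c + 1) 1 0 x.
have c10 : 0 < re (c + 1) by rewrite ReD /= addr_gt0.
suff : cintegral leb setT (df : RT -> R[i]) = 0.
  rewrite /df cintegralD; last 2 first.
  - by apply: cintegrableZl; exact: cintegrable_gam.
  - rewrite (_ : (fun x => _) = (fun x => - (pi%:C)%C * bker (c + 1) 1 0 x)); last first.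
      by apply/funext => x; rewrite mulNr.
    by apply: cintegrableZl; exact: cintegrable_gam.
  under [X in _ + X = _ -> _]eq_cintegral do rewrite -mulNr.
  rewrite !cintegralZl; [|exact: cintegrable_gam..].
  rewrite mulNr => /eqP; rewrite subr_eq0 => /eqP E.
  by rewrite mulrAC [c * gam c]E mulrAC mulfV ?mul1r.
have p1E x : bker (c + 1) 1 0 x = ((expR x)%:C)%C * bker c 1 0 x.
  by rewrite -cexp_real /bker -cexpD; congr cexp; rewrite mulrDl mul1r; ring.
have reE x : re (bker c 1 0 x) = expR (a * x - pi * expR x) * cos (b * x).
  by rewrite Re_cexp ReD ReN ReM ImD ImN ImM /= !mulr0 mulr1 subr0 addr0 add0r subr0.
have imE x : im (bker c 1 0 x) = expR (a * x - pi * expR x) * sin (b * x).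
  by rewrite Im_cexp ReD ReN ReM ImD ImN ImM /= !mulr0 mulr1 subr0 addr0 add0r subr0.
have dk (x : R) : is_derive x (1 : R) (fun x : R => a * x - pi * expR x) (a - pi * expR x).
  have := is_deriveB (is_deriveZ a (is_derive_id x (1 : R))) (is_deriveZ pi (is_derive_expR x)).
  by move=> h; apply: is_derive_eq h _; rewrite /GRing.scale /= mulr1.
have dek (x : R) : is_derive x (1 : R) (fun x : R => expR (a * x - pi * expR x))
    (expR (a * x - pi * expR x) * (a - pi * expR x)).
  exact: is_derive1_comp (is_derive_expR _) (dk x).
have db (x : R) : is_derive x (1 : R) (fun x : R => b * x) b.
  by apply: is_derive_eq (is_deriveZ b (is_derive_id x (1 : R))) _; rewrite /GRing.scale /= mulr1.
have dc (x : R) : is_derive x (1 : R) (fun x : R => cos (b * x)) (- sin (b * x) * b).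
  exact: is_derive1_comp (is_derive_cos _) (db x).
have ds (x : R) : is_derive x (1 : R) (fun x : R => sin (b * x)) (cos (b * x) * b).
  exact: is_derive1_comp (is_derive_sin _) (db x).
have cont (F : R -> R) (G : R -> R) : (forall x : R, is_derive x (1 : R) F (G x)) -> continuous F.
  by move=> dF x; apply/differentiable_continuous/derivable1_diffP; have [] := dF x.
have c1 := cont _ _ dek; have c2 := cont _ _ dc; have c3 := cont _ _ ds.
have dfE x : df x = (c - (pi * expR x)%:C%C) * bker c 1 0 x.
  by rewrite /df p1E RCM; ring.
have cak : continuous (fun x : R => a - pi * expR x).
  exact: (cont _ _ (fun x => is_deriveB (is_derive_cst a x (1 : R)) (is_deriveZ pi (is_derive_expR x)))).
apply: (@cintegral_derive0 (bker c 1 0)).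
- move=> x; rewrite dfE ReM reE imE ReD ImD ReN ImN /= subr0 -/a -/b.
  rewrite (_ : (fun x => _) = (fun x => expR (a * x - pi * expR x) * cos (b * x))); last exact/funext.
  apply: is_derive_eq (is_deriveM (dek x) (dc x)) _; rewrite /GRing.scale /=; ring.
- move=> x; rewrite dfE ImM reE imE ReD ImD ReN ImN /= subr0 -/a -/b.
  rewrite (_ : (fun x => _) = (fun x => expR (a * x - pi * expR x) * sin (b * x))); last exact/funext.
  apply: is_derive_eq (is_deriveM (dek x) (ds x)) _; rewrite /GRing.scale /=; ring.
- rewrite (_ : (fun x => _) = (fun x : R => (a - pi * expR x) * (expR (a * x - pi * expR x) * cos (b * x)) -
    b * (expR (a * x - pi * expR x) * sin (b * x)))); last first.
    by apply/funext => x; rewrite dfE ReM reE imE ReD ImD ReN ImN /= subr0 -/a -/b.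
  move=> x; apply: cvgB; apply: cvgM.
  + exact: cak.
  + by apply: cvgM; [exact: c1|exact: c2].
  + exact: cvg_cst.
  + by apply: cvgM; [exact: c1|exact: c3].
- rewrite (_ : (fun x => _) = (fun x : R => (a - pi * expR x) * (expR (a * x - pi * expR x) * sin (b * x)) +
    b * (expR (a * x - pi * expR x) * cos (b * x)))); last first.
    by apply/funext => x; rewrite dfE ImM reE imE ReD ImD ReN ImN /= subr0 -/a -/b.
  move=> x; apply: cvgD; apply: cvgM.
  + exact: cak.
  + by apply: cvgM; [exact: c1|exact: c3].
  + exact: cvg_cst.
  + by apply: cvgM; [exact: c1|exact: c2].
- exact: cintegrable_gam.
- rewrite (_ : df = (fun x => c * bker c 1 0 x + - (pi%:C)%C * bker (c + 1) 1 0 x)); last first.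
    by apply/funext => x; rewrite mulNr.
  by apply: cintegrableD; apply: cintegrableZl; exact: cintegrable_gam.
Qed.

Lemma gamDn (c : R[i]) n : 0 < re c ->
  gam c = gam (c + n%:R) * \prod_(i < n) ((pi%:C)%C / (c + i%:R)).
Proof.
move=> c0; have p0 : (pi%:C)%C != 0 :> R[i] by rewrite fmorph_eq0 gt_eqF// pi_gt0.
have Ren k : re (c + k%:R) = re c + k%:R by rewrite ReD -RCnat.
have cn0 k : 0 < re (c + k%:R) by rewrite Ren ltr_wpDr.
elim: n => [|n IH]; first by rewrite addr0 big_ord0 mulr1.
rewrite big_ord_recr /= IH (_ : c + n.+1%:R = c + n%:R + 1); last by rewrite -addrA natr1.
rewrite gamD1//.
have n0 : c + n%:R != 0 by apply: contraTneq (cn0 n) => ->; rewrite ltxx.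
set P := \prod_(i < n) _; set w := c + n%:R.
have -> : w / (pi%:C)%C * gam w * (P * ((pi%:C)%C / w)) =
    gam w * P * ((w / (pi%:C)%C) * ((pi%:C)%C / w)) by ring.
by rewrite (mulrA (w / _)) divfK// mulfV// mulr1.
Qed.

Lemma Euler_integral_gam (z : R[i]) : 0 < re z ->
  Euler_integral z = cexp (z * ((ln pi)%:C)%C) * gam z.
Proof.
move=> z0; have p0 := pi_gt0 R.
rewrite /Euler_integral (cintegral_halfline (cmeas_bker z pi^-1 0)).
  by rewrite cintegral_bker0 ?invr_gt0// lnV ?posrE// RCN mulrNN.
move=> x; rewrite cpow_expR -mulrA -RCM divfK ?gt_eqF ?expR_gt0// -cexp_real -cexpD.
by congr cexp; rewrite mulr0 addr0 mulrCA divff ?gt_eqF// mulr1 RCN.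
Qed.

(** [Gamma] shifts by the least possible [N]; the functional equation enlarges it to any admissible
    [M], so that one [M] serves a whole neighbourhood. At a pole both sides contain the inverse of
    zero and vanish. *)
Lemma GammaR_gam (s : R[i]) M : 0 < re (s / 2) + M%:R ->
  GammaR s = gam (s / 2 + M%:R) * \prod_(i < M) ((pi%:C)%C / (s / 2 + i%:R)).
Proof.
have p0 : (pi%:C)%C != 0 :> R[i] by rewrite fmorph_eq0 gt_eqF// pi_gt0.
rewrite /GammaR /Gamma mulNr; move: (s / 2) => z zM {s}.
set N := if 0 < re z then 0%N else _.
have Ren k : re (z + k%:R) = re z + k%:R by rewrite ReD -RCnat.
have NM : (N <= M)%N.
  rewrite /N; case: ifPn => // z0; rewrite -leNgt in z0.
  rewrite -(ltr_nat R); apply: (@le_lt_trans _ _ (- re z)).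
    have z0' : 0 <= - re z by rewrite oppr_ge0.
    by have /andP[] := truncn_itv z0'.
  by move: zM; lra.
have zN : 0 < re (z + N%:R).
  rewrite Ren /N; case: ifPn => [|_]; first by rewrite addr0.
  by have := truncnS_gt (- re z); rewrite -subr_gt0 opprK addrC.
rewrite Euler_integral_gam// cpowE.
have -> : cexp (- z * ((ln pi)%:C)%C) * (cexp ((z + N%:R) * ((ln pi)%:C)%C) * gam (z + N%:R) / \prod_(i < N) (z + i%:R)) =
    gam (z + N%:R) * \prod_(i < N) ((pi%:C)%C / (z + i%:R)).
  rewrite big_split /= prodr_const card_ord -prodfV.
  rewrite [LHS]mulrA [cexp _ * _]mulrA -cexpD.
  have -> : - z * ((ln pi)%:C)%C + (z + N%:R) * ((ln pi)%:C)%C = ((N%:R * ln pi)%:C)%C.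
    by rewrite RCM RCnat; ring.
  rewrite cexp_real expRM_natl lnK ?posrE ?pi_gt0//.
  by rewrite (mulrC _ (gam _)) rmorphXn mulrA.
rewrite (gamDn (M - N) zN) -addrA -natrD subnKC// -mulrA; congr (_ * _).
rewrite -[RHS](big_mkord xpredT (fun i => (pi%:C)%C / (z + i%:R))).
rewrite [RHS](@big_cat_nat _ _ _ N)//= [RHS]mulrC; congr (_ * _); last by rewrite big_mkord.
rewrite -[in RHS](add0n N) big_addn big_mkord; apply: eq_bigr => i _.
by rewrite -addrA -natrD addnC.
Qed.

Definition gamR (a : R) : R := \int[leb]_x expR (a * x - pi * expR x).

Let kerR (a : R) (x : RT) : R := expR (a * x - pi * expR x).

Let bkerR a x : bker (a%:C)%C 1 0 x = ((kerR a x)%:C)%C.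
Proof. by rewrite /bker -cexp_real; congr cexp; rewrite mulr0 addr0 mulr1 -RCM RCD RCN. Qed.

Lemma gam_real a : gam (a%:C)%C = ((gamR a)%:C)%C.
Proof. by rewrite /gam -cintegral_real; apply: eq_cintegral => x _; exact: bkerR. Qed.

Let ikerR a : 0 < a -> leb.-integrable setT (EFin \o kerR a).
Proof.
move=> a0; have [h _] := @cintegrable_gam (a%:C)%C a0.
by apply: eq_integrable h => // x _; rewrite bkerR.
Qed.

Lemma gamR_D1 a : 0 < a -> gamR (a + 1) = a / pi * gamR a.
Proof.
move=> a0; apply: (@complexI R); rewrite RCM RCM RCV -!gam_real -gamD1//.
by congr gam; rewrite RCD.
Qed.

(** On [[0, 1]] the exponent [a x - pi e^x] is at least [- pi e], whatever [a > 0] is. *)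
Lemma gamR_ge a : 0 < a -> expR (- (pi * expR 1)) <= gamR a.
Proof.
move=> a0; set K := expR _.
have iI : leb.-integrable setT (EFin \o (\1_(`[0, 1]%classic : set R) : RT -> R)).
  exact: integrable_indic_itv.
have -> : K = \int[leb]_x (K * \1_(`[0, 1]%classic : set R) x).
  rewrite RintegralZl// /Rintegral integral_indic// setIT /= lebesgue_measure_itv/= lte_fin ltr01.
  by rewrite oppr0 adde0 /= mulr1.
apply: le_Rintegral => //; last first.
- move=> x _; rewrite indicE mem_setE in_itv/=.
  have [/andP[x0 x1]|_] := boolP (0 <= x <= 1); last by rewrite mulr0 expR_ge0.
  rewrite mulr1 ler_expR -[leLHS]add0r lerD ?mulr_ge0 ?(ltW a0)// lerN2 ler_pM2l ?pi_gt0//.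
  by rewrite ler_expR.
- exact: ikerR.
- by apply: eq_integrable (integrableZl measurableT K iI) => // x _.
Qed.

Lemma sin_norm_le (t : R) : `|sin t| <= `|t|.
Proof.
wlog t0 : t / 0 <= t.
  move=> H; have [|t0] := leP 0 t; first exact: H.
  by rewrite -normrN -sinN -[leRHS]normrN H// oppr_ge0 ltW.
have [|c _] := @MVT_segment R sin cos 0 t t0 (fun x _ => is_derive_sin x).
  by apply: continuous_subspaceT => x; exact: continuous_sin.
rewrite sin0 !subr0 => ->; rewrite normrM ler_piMl//.
by rewrite ler_norml cos_geN1 cos_le1.
Qed.

Lemma cos_ge_sqr (y : R) : 1 - y ^+ 2 / 2 <= cos y.
Proof.
have -> : cos y = 1 - 2 * sin (y / 2) ^+ 2.
  by rewrite {1}(splitr y) cosD -!expr2 cos2sin2; ring.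
have : sin (y / 2) ^+ 2 <= (y / 2) ^+ 2.
  by rewrite -(real_normK (num_real (sin _))) -(real_normK (num_real (y / 2))) lerXn2r ?nnegrE// sin_norm_le.
by rewrite exprMn; lra.
Qed.

(** For [z = y / 2 >= 0] the right-hand side is [4 (e^z - e^(-z))^2], and [e^z - e^(-z) >= z].
    Exponentials are preferred to [y^2] because they only shift the parameter of [gamR]. *)
Lemma sqr_le_cosh (y : R) : y ^+ 2 <= 4 * (expR y + expR (- y) - 2).
Proof.
wlog y0 : y / 0 <= y.
  move=> H; have [|y0] := leP 0 y; first exact: H.
  by have := H (- y); rewrite sqrrN opprK oppr_ge0 ltW// (addrC (expR (- y))); exact.
set z := y / 2; have z0 : 0 <= z by rewrite divr_ge0.
have e0 := expR_gt0 z.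
have -> : expR y + expR (- y) - 2 = (expR z - expR (- z)) ^+ 2.
  have -> : y = z + z by rewrite /z -splitr.
  rewrite opprD !expRD !expRN; field; exact: lt0r_neq0.
have h1 : 1 + z <= expR z := expR_ge1Dx z.
have h2 : expR (- z) <= 1 by rewrite -expR0 ler_expR oppr_le0.
have h3 : z <= expR z - expR (- z) by lra.
have -> : y = 2 * z by rewrite /z mulrCA divff ?mulr1.
by rewrite exprMn -natrX ler_pM2l// lerXn2r ?nnegrE//; lra.
Qed.

(** After rotation by a phase the integrand has real part [e^(a x - pi e^x) cos (b (x - m))]. The
    cosine is at least [1 - 2 b^2 (e^(x - m) + e^(m - x) - 2)], and the two exponentials integrate
    to multiples of [gamR (a + 1)] and [gamR (a - 1)]. *)
Lemma gam_lower (a b : R) : 1 < a ->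
  gamR a * (1 - 2 * b ^+ 2 / (a - 1)) <= normc (gam (a +i* b)%C).
Proof.
move=> a1; have a0 : 0 < a by rewrite (lt_trans ltr01).
have a10 : 0 < a - 1 by rewrite subr_gt0.
have p0 := pi_gt0 R.
(* The point where [a x - pi e^x] is largest. As [e^m = a / pi], the shifted integrals become
   [gamR a] and [a / (a - 1) gamR a], whose excess over [2 gamR a] is [gamR a / (a - 1)]. *)
set m := ln (a / pi); set z := (a +i* b)%C.
have z0 : 0 < re z by [].
pose u : R[i] := cexp (0 +i* (- (m * b)))%C.
have nu : normc u = 1 by rewrite normc_cexp expR0.
have -> : normc (gam z) = normc (u * gam z) by rewrite normc_mul nu mul1r.
apply: le_trans (normRe_le _); apply: le_trans (ler_norm _).
have ReE x : re (u * bker z 1 0 x) = kerR a x * cos (b * (x - m)).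
  rewrite /bker -cexpD Re_cexp !(ReD, ReN, ReM, ImD, ImN, ImM) /=.
  by rewrite /kerR; congr (expR _ * cos _); ring.
have [iu _] := cintegrableZl u (cintegrable_gam z0).
rewrite /gam -cintegralZl; last exact: cintegrable_gam.
have iS (k c : R) : 0 < k -> leb.-integrable setT (EFin \o (fun x => c * kerR k x)).
  by move=> k0; apply: eq_integrable (integrableZl measurableT c (ikerR k0)) => // x _.
pose h x := (1 + 4 * b ^+ 2) * kerR a x - (2 * b ^+ 2 * expR (- m)) * kerR (a + 1) x
  - (2 * b ^+ 2 * expR m) * kerR (a - 1) x.
have a2 : 0 < a + 1 by rewrite addr_gt0.
have i12 : leb.-integrable setT (EFin \o (fun x => (1 + 4 * b ^+ 2) * kerR a x -
    (2 * b ^+ 2 * expR (- m)) * kerR (a + 1) x)).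
  by apply: eq_integrable (integrableB measurableT (iS a (1 + 4 * b ^+ 2) a0) (iS _ (2 * b ^+ 2 * expR (- m)) a2)) => // x _.
have ih : leb.-integrable setT (EFin \o h).
  by apply: eq_integrable (integrableB measurableT i12 (iS _ (2 * b ^+ 2 * expR m) a10)) => // x _.
have -> : gamR a * (1 - 2 * b ^+ 2 / (a - 1)) = \int[leb]_x h x.
  rewrite RintegralB//; last exact: iS.
  rewrite RintegralB//; [|exact: iS|exact: iS].
  rewrite !RintegralZl//; [|exact: ikerR|exact: ikerR|exact: ikerR].
  rewrite -!/(gamR _) gamR_D1//.
  have -> : gamR (a - 1) = pi / (a - 1) * gamR a.
    have := gamR_D1 a10; rewrite subrK => ->.
    by rewrite mulrA mulrA divfK ?gt_eqF// mulfV ?gt_eqF// mul1r.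
  rewrite expRN /m lnK ?posrE ?divr_gt0//.
  have [pn an an1] := And3 (lt0r_neq0 p0) (lt0r_neq0 a0) (lt0r_neq0 a10).
  have E1 : a / pi * (pi / (a - 1)) = 1 + (a - 1)^-1.
    by rewrite mulrA divfK// -{1}(subrK 1 a) mulrDl mulfV// mul1r.
  have x0 : a / pi != 0 by rewrite mulf_neq0 ?invr_eq0.
  have -> : 2 * b ^+ 2 / (a / pi) * (a / pi * gamR a) = 2 * b ^+ 2 * gamR a.
    by rewrite -mulrA (mulrA (a / pi)^-1) mulVf// mul1r.
  have -> : 2 * b ^+ 2 * (a / pi) * (pi / (a - 1) * gamR a) = 2 * b ^+ 2 * (1 + (a - 1)^-1) * gamR a.
    by rewrite -E1; ring.
  by ring.
apply: le_Rintegral => // x _; rewrite ReE.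
have -> : h x = kerR a x * (1 - 2 * b ^+ 2 * (expR (x - m) + expR (- (x - m)) - 2)).
  rewrite /h /kerR.
  have -> : (a + 1) * x - pi * expR x = (a * x - pi * expR x) + x by ring.
  have -> : (a - 1) * x - pi * expR x = (a * x - pi * expR x) - x by ring.
  rewrite opprB !expRD !expRN; ring.
rewrite ler_wpM2l ?expR_ge0//; apply: le_trans (cos_ge_sqr _).
rewrite lerD2l lerN2 exprMn.
have := ler_wpM2l (sqr_ge0 b) (sqr_le_cosh (x - m)).
by lra.
Qed.

(** The functional equation moves the argument [N] steps to the right, where [gam_lower] is
    effective. The bound is uniform in [e], also when [c] lies on the imaginary axis. *)
Lemma gam_lbound (c : R[i]) : 0 <= re c ->
  exists2 d, 0 < d & forall e, 0 < e -> e <= 1 -> d <= normc (gam (c + (e%:C)%C)).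
Proof.
move=> c0; pose b : R := im c; pose K : R := expR (- (pi * expR 1)).
have K0 : 0 < K by exact: expR_gt0.
have p0 := pi_gt0 R.
(* Large enough that [2 b^2 / (a - 1) < 1 / 2] at the shifted real part [a]: this is the factor
   [1 / 2] in the bound. *)
pose N := (Num.truncn (4 * b ^+ 2)).+2.
have N4 : 4 * b ^+ 2 + 1 <= N%:R.
  have := truncnS_gt (4 * b ^+ 2); rewrite /N -(natr1 _.+1); lra.
(* An upper bound for every denominator [|c + e + i|] with [i < N] and [e <= 1]. *)
pose B := normc c + 1 + N%:R.
have B0 : 0 < B by rewrite addr_gt0 ?ltr0n// ltr_wpDl// normc_ge0.
exists (K / 2 * (pi / B) ^+ N); first by rewrite mulr_gt0 ?exprn_gt0 ?divr_gt0.
move=> e e0 e1; set z := c + (e%:C)%C.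
have Rez : re z = re c + e by rewrite ReD.
have z0 : 0 < re z by rewrite Rez ltr_wpDl.
have Imz : im z = b by rewrite ImD /= addr0.
rewrite (gamDn N z0) normc_mul normc_prod; apply: ler_pM.
- by rewrite divr_ge0 ?ltW.
- by rewrite exprn_ge0 ?divr_ge0 ?ltW.
- have -> : z + N%:R = ((re z + N%:R) +i* b)%C.
    by rewrite -(RCnat N); apply: complexP; [rewrite ReD|rewrite ImD Imz /= addr0].
  have aN : 1 + 4 * b ^+ 2 < re z + N%:R by lra.
  have b2 := sqr_ge0 b.
  apply: le_trans (gam_lower _ _); last by lra.
  rewrite ler_pM ?(ltW K0)//; first by apply: gamR_ge; lra.
  rewrite lerBrDr -lerBrDl ler_pdivrMr; lra.
- rewrite -[N in X in X <= _]card_ord -prodr_const; apply: ler_prod => i _.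
  apply/andP; split; first by rewrite divr_ge0 ?ltW.
  rewrite normc_mul normc_inv normc_real gtr0_norm// ler_pM2l// lef_pV2 ?posrE//.
    apply: le_trans (normcD_le _ _) _; rewrite /B lerD//.
      apply: le_trans (normcD_le _ _) _; rewrite lerD2l normc_real gtr0_norm//.
    by rewrite -RCnat normc_real ger0_norm// ler_nat ltnW.
  rewrite lt_neqAle normc_ge0 andbT eq_sym normc_eq0.
  apply: contraTneq z0 => zi; have := congr1 (@re R) zi.
  rewrite ReD -RCnat /= => h; rewrite -leNgt; have : 0 <= i%:R :> R by []. lra.
Qed.

(** [gam e = (pi / e) gam (e + 1)], and [gamR] is bounded below on the positive reals. *)
Lemma gam_pole : exists2 d, 0 < d & forall e, 0 < e -> e <= 1 -> d / e <= normc (gam (e%:C)%C).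
Proof.
have p0 := pi_gt0 R.
exists (expR (- (pi * expR 1)) * pi); first by rewrite mulr_gt0 ?expR_gt0.
move=> e e0 e1; rewrite (@gamDn (e%:C)%C 1 e0) big_ord1 addr0 -[1%:R]RCnat -RCD gam_real.
rewrite !normc_mul normc_inv !normc_real (gtr0_norm p0) (gtr0_norm e0) mulrA.
rewrite ler_pM2r ?invr_gt0// ler_pM2r// (le_trans _ (ler_norm _))//.
by apply: gamR_ge; rewrite addr_gt0.
Qed.

End line_integral.

(** * Meromorphy *)

Section taylor.
Context {R : realType}.
Local Notation leb := (@lebesgue_measure R).
Local Notation RT := (measurableTypeR R).

Lemma expR_sub1_le (a : R) : `|expR a - 1| <= `|a| * expR `|a|.
Proof.
have [a0|a0] := leP 0 a.
  rewrite !ger0_norm ?subr_ge0 -?expR0 ?ler_expR// expR0.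
  have e0 := expR_gt0 a.
  have : expR a * (1 - a) <= 1.
    rewrite -(mulfV (lt0r_neq0 e0)) ler_pM2l// -expRN.
    by have := expR_ge1Dx (- a); rewrite expRN mulfV ?lt0r_neq0.
  by lra.
rewrite ler0_norm; last by rewrite subr_le0 -expR0 ler_expR ltW.
rewrite ltr0_norm//.
have h1 := expR_ge1Dx a.
have h2 : 1 <= expR (- a) by rewrite -expR0 ler_expR oppr_ge0 ltW.
have : - a * 1 <= - a * expR (- a) by rewrite ler_wpM2l// oppr_ge0 ltW.
by lra.
Qed.

Lemma expR_sub1D_le (a : R) : `|expR a - 1 - a| <= a ^+ 2 * expR `|a|.
Proof.
have h1 := expR_ge1Dx a.
rewrite ger0_norm; last by lra.
have [a0|a0] := leP 0 a.
  rewrite ger0_norm//; have := expR_sub1_le a.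
  rewrite !ger0_norm// ?subr_ge0 -?expR0 ?ler_expR// expR0 => h.
  have e1 : 1 <= expR a by rewrite -expR0 ler_expR.
  have := ler_wpM2l a0 h; nra.
rewrite ltr0_norm//; have e1 : 1 <= expR (- a) by rewrite -expR0 ler_expR oppr_ge0 ltW.
have h2 := expR_ge1Dx (- a).
have e0 : 0 < expR a := expR_gt0 a.
have h3 : expR a * (1 - a) <= 1.
  rewrite -[leRHS](mulfV (lt0r_neq0 e0)) ler_pM2l// -expRN; lra.
have h4 : expR a - 1 - a <= a ^+ 2 by nra.
by apply: (le_trans h4); rewrite ler_peMr ?sqr_ge0.
Qed.

Lemma cos_sub1_le (b : R) : `|cos b - 1| <= `|b|.
Proof.
rewrite ler0_norm ?subr_le0 ?cos_le1//.
have h1 := cos_ge_sqr b; have h2 := cos_geN1 b.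
have nb : `|b| ^+ 2 = b ^+ 2 by exact: real_normK (num_real b).
have := normr_ge0 b; move: nb; set t := `|b| => nb t0.
by have [t2|t2] := leP t 2; nra.
Qed.

Lemma sin_sub_le (b : R) : `|sin b - b| <= b ^+ 2.
Proof.
wlog b0 : b / 0 <= b.
  move=> H; have [|b0] := leP 0 b; first exact: H.
  by have := H (- b); rewrite sinN sqrrN -opprD normrN oppr_ge0 ltW//; exact.
have [|c cb] := @MVT_segment R sin cos 0 b b0 (fun x _ => is_derive_sin x).
  by apply: continuous_subspaceT => x; exact: continuous_sin.
rewrite sin0 !subr0 => ->.
move: cb; rewrite in_itv/= => /andP[c0 cb].
have -> : cos c * b - b = (cos c - 1) * b by ring.
rewrite normrM (ger0_norm b0) expr2 ler_wpM2r//.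
by rewrite (le_trans (cos_sub1_le _))// ger0_norm.
Qed.

(** The 4 counts the error terms: two in the real part and two in the imaginary part, each at most
    [r^2 e^r] with [r = |w|]. *)
Lemma cexp_taylor (w : R[i]) : normc (cexp w - 1 - w) <= 4 * normc w ^+ 2 * expR (normc w).
Proof.
apply: le_trans (normc_le _) _; set a := re w; set b := im w.
set r := normc w.
have ra : `|a| <= r := normRe_le w.
have rb : `|b| <= r := normIm_le w.
have r0 : 0 <= r := normc_ge0 w.
rewrite !(ReD, ReN, ImD, ImN) Re_cexp Im_cexp -/a -/b /= subr0.
have e1 : 1 <= expR r by rewrite -expR0 ler_expR.
have ea : expR a <= expR r by rewrite ler_expR (le_trans _ ra)// ler_norm.
have ea' : expR `|a| <= expR r by rewrite ler_expR.
have a2 : a ^+ 2 <= r ^+ 2 by rewrite -(real_normK (num_real a)) lerXn2r ?nnegrE.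
have b2 : b ^+ 2 <= r ^+ 2 by rewrite -(real_normK (num_real b)) lerXn2r ?nnegrE.
have E1 : `|expR a - 1 - a| <= r ^+ 2 * expR r.
  by apply: le_trans (expR_sub1D_le a) _; rewrite ler_pM ?sqr_ge0 ?expR_ge0.
have E2 : `|expR a * (cos b - 1)| <= r ^+ 2 * expR r.
  rewrite normrM (ger0_norm (expR_ge0 _)) mulrC ler_pM ?expR_ge0//.
  rewrite ler0_norm ?subr_le0 ?cos_le1//; have := cos_ge_sqr b; have := sqr_ge0 b; lra.
have E3 : `|(expR a - 1) * sin b| <= r ^+ 2 * expR r.
  rewrite normrM; apply: (@le_trans _ _ ((r * expR r) * r)); last by rewrite expr2; lra.
  apply: ler_pM => //; last by rewrite (le_trans (sin_norm_le b)).
  by apply: le_trans (expR_sub1_le a) _; rewrite ler_pM ?expR_ge0.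
have E4 : `|sin b - b| <= r ^+ 2 * expR r.
  apply: le_trans (sin_sub_le b) _; apply: (le_trans b2).
  by rewrite ler_peMr ?sqr_ge0.
have -> : expR a * cos b - 1 - a = (expR a - 1 - a) + expR a * (cos b - 1) by ring.
have -> : expR a * sin b - b = (expR a - 1) * sin b + (sin b - b) by ring.
apply: (@le_trans _ _ (r ^+ 2 * expR r + r ^+ 2 * expR r + (r ^+ 2 * expR r + r ^+ 2 * expR r))).
  apply: lerD; apply: le_trans (ler_normD _ _) _; exact: lerD.
by lra.
Qed.

Let kerR (a : R) (x : RT) : R := expR (a * x - pi * expR x).

Let mkerR a : measurable_fun setT (kerR a).
Proof.
apply: measurableT_comp (@measurable_expR R) _; apply: measurable_funB.
  exact: measurable_funM.
by apply: measurable_funM => //; exact: measurable_expR.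
Qed.

Let kerR_oo a : 0 < a -> (\int[leb]_x (kerR a x)%:E < +oo)%E.
Proof.
move=> a0; have /cintegrableTP[_] := @cintegrable_gam R (a%:C)%C a0.
congr (_ < _)%E; apply: eq_integral => x _; rewrite normc_bker /kerR.
by rewrite mulr1 mulr0 addr0.
Qed.

Let normc_bker0 c x : normc (bker c 1 0 x) = kerR (re c) x.
Proof. by rewrite normc_bker mulr1 mulr0 addr0. Qed.

(** Exponential growth is absorbed by shifting the parameter, in the direction given by the sign of
    [x]. *)
Let kerR_abs a k (x : R) : expR (k * `|x|) * kerR a x <= kerR (a + k) x + kerR (a - k) x.
Proof.
rewrite /kerR -expRD; have [x0|x0] := leP 0 x.
  rewrite ger0_norm// -[leLHS]addr0 lerD ?expR_ge0// ler_expR; lra.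
rewrite ltr0_norm// -[leLHS]add0r lerD ?expR_ge0// ler_expR; lra.
Qed.

(** Differentiation under the integral sign with an explicit remainder; [D] is the integral of
    [x bker c 1 0]. For [|h| <= 1] the remainder contains [x^2 e^(|h x|) <= 2 e^(2 |x|)], hence the
    parameters [re c + 2] and [re c - 2], both positive. *)
Lemma gam_taylor (c : R[i]) : 2 < re c ->
  exists D : R[i], exists2 K : R, 0 <= K & forall h, normc h <= 1 ->
    normc (gam (c + h) - gam c - h * D) <= K * normc h ^+ 2.
Proof.
set a := re c => a2.
have [a_0 a_1 a_2] : [/\ 0 < a, 0 < a - 1 & 0 < a - 2] by split; lra.
have xe (x : R) : `|x| <= expR `|x| by rewrite (le_trans _ (expR_ge1Dx _))// lerDr.
have iD : cintegrable leb setT (fun x : RT => (x%:C)%C * bker c 1 0 x).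
  apply: (@cintegrable_dom _ RT R leb _ (fun x : RT => (kerR (a + 1) x)%:E + (kerR (a - 1) x)%:E)%E).
  - by apply: cmeasM; [exact: cmeas_id_real|exact: cmeas_bker].
  - by apply: emeasurable_funD; apply/measurable_EFinP; exact: mkerR.
  - move=> x; rewrite -EFinD lee_fin normc_mul normc_real normc_bker0 -/a.
    apply: le_trans (kerR_abs a 1 x); rewrite mul1r ler_wpM2r ?expR_ge0//.
  rewrite ge0_integralD//; try by [move=> x _; rewrite lee_fin expR_ge0|apply/measurable_EFinP; exact: mkerR].
  by apply: lte_add_pinfty; apply: kerR_oo; lra.
exists (cintegral leb setT (fun x : RT => (x%:C)%C * bker c 1 0 x)).
pose J := fine (\int[leb]_x ((kerR (a + 2) x)%:E + (kerR (a - 2) x)%:E))%E.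
have J_oo : (\int[leb]_x ((kerR (a + 2) x)%:E + (kerR (a - 2) x)%:E) < +oo)%E.
  rewrite ge0_integralD//; try by [move=> x _; rewrite lee_fin expR_ge0|apply/measurable_EFinP; exact: mkerR].
  by apply: lte_add_pinfty; apply: kerR_oo; lra.
have J_0 : (0 <= \int[leb]_x ((kerR (a + 2) x)%:E + (kerR (a - 2) x)%:E))%E.
  by apply: integral_ge0 => x _; rewrite -EFinD lee_fin addr_ge0 ?expR_ge0.
exists (8 * J); first by rewrite mulr_ge0// fine_ge0.
move=> h h1.
have ch : 0 < re (c + h).
  rewrite ReD -/a; have := le_trans (normRe_le h) h1; rewrite ler_norml => /andP[]; lra.
have -> : gam (c + h) - gam c - h * cintegral leb setT (fun x : RT => (x%:C)%C * bker c 1 0 x) =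
    cintegral leb setT (fun x : RT => bker (c + h) 1 0 x + (-1) * bker c 1 0 x + (- h) * ((x%:C)%C * bker c 1 0 x)).
  rewrite cintegralD; last 2 first.
  - apply: cintegrableD; first exact: cintegrable_gam.
    by apply: cintegrableZl; exact: cintegrable_gam.
  - exact: cintegrableZl.
  rewrite cintegralD; last 2 first.
  - exact: cintegrable_gam.
  - by apply: cintegrableZl; exact: cintegrable_gam.
  by rewrite !cintegralZl//; [rewrite mulN1r mulNr|exact: cintegrable_gam].
have md : cmeas (fun x : RT => bker (c + h) 1 0 x + (-1) * bker c 1 0 x + (- h) * ((x%:C)%C * bker c 1 0 x)).
  apply: cmeasD.
    apply: cmeasD; first exact: cmeas_bker.
    by apply: cmeasM; [exact: cmeas_cst|exact: cmeas_bker].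
  apply: cmeasM; first exact: cmeas_cst.
  by apply: cmeasM; [exact: cmeas_id_real|exact: cmeas_bker].
rewrite -lee_fin; apply: le_trans (normc_cintegral_le leb md) _.
apply: (@le_trans _ _ (\int[leb]_x ((8 * normc h ^+ 2)%:E * ((kerR (a + 2) x)%:E + (kerR (a - 2) x)%:E)))%E).
  apply: ge0_le_integral => //.
  - by move=> x _; rewrite lee_fin normc_ge0.
  - by apply/measurable_EFinP; exact: measurable_normc.
  - apply: emeasurable_funM => //; apply: emeasurable_funD; apply/measurable_EFinP; exact: mkerR.
  - move=> x _; rewrite -EFinD -EFinM lee_fin.
    have -> : bker (c + h) 1 0 x + (-1) * bker c 1 0 x + (- h) * ((x%:C)%C * bker c 1 0 x) =
        (cexp (h * (x%:C)%C) - 1 - h * (x%:C)%C) * bker c 1 0 x.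
      have -> : bker (c + h) 1 0 x = cexp (h * (x%:C)%C) * bker c 1 0 x.
        by rewrite /bker -cexpD; congr cexp; rewrite mulrDl; ring.
      by ring.
    rewrite normc_mul normc_bker0 -/a.
    apply: (@le_trans _ _ (8 * normc h ^+ 2 * (expR (2 * `|x|) * kerR a x))); last first.
      by rewrite ler_wpM2l ?kerR_abs// mulr_ge0 ?sqr_ge0.
    rewrite mulrA ler_wpM2r ?expR_ge0//.
    apply: le_trans (cexp_taylor _) _.
    rewrite normc_mul normc_real exprMn.
    have x2 : `|x| ^+ 2 <= 2 * expR `|x|.
      by have := expR_ge1Dxn 1 (normr_ge0 x); rewrite (_ : 2`! = 2%N)//; lra.
    have ex : expR (normc h * `|x|) <= expR `|x|.
      by rewrite ler_expR ler_piMl.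
    have -> : 8 * normc h ^+ 2 * expR (2 * `|x|) = 4 * normc h ^+ 2 * (2 * expR `|x| * expR `|x|).
      by rewrite (_ : 2 * `|x| = `|x| + `|x|) ?expRD; ring.
    have -> : 4 * (normc h ^+ 2 * `|x| ^+ 2) * expR (normc h * `|x|) =
        4 * normc h ^+ 2 * (`|x| ^+ 2 * expR (normc h * `|x|)) by ring.
    apply: ler_wpM2l; first by rewrite mulr_ge0 ?sqr_ge0.
    by apply: ler_pM => //; rewrite ?sqr_ge0 ?expR_ge0.
rewrite ge0_integralZl//; last 3 first.
- by apply: emeasurable_funD; apply/measurable_EFinP; exact: mkerR.
- by move=> x _; rewrite -EFinD lee_fin addr_ge0 ?expR_ge0.
- by rewrite lee_fin mulr_ge0 ?sqr_ge0.
rewrite -(fineK (_ : (\int[leb]_x ((kerR (a + 2) x)%:E + (kerR (a - 2) x)%:E))%E \is a fin_num)); last first.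
  by rewrite ge0_fin_numE.
rewrite -EFinM lee_fin -/J; lra.
Qed.

End taylor.

(** * Meromorphic functions and the case of [GammaR] *)

Section meromorphic.
Context {R : realType}.
Local Notation C := R[i].

Lemma near_normc (z0 : C) (P : C -> Prop) (d : R) : 0 < d ->
  (forall z, normc (z - z0) < d -> P z) -> \forall z \near (z0 : C^o), P z.
Proof.
move=> d0 H; apply/nbhs_ballP; exists (d%:C)%C => /=; first by rewrite ltcR.
move=> z; rewrite /ball /= => h; apply: H.
by move: h; rewrite distrC norm_normc ltcR.
Qed.

(** Radii of balls are elements of [R[i]]; a positive one has imaginary part 0, so its real part is
    the radius sought. *)
Lemma near_normcP (z0 : C) (P : C -> Prop) : (\forall z \near (z0 : C^o), P z) ->
  exists2 d : R, 0 < d & forall z, normc (z - z0) < d -> P z.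
Proof.
move=> /nbhs_ballP[e /= e0 H].
have [ei er] : im e = 0 /\ 0 < re e.
  by move: e0; rewrite ltcE /= => /andP[/eqP -> ->].
exists (re e) => // z hz; apply: H; rewrite /ball /=.
have -> : e = ((re e)%:C)%C by apply: complexP.
by rewrite distrC norm_normc ltcR.
Qed.

Lemma meromorphic_atP (F : C -> C) (z0 : C) : meromorphic_at F z0 <->
  exists N (g : C^o -> C^o), exists2 d : R, 0 < d & forall z, normc (z - z0) < d ->
    derivable g z 1 /\ (z != z0 -> F z = g z / (z - z0) ^+ N).
Proof.
split => [[N [g [dg Eg]]]|[N [g [d d0 H]]]].
  have [d1 d10 H1] := near_normcP dg.
  have [d2 d20 H2] := @near_normcP z0 (fun z => z != z0 -> F z = g z / (z - z0) ^+ N) Eg.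
  exists N, g, (Num.min d1 d2) => [|z]; first by rewrite lt_min d10.
  by rewrite lt_min => /andP[z1 z2]; split; [exact: H1|exact: H2].
exists N, g; split; first by apply: (near_normc d0) => z /H[].
apply: (@near_normc z0 (fun z => z != z0 -> F z = g z / (z - z0) ^+ N) _ d0) => z.
by move=> /H[].
Qed.

Lemma meromorphic_derivable (F : C -> C) (z0 : C) (d : R) : 0 < d ->
  (forall z, normc (z - z0) < d -> derivable (F : C^o -> C^o) z 1) -> meromorphic_at F z0.
Proof.
move=> d0 dF; apply/meromorphic_atP; exists 0%N, F, d => // z zd.
by split; [exact: dF|rewrite expr0 divr1].
Qed.

Lemma meromorphicM (F G : C -> C) (z0 : C) :
  meromorphic_at F z0 -> meromorphic_at G z0 -> meromorphic_at (fun z => F z * G z) z0.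
Proof.
move=> /meromorphic_atP[N [f [d1 d10 Ef]]] /meromorphic_atP[M [g [d2 d20 Eg]]].
apply/meromorphic_atP; exists (N + M)%N, (fun z => f z * g z), (Num.min d1 d2).
  by rewrite lt_min d10.
move=> z; rewrite lt_min => /andP[/Ef[f1 f2] /Eg[g1 g2]]; split.
  exact: (@derivableM _ _ f g z 1 f1 g1).
by move=> zz0; rewrite exprD invfM f2// g2// mulrACA.
Qed.

Lemma meromorphic_prod (I : Type) (r : seq I) (F : I -> C -> C) (z0 : C) :
  (forall i, meromorphic_at (F i) z0) -> meromorphic_at (fun z => \prod_(i <- r) F i z) z0.
Proof.
move=> H; elim: r => [|i r IH].
  under eq_fun do rewrite big_nil.
  apply: (@meromorphic_derivable _ _ 1) => // z _; exact: derivable_cst.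
under eq_fun do rewrite big_cons.
exact: meromorphicM.
Qed.

Lemma meromorphic_eq (F G : C -> C) (z0 : C) (d : R) : 0 < d ->
  (forall z, normc (z - z0) < d -> F z = G z) -> meromorphic_at F z0 -> meromorphic_at G z0.
Proof.
move=> d0 FG /meromorphic_atP[N [f [d1 d10 Ef]]].
apply/meromorphic_atP; exists N, f, (Num.min d d1); first by rewrite lt_min d0.
move=> z; rewrite lt_min => /andP[/FG <- /Ef]; exact.
Qed.

Lemma meromorphic_gam (k z0 : C) : 2 < re (z0 / 2 + k) ->
  meromorphic_at (fun z => gam (z / 2 + k)) z0.
Proof.
move=> Re2; pose d := re (z0 / 2 + k) - 2.
have d0 : 0 < d by rewrite subr_gt0.
apply: (@meromorphic_derivable _ _ d) => // z zd.
have Rez : 2 < re (z / 2 + k).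
  have := le_lt_trans (normRe_le _) zd; rewrite ltr_norml => /andP[+ _].
  move: Re2; rewrite /d !ReD ReN !Re_half; lra.
have [D [K K0 HK]] := gam_taylor Rez.
apply/cvg_ex; exists (D / 2 : C^o); apply/cvgrPdist_le => /= e e0.
have [ei er] : im e = 0 /\ 0 < re e.
  by move: e0; rewrite ltcE /= => /andP[/eqP -> ->].
have eE : e = ((re e)%:C)%C by apply: complexP.
(* [|h| < 1] gives access to the Taylor bound, and [(K + 1) |h| <= e] covers the error [K |h| / 4]
   of the difference quotient. *)
pose dl := Num.min 1 (re e / (K + 1)).
have K1 : 0 < K + 1 by rewrite ltr_wpDl.
have dl0 : 0 < dl by rewrite lt_min ltr01 divr_gt0.
suff : \forall h \near (0 : C^o), h != 0 ->
    `|D / 2 - h^-1 *: (gam ((h *: (1 : C^o) + z) / 2 + k) - gam (z / 2 + k))| <= e by [].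
apply: (@near_normc _ _ dl) => // h; rewrite subr0 => hd h0.
rewrite eE norm_normc lecR.
have nh : normc (h / 2) = normc h / 2.
  by rewrite normc_mul normc_inv -[2 in LHS]RCnat normc_real ger0_norm.
have h1 : normc h < 1 by rewrite (lt_le_trans hd)// ge_min lexx.
have hn := normc_ge0 h.
have := HK (h / 2) (_ : normc (h / 2) <= 1); rewrite nh => /(_ _).
have -> : (h *: (1 : C^o) + z) / 2 + k = z / 2 + k + h / 2.
  by rewrite /GRing.scale /= mulr1 mulrDl [h / 2 + _]addrC addrAC.
set A := gam _ - gam _ => H.
have {}H : normc (A - h / 2 * D) <= K * (normc h / 2) ^+ 2 by apply: H; lra.
have -> : D / 2 - h^-1 *: A = - h^-1 * (A - h / 2 * D).
  by rewrite /GRing.scale /=; field.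
rewrite normc_mul normc_opp normc_inv.
have hp : 0 < normc h by rewrite lt_neqAle hn andbT eq_sym normc_eq0.
rewrite ler_pdivrMl// (le_trans H)//.
have he : normc h * (K + 1) <= re e.
  by rewrite -ler_pdivlMr// ltW// (lt_le_trans hd)// ge_min lexx orbT.
have Kh : 0 <= K * normc h by rewrite mulr_ge0.
by nra.
Qed.

Lemma meromorphic_inv (a k z0 : C) : meromorphic_at (fun z => a / (z / 2 + k)) z0.
Proof.
have [z0k|z0k] := eqVneq (z0 / 2 + k) 0.
  (* At the pole itself the function is [2 a / (z - z0)]. *)
  apply/meromorphic_atP; exists 1%N, (fun=> 2 * a), 1 => // z _.
  split => [|_]; first exact: derivable_cst.
  rewrite expr1.
  have -> : z / 2 + k = (z - z0) / 2 by rewrite mulrBl -[RHS]addr0 -z0k; ring.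
  by rewrite invfM invrK mulrA mulrAC (mulrC a).
(* Half the distance from [z0] to the pole [- 2 k]. *)
pose d := normc (z0 / 2 + k).
have d0 : 0 < d by rewrite lt_neqAle normc_ge0 andbT eq_sym normc_eq0.
apply: (@meromorphic_derivable _ _ d) => // z zd.
have zk : z / 2 + k != 0.
  apply: contraTneq zd => zk; rewrite -leNgt /d.
  have -> : z0 / 2 + k = - ((z - z0) / 2) by rewrite mulrBl opprB -[LHS]subr0 -zk; ring.
  rewrite normc_opp normc_mul normc_inv -[2]RCnat normc_real ger0_norm//.
  by rewrite ler_pdivrMr// ler_peMr ?normc_ge0// ler1n.
apply: derivableM; first exact: derivable_cst.
by apply: derivableV => //; apply: derivableD.
Qed.

Lemma meromorphic_GammaR (k z0 : C) : meromorphic_at (fun z => GammaR (z + k)) z0.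
Proof.
(* A real part above 3 at [z0] exceeds the 2 of [gam_taylor] and stays positive on the ball of
   radius 1, so this [M] is admissible there. *)
pose M := (Num.truncn (`|re (z0 / 2 + k / 2)| + 3)).+1.
have M3 : `|re (z0 / 2 + k / 2)| + 3 < M%:R by exact: truncnS_gt.
have M2 : 3 < re (z0 / 2 + k / 2) + M%:R.
  by have := ler_norm (- re (z0 / 2 + k / 2)); rewrite normrN; lra.
apply: (@meromorphic_eq (fun z => gam (z / 2 + (k / 2 + M%:R)) *
   \prod_(i < M) ((pi%:C)%C / (z / 2 + (k / 2 + i%:R)))) _ _ 1) => // [z zd|].
  have RM : re ((z + k) / 2) + M%:R > 0.
    have := le_lt_trans (normRe_le _) zd; rewrite ltr_norml => /andP[+ _].
    move: M2; rewrite mulrDl !ReD ReN !Re_half; lra.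
  rewrite (GammaR_gam RM) mulrDl addrA; congr (_ * _).
  by apply: eq_bigr => i _; rewrite addrA.
apply: meromorphicM; last by apply: meromorphic_prod => i; exact: meromorphic_inv.
apply: meromorphic_gam; move: M2; rewrite !ReD -[M%:R in X in _ -> X]RCnat /=; lra.
Qed.

End meromorphic.

(** * The kernels lam and qk *)

Section kernels.
Context {R : realType}.
Local Notation leb := (@lebesgue_measure R).
Local Notation RT := (measurableTypeR R).
Local Notation L := (@lebesgue_tuple R).
Local Notation C := R[i].

(** Coordinates are read with [nth 0]: indices such as [i.+1] require no ordinal casts, and the
    coordinate past the end reads as 0. *)
Definition tsum n (u : n.-tuple R) : R := \sum_(i < n) nth 0 u i.

Definition lamE n (u : n.+1.-tuple R) (x : n.-tuple R) : R :=
  \sum_(i < n) (expR (nth 0 u i - nth 0 x i) + expR (nth 0 x i - nth 0 u i.+1)).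

(** The limit of [lamE] as its first argument, [u] with one more coordinate, has that last
    coordinate sent to [+oo]. *)
Definition qE n (v u : n.-tuple R) : R :=
  \sum_(i < n) expR (nth 0 u i - nth 0 v i) +
  \sum_(i < n.-1) expR (nth 0 v i - nth 0 u i.+1).

Definition lam n (b : C) (u : n.+1.-tuple R) (x : n.-tuple R) : C :=
  cexp (b * ((tsum u - tsum x)%:C)%C - ((pi * lamE u x)%:C)%C).

Definition qk n (c : C) (v u : n.-tuple R) : C :=
  cexp (c * ((tsum u - tsum v)%:C)%C - ((pi * qE v u)%:C)%C).

Definition lamR n (b : R) (u : n.+1.-tuple R) (x : n.-tuple R) : R :=
  expR (b * (tsum u - tsum x) - pi * lamE u x).

Definition qR n (c : R) (v u : n.-tuple R) : R :=
  expR (c * (tsum u - tsum v) - pi * qE v u).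

Lemma normc_lam n b (u : n.+1.-tuple R) (x : n.-tuple R) :
  normc (lam b u x) = lamR (re b) u x.
Proof. by rewrite normc_cexp ReD ReN ReM /= mulr0 subr0. Qed.

Lemma normc_qk n c (v u : n.-tuple R) : normc (qk c v u) = qR (re c) v u.
Proof. by rewrite normc_cexp ReD ReN ReM /= mulr0 subr0. Qed.

Lemma lam_real n (b : R) (u : n.+1.-tuple R) (x : n.-tuple R) :
  lam (b%:C)%C u x = ((lamR b u x)%:C)%C.
Proof. by rewrite /lam /lamR -cexp_real; congr cexp; rewrite !(RCD, RCN, RCM). Qed.

Lemma qk_real n (c : R) (v u : n.-tuple R) : qk (c%:C)%C v u = ((qR c v u)%:C)%C.
Proof. by rewrite /qk /qR -cexp_real; congr cexp; rewrite !(RCD, RCN, RCM). Qed.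

Lemma lamR_ge0 n b (u : n.+1.-tuple R) (x : n.-tuple R) : 0 <= lamR b u x.
Proof. exact: expR_ge0. Qed.

Lemma qR_ge0 n c (v u : n.-tuple R) : 0 <= qR c v u.
Proof. exact: expR_ge0. Qed.

Section kernel_measurable.
Context d (T : measurableType d).

Lemma measurable_tnth0 n i (f : T -> n.-tuple RT) : measurable_fun setT f ->
  measurable_fun setT (fun z => nth 0 (f z : n.-tuple R) i).
Proof.
move=> mf; have [ni|ni] := ltnP i n; last first.
  rewrite (_ : (fun z => _) = (fun=> 0)); first exact: measurable_cst.
  by apply/funext => z; rewrite nth_default// size_tuple.
rewrite (_ : (fun z => _) = (fun z => tnth (f z) (Ordinal ni))).
  by have /measurable_fun_tnthP := mf; exact.
by apply/funext => z; rewrite (tnth_nth 0).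
Qed.

Lemma measurable_tsum n (f : T -> n.-tuple RT) : measurable_fun setT f ->
  measurable_fun setT (fun z => tsum (f z)).
Proof.
move=> mf; pose h (i : 'I_n) (z : T) : R := nth 0 (f z : n.-tuple R) i.
by apply: (@measurable_sum _ _ _ _ _ _ h) => i; exact: measurable_tnth0.
Qed.

Let mexpB (f g : T -> R) : measurable_fun setT f -> measurable_fun setT g ->
  measurable_fun setT (fun z => expR (f z - g z)).
Proof.
by move=> mf mg; apply: measurableT_comp (@measurable_expR R) _; exact: measurable_funB.
Qed.

Lemma measurable_lamE n (f : T -> n.+1.-tuple RT) (g : T -> n.-tuple RT) :
  measurable_fun setT f -> measurable_fun setT g ->
  measurable_fun setT (fun z => lamE (f z) (g z)).
Proof.
move=> mf mg; pose h (i : 'I_n) (z : T) : R :=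
  expR (nth 0 (f z : n.+1.-tuple R) i - nth 0 (g z : n.-tuple R) i) +
  expR (nth 0 (g z : n.-tuple R) i - nth 0 (f z : n.+1.-tuple R) i.+1).
apply: (@measurable_sum _ _ _ _ _ _ h) => i.
by apply: measurable_funD; apply: mexpB; exact: measurable_tnth0.
Qed.

Lemma measurable_qE n (f g : T -> n.-tuple RT) :
  measurable_fun setT f -> measurable_fun setT g ->
  measurable_fun setT (fun z => qE (f z) (g z)).
Proof.
move=> mf mg; apply: measurable_funD.
  pose h (i : 'I_n) (z : T) : R :=
    expR (nth 0 (g z : n.-tuple R) i - nth 0 (f z : n.-tuple R) i).
  by apply: (@measurable_sum _ _ _ _ _ _ h) => i; apply: mexpB; exact: measurable_tnth0.
pose h (i : 'I_n.-1) (z : T) : R :=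
  expR (nth 0 (f z : n.-tuple R) i - nth 0 (g z : n.-tuple R) i.+1).
by apply: (@measurable_sum _ _ _ _ _ _ h) => i; apply: mexpB; exact: measurable_tnth0.
Qed.

Lemma cmeas_lam n b (f : T -> n.+1.-tuple RT) (g : T -> n.-tuple RT) :
  measurable_fun setT f -> measurable_fun setT g -> cmeas (fun z => lam b (f z) (g z)).
Proof.
move=> mf mg; apply: cmeas_cexp; apply: cmeasD.
  apply: cmeasM; first exact: cmeas_cst.
  by apply: cmeas_real; apply: measurable_funB; exact: measurable_tsum.
apply: cmeasN; apply: cmeas_real; apply: measurable_funM => //.
exact: measurable_lamE.
Qed.

Lemma cmeas_qk n c (f g : T -> n.-tuple RT) :
  measurable_fun setT f -> measurable_fun setT g -> cmeas (fun z => qk c (f z) (g z)).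
Proof.
move=> mf mg; apply: cmeas_cexp; apply: cmeasD.
  apply: cmeasM; first exact: cmeas_cst.
  by apply: cmeas_real; apply: measurable_funB; exact: measurable_tsum.
apply: cmeasN; apply: cmeas_real; apply: measurable_funM => //.
exact: measurable_qE.
Qed.

Lemma measurable_lamR n b (f : T -> n.+1.-tuple RT) (g : T -> n.-tuple RT) :
  measurable_fun setT f -> measurable_fun setT g ->
  measurable_fun setT (fun z => (lamR b (f z) (g z))%:E).
Proof.
move=> mf mg; have := (cmeas_lam (b%:C)%C mf mg).1.
under eq_fun do rewrite lam_real.
by move=> /= H; exact/measurable_EFinP.
Qed.

Lemma measurable_qR n c (f g : T -> n.-tuple RT) :
  measurable_fun setT f -> measurable_fun setT g ->
  measurable_fun setT (fun z => (qR c (f z) (g z))%:E).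
Proof.
move=> mf mg; have := (cmeas_qk (c%:C)%C mf mg).1.
under eq_fun do rewrite qk_real.
by move=> /= H; exact/measurable_EFinP.
Qed.

End kernel_measurable.

(** * Exchange of the kernels [qk] and [lam] *)

Section exchange.
Variables (n : nat) (v : n.+1.-tuple R) (x : n.-tuple R).

(** [A i] and [D i] are the coefficients of [e^(u_i)] and [e^(- u_i)] in [qE v u + lamE u x]. The
    boundary values differ: [u_0] has no term with [e^(- u_0)], and [u_n] has no neighbour in
    [x]. *)
Let A (i : nat) : R := expR (- nth 0 v i) + (if (i < n)%N then expR (- nth 0 x i) else 0).
Let D (i : nat) : R := if i is j.+1 then expR (nth 0 v j) + expR (nth 0 x j) else 0.

Let A_gt0 i : 0 < A i.
Proof. by rewrite /A ltr_pwDl ?expR_gt0//; case: ifP => // _; exact: expR_ge0. Qed.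

Let D_gt0 i : 0 < D i.+1.
Proof. by rewrite addr_gt0 ?expR_gt0. Qed.

(** [1 / p + 1 / q = (p + q) / (p q)] with [p = e^(v_i)] and [q = e^(x_i)]. *)
Let lnA i : (i < n)%N -> ln (A i) = ln (D i.+1) - nth 0 v i - nth 0 x i.
Proof.
move=> ni; have -> : A i = D i.+1 * expR (- nth 0 v i - nth 0 x i).
  rewrite /A ni /= expRD !expRN; field.
  by rewrite !gt_eqF ?expR_gt0.
by rewrite lnM ?posrE ?expR_gt0// expRK addrA.
Qed.

Let lnAn : ln (A n) = - nth 0 v n.
Proof. by rewrite /A ltnn addr0 expRK. Qed.

(** The total exponent, up to the parameter [c + b], of the powers produced by the reflections and
    by coordinate 0. *)
Let sumln : \sum_(i < n) ln (D i.+1) - \sum_(i < n.+1) ln (A i) = tsum v + tsum x.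
Proof.
rewrite /tsum !big_ord_recr /= lnAn.
have -> : \sum_(i < n) ln (A i) = \sum_(i < n) ln (D i.+1) - \sum_(i < n) nth 0 v i - \sum_(i < n) nth 0 x i.
  by rewrite -!sumrB; apply: eq_bigr => i _; rewrite lnA.
by ring.
Qed.

Let qlamE c b (u : n.+1.-tuple R) : qk c v u * lam b u x =
  cexp (- c * ((tsum v)%:C)%C - b * ((tsum x)%:C)%C) *
  \prod_(i < n.+1) bker (c + b) (A i) (D i) (tnth u i).
Proof.
rewrite /qk /lam -cexpD -cexp_sum -cexpD; congr cexp.
rewrite sumrB -mulr_sumr -!RCsum.
have -> : \sum_(i < n.+1) tnth u i = tsum u.
  by apply: eq_bigr => i _; rewrite (tnth_nth 0).
have -> : \sum_(i < n.+1) pi * (expR (tnth u i) * A i + expR (- tnth u i) * D i) =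
    pi * (qE v u + lamE u x).
  rewrite -mulr_sumr; congr (_ * _); rewrite /qE /lamE !big_split /=.
  have -> : \sum_(i < n.+1) expR (tnth u i) * A i =
      \sum_(i < n.+1) expR (nth 0 u i - nth 0 v i) + \sum_(i < n) expR (nth 0 u i - nth 0 x i).
    under eq_bigr => i _.
      rewrite (tnth_nth 0) /A mulrDr -expRD; over.
    rewrite big_split /=; congr (_ + _).
    rewrite big_ord_recr /= ltnn mulr0 addr0; apply: eq_bigr => i _.
    by rewrite ltn_ord -expRD.
  have -> : \sum_(i < n.+1) expR (- tnth u i) * D i =
      \sum_(i < n) expR (nth 0 v i - nth 0 u i.+1) + \sum_(i < n) expR (nth 0 x i - nth 0 u i.+1).
    rewrite big_ord_recl /= mulr0 add0r -big_split /=; apply: eq_bigr => i _.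
    by rewrite (tnth_nth 0) /= mulrDr -!expRD ![- _ + _]addrC.
  by ring.
rewrite !(RCD, RCN, RCM); ring.
Qed.

(** On this side [w_i] meets the same coefficients as [u_(i+1)] does on the other, with the opposite
    parameter: exactly what the reflection of [bker] undoes. *)
Let lamqE c b (w : n.-tuple R) : lam b v w * qk c w x =
  cexp (b * ((tsum v)%:C)%C + c * ((tsum x)%:C)%C) *
  \prod_(i < n) bker (- (c + b)) (A i.+1) (D i.+1) (tnth w i).
Proof.
rewrite /qk /lam -cexpD -cexp_sum -cexpD; congr cexp.
rewrite sumrB -mulr_sumr -!RCsum.
have -> : \sum_(i < n) tnth w i = tsum w.
  by apply: eq_bigr => i _; rewrite (tnth_nth 0).
have -> : \sum_(i < n) pi * (expR (tnth w i) * A i.+1 + expR (- tnth w i) * D i.+1) =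
    pi * (lamE v w + qE w x).
  rewrite -mulr_sumr; congr (_ * _); rewrite /qE /lamE !big_split /=.
  have -> : \sum_(i < n) expR (tnth w i) * A i.+1 =
      \sum_(i < n) expR (nth 0 w i - nth 0 v i.+1) + \sum_(i < n.-1) expR (nth 0 w i - nth 0 x i.+1).
    under eq_bigr => i _.
      rewrite (tnth_nth 0) /A mulrDr -expRD; over.
    rewrite big_split /=; congr (_ + _).
    case: (n) w x => [|m] w x'; first by rewrite !big_ord0.
    rewrite big_ord_recr /= ltnn mulr0 addr0; apply: eq_bigr => i _.
    by rewrite ltnS ltn_ord -expRD.
  have -> : \sum_(i < n) expR (- tnth w i) * D i.+1 =
      \sum_(i < n) expR (nth 0 v i - nth 0 w i) + \sum_(i < n) expR (nth 0 x i - nth 0 w i).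
    rewrite -big_split /=; apply: eq_bigr => i _.
    by rewrite (tnth_nth 0) /= mulrDr -!expRD ![- _ + _]addrC.
  by ring.
rewrite !(RCD, RCN, RCM); ring.
Qed.

(* The integrals over the coordinates of [u] factor; those with index [i.+1]
   are reflected into the integrals over the coordinates [i] of [w]. *)
Lemma kernel_exchange (c b : C) : 0 < re (c + b) ->
  [/\ cintegrable (L n.+1) setT (fun u => qk c v u * lam b u x),
      cintegrable (L n) setT (fun w => lam b v w * qk c w x) &
      cintegral (L n.+1) setT (fun u => qk c v u * lam b u x) =
      gam (c + b) * cintegral (L n) setT (fun w => lam b v w * qk c w x)].
Proof.
set p := c + b => p0.
have i1 i : cintegrable leb setT (bker p (A i) (D i) : RT -> C).
  apply: cintegrable_bker; [exact: A_gt0| |].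
    by case: i => // i; exact/ltW/D_gt0.
  by case: i => [|i]; [right|left; exact: D_gt0].
have i2 i : cintegrable leb setT (bker (- p) (A i.+1) (D i.+1) : RT -> C).
  by apply: cintegrable_bker; [exact: A_gt0|exact/ltW/D_gt0|left; exact: D_gt0].
have [I1 E1] := cintegral_tuple_prod n.+1 i1.
have [I2 E2] := cintegral_tuple_prod n i2.
have F1 : (fun u : n.+1.-tuple RT => qk c v u * lam b u x) =
    (fun u => cexp (- c * ((tsum v)%:C)%C - b * ((tsum x)%:C)%C) *
      \prod_(i < n.+1) bker p (A i) (D i) (tnth u i)).
  by apply/funext => u; rewrite qlamE.
have F2 : (fun w : n.-tuple RT => lam b v w * qk c w x) =
    (fun w => cexp (b * ((tsum v)%:C)%C + c * ((tsum x)%:C)%C) *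
      \prod_(i < n) bker (- p) (A i.+1) (D i.+1) (tnth w i)).
  by apply/funext => w; rewrite lamqE.
rewrite F1 F2; split; [exact: cintegrableZl|exact: cintegrableZl|].
(* As [D 0 = 0], coordinate 0 yields the factor [gam p]; it has no counterpart among the coordinates
   of [w]. *)
rewrite !cintegralZl// E1 E2 big_ord_recl cintegral_bker0//.
have -> : \prod_(i < n) cintegral leb setT (bker p (A (lift ord0 i)) (D (lift ord0 i)) : RT -> C) =
    \prod_(i < n) (cexp (p * ((ln (D i.+1) - ln (A i.+1))%:C)%C) *
      cintegral leb setT (bker (- p) (A i.+1) (D i.+1) : RT -> C)).
  by apply: eq_bigr => i _; rewrite lift0; exact: cintegral_bker_reflect.
rewrite big_split /= -cexp_sum.
set P := \prod_(i < n) _; set z1 := - c * _ - _; set z2 := - p * _; set z3 := \sum_(i < n) _.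
(* The collected powers have exponent [p (tsum v + tsum x)], which turns one prefactor into the
   other. *)
have -> : b * ((tsum v)%:C)%C + c * ((tsum x)%:C)%C = z1 + (z2 + z3).
  have -> : z2 + z3 = p * ((tsum v + tsum x)%:C)%C.
    have -> : z3 = p * ((\sum_(i < n) ln (D i.+1) - \sum_(i < n) ln (A i.+1))%:C)%C.
      by rewrite /z3 -mulr_sumr -RCsum sumrB.
    have EA : \sum_(i < n.+1) ln (A i) = ln (A 0) + \sum_(i < n) ln (A i.+1).
      by rewrite big_ord_recl.
    by rewrite -sumln EA !(RCD, RCN) /z2; ring.
  by rewrite /z1 /p RCD; ring.
by rewrite !cexpD; ring.
Qed.

(** The complex identity at real parameters; both integrals are finite, so [fine] can be undone. *)
Lemma kernel_exchangeR (c b : R) : 0 < c + b ->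
  (\int[L n.+1]_u (qR c v u * lamR b u x)%:E =
   (gamR (c + b))%:E * \int[L n]_w (lamR b v w * qR c w x)%:E)%E.
Proof.
move=> p0; have [] := @kernel_exchange (c%:C)%C (b%:C)%C.
  by rewrite -RCD.
have -> : (fun u : n.+1.-tuple RT => qk (c%:C)%C v u * lam (b%:C)%C u x) =
    (fun u => ((qR c v u * lamR b u x)%:C)%C).
  by apply/funext => u; rewrite lam_real qk_real RCM.
have -> : (fun w : n.-tuple RT => lam (b%:C)%C v w * qk (c%:C)%C w x) =
    (fun w => ((lamR b v w * qR c w x)%:C)%C).
  by apply/funext => u; rewrite lam_real qk_real RCM.
move=> [j1 _] [j2 _]; rewrite -RCD gam_real !cintegral_real -RCM => /complexI.
rewrite /Rintegral => E; rewrite -[LHS]fineK; last exact: integrable_fin_num j1.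
have f2 := integrable_fin_num measurableT j2.
by rewrite E EFinM [X in (_ * X)%E]fineK.
Qed.

End exchange.

(** The parameters are a sequence over [nat], so that dropping the first one is a shift. *)
Fixpoint Phi n (b : nat -> C) : n.-tuple R -> C :=
  match n return n.-tuple R -> C with
  | 0 => fun=> 1
  | m.+1 => fun u => cintegral (L m) setT
      (fun x => lam (b 0%N) u x * @Phi m (fun i => b i.+1) x)
  end.

(** Values in [\bar R] make Tonelli applicable before finiteness is known. *)
Fixpoint PhiR n (b : nat -> R) : n.-tuple R -> \bar R :=
  match n return n.-tuple R -> \bar R with
  | 0 => fun=> 1%E
  | m.+1 => fun u => (\int[L m]_x
      ((lamR (b 0%N) u x)%:E * @PhiR m (fun i => b i.+1) x))%E
  end.

Lemma PhiR_ge0 n (b : nat -> R) (u : n.-tuple R) : (0 <= PhiR b u)%E.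
Proof.
elim: n b u => [|n IH] b u //=; apply: integral_ge0 => x _.
by rewrite mule_ge0 ?lee_fin ?lamR_ge0.
Qed.

Lemma cmeas_Phi n (b : nat -> C) : cmeas (@Phi n b : n.-tuple RT -> C).
Proof.
elim: n b => [|n IH] b /=; first exact: cmeas_cst.
apply: (@cmeas_cintegral1 _ _ (n.+1.-tuple RT) (n.-tuple RT) R (L n)
  (fun z => lam (b 0%N) z.1 z.2 * Phi (fun i => b i.+1) z.2)).
apply: cmeasM; first by apply: cmeas_lam; [exact: measurable_fst|exact: measurable_snd].
exact: cmeas_comp (IH _) measurable_snd.
Qed.

Lemma measurable_PhiR n (b : nat -> R) :
  measurable_fun setT (@PhiR n b : n.-tuple RT -> \bar R).
Proof.
elim: n b => [|n IH] b /=; first exact: measurable_cst.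
apply: (@measurable_fun_fubini_tonelli_F _ _ (n.+1.-tuple RT) (n.-tuple RT) R (L n)
  (fun z => (lamR (b 0%N) z.1 z.2)%:E * PhiR (fun i => b i.+1) z.2)%E).
  apply: emeasurable_funM.
    by apply: measurable_lamR; [exact: measurable_fst|exact: measurable_snd].
  exact: measurableT_comp (IH _) measurable_snd.
by move=> z; rewrite mule_ge0 ?lee_fin ?lamR_ge0 ?PhiR_ge0.
Qed.

Lemma normc_Phi_le n (b : nat -> C) (u : n.-tuple R) :
  ((normc (Phi b u))%:E <= PhiR (fun i => re (b i)) u)%E.
Proof.
elim: n b u => [|n IH] b u /=.
  by rewrite expr0n /= addr0 expr1n sqrtr1.
have mF : cmeas (fun x : n.-tuple RT => lam (b 0%N) u x * Phi (fun i => b i.+1) x).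
  by apply: cmeasM; [apply: cmeas_lam => //; exact: measurable_cst|exact: cmeas_Phi].
apply: le_trans (normc_cintegral_le _ mF) _; apply: ge0_le_integral => //.
- by move=> x _; rewrite lee_fin normc_ge0.
- by apply/measurable_EFinP; exact: measurable_normc.
- apply: emeasurable_funM; last exact: measurable_PhiR.
  by apply: measurable_lamR => //; exact: measurable_cst.
- move=> x _; rewrite normc_mul EFinM normc_lam lee_wpmul2l ?lee_fin ?lamR_ge0//.
Qed.

Definition tabs n (u : n.-tuple R) : R := \sum_(i < n) `|nth 0 u i|.

Lemma tsum_le n (u : n.-tuple R) : `|tsum u| <= tabs u.
Proof. exact: ler_norm_sum. Qed.

Lemma tabs_ge0 n (u : n.-tuple R) : 0 <= tabs u.
Proof. by apply: sumr_ge0. Qed.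

End kernels.

Section ge0_scale.
Context d (T : measurableType d) (R : realType) (mu : {measure set T -> \bar R}).
Variable f : T -> \bar R.
Hypotheses (mf : measurable_fun setT f) (f0 : forall x, (0 <= f x)%E).

Lemma ge0_integralTZl (k : R) : 0 <= k -> (\int[mu]_x (k%:E * f x) = k%:E * \int[mu]_x f x)%E.
Proof. by move=> k0; rewrite ge0_integralZl. Qed.

Lemma ge0_integralTZr (k : \bar R) : (0 <= k)%E -> (\int[mu]_x (f x * k) = (\int[mu]_x f x) * k)%E.
Proof. by move=> k0; rewrite ge0_integralZr. Qed.

End ge0_scale.

(** * Phi is an eigenfunction of qk *)

Section Phi_eigenfunction.
Context {R : realType}.
Local Notation leb := (@lebesgue_measure R).
Local Notation RT := (measurableTypeR R).
Local Notation L := (@lebesgue_tuple R).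
Local Notation C := R[i].

Lemma measurable_qR_PhiR n (c : R) (b : nat -> R) (v : n.-tuple R) :
  measurable_fun setT (fun u : n.-tuple RT => (qR c v u)%:E * PhiR b u)%E.
Proof.
apply: emeasurable_funM; last exact: measurable_PhiR.
by apply: measurable_qR => //; exact: measurable_cst.
Qed.

Lemma measurable_lamR_PhiR n (c : R) (b : nat -> R) (v : n.+1.-tuple R) :
  measurable_fun setT (fun u : n.-tuple RT => (lamR c v u)%:E * PhiR b u)%E.
Proof.
apply: emeasurable_funM; last exact: measurable_PhiR.
by apply: measurable_lamR => //; exact: measurable_cst.
Qed.

Lemma qR_PhiR_ge0 n (c : R) (b : nat -> R) (v u : n.-tuple R) :
  (0 <= (qR c v u)%:E * PhiR b u)%E.
Proof. by apply: mule_ge0; [rewrite lee_fin; exact: qR_ge0|exact: PhiR_ge0]. Qed.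

Lemma lamR_PhiR_ge0 n (c : R) (b : nat -> R) (v : n.+1.-tuple R) (u : n.-tuple R) :
  (0 <= (lamR c v u)%:E * PhiR b u)%E.
Proof. by apply: mule_ge0; [rewrite lee_fin; exact: lamR_ge0|exact: PhiR_ge0]. Qed.

(** The one-variable majorant of [PhiR_bound], with [a = u_i] and [b = u_(i+1)]: the first summand
    controls [x >= 0], the second [x < 0]. *)
Lemma cintegral_bker_pair (P a b : R) : 0 < P ->
  cintegrable leb setT (fun x : RT => bker (P%:C)%C (expR (- b)) 0 x + bker (P%:C)%C (expR a) 0 (0 - x)) /\
  cintegral leb setT (fun x : RT => bker (P%:C)%C (expR (- b)) 0 x + bker (P%:C)%C (expR a) 0 (0 - x)) =
  (((expR (P * b) + expR (- P * a)) * gamR P)%:C)%C.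
Proof.
move=> P0; have Pr : 0 < re (P%:C)%C by [].
have F1 : cintegrable leb setT (bker (P%:C)%C (expR (- b)) 0 : RT -> C).
  by apply: cintegrable_bker; [exact: expR_gt0|exact: lexx|right].
have F2 : cintegrable leb setT (bker (P%:C)%C (expR a) 0 : RT -> C).
  by apply: cintegrable_bker; [exact: expR_gt0|exact: lexx|right].
have [E2 I2] := cintegral_reflect 0 (cmeas_bker (P%:C)%C (expR a) 0).
have F3 := I2.1 F2; split; first exact: (cintegrableD F1 F3).
rewrite (cintegralD F1 F3) -E2 (cintegral_bker0 (expR_gt0 _) Pr) (cintegral_bker0 (expR_gt0 _) Pr).
rewrite !expRK gam_real -RCN -!RCM !cexp_real -mulrDl -RCD -RCM mulrNN.
by [].
Qed.

(** A crude bound, strong enough for the induction to close: exponential growth in [x] is beaten by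
    the doubly exponential decay of [lam], and the integral grows exponentially in [u] again. *)
Lemma PhiR_bound n (b : nat -> R) : exists K N : R, [/\ 0 <= K, 0 <= N &
  forall u : n.-tuple R, (PhiR b u <= (K * expR (N * tabs u))%:E)%E].
Proof.
elim: n b => [|n IH] b.
  by exists 1, 0; split => // u; rewrite mul0r expR0 mulr1.
have [K [N [K0 N0 H]]] := IH (fun i => b i.+1).
(* The growth [N] of the inner function plus that of the power in [lam]; the 1 makes [P]
   positive. *)
pose P := N + `|b 0%N| + 1.
have P0 : 0 < P by rewrite ltr_wpDl// addr_ge0.
pose g := gamR P.
have g0 : 0 <= g by apply: Rintegral_ge0 => x _; exact: expR_ge0.
(* Each coordinate of [x] contributes two terms with factor [gamR P], and each coordinate of [u]
   occurs in at most two of the resulting exponents. *)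
exists (K * (2 * g) ^+ n), (`|b 0%N| + 2 * P); split.
- by rewrite mulr_ge0 ?exprn_ge0 ?mulr_ge0.
- by rewrite addr_ge0// mulr_ge0// ltW.
move=> u.
pose F (i : nat) (x : RT) : C := bker (P%:C)%C (expR (- nth 0 u i.+1)) 0 x +
  bker (P%:C)%C (expR (nth 0 u i)) 0 (0 - x).
have FE i := (cintegral_bker_pair (nth 0 u i) (nth 0 u i.+1) P0).2.
have iF i : cintegrable leb setT (F i) := (cintegral_bker_pair (nth 0 u i) (nth 0 u i.+1) P0).1.
have [I1 E1] := cintegral_tuple_prod n iF.
pose f (i : nat) (x : R) : R := expR (P * x - pi * (expR x * expR (- nth 0 u i.+1))) +
  expR (- P * x - pi * (expR (- x) * expR (nth 0 u i))).
have FR i x : F i x = ((f i x)%:C)%C.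
  rewrite /F /f /bker RCD -!cexp_real sub0r opprK !mulr0 !addr0; congr (cexp _ + cexp _).
    by rewrite !(RCD, RCN, RCM).
  by rewrite !(RCD, RCN, RCM) mulrN mulNr.
have fint : (\int[L n]_x ((\prod_(i < n) f i (tnth x i))%:E) =
   (\prod_(i < n) ((expR (P * nth 0 u i.+1) + expR (- P * nth 0 u i)) * g))%:E)%E.
  have EF : (fun x : n.-tuple RT => \prod_(i < n) F i (tnth x i)) =
      (fun x => ((\prod_(i < n) f i (tnth x i))%:C)%C).
    by apply/funext => x; rewrite rmorph_prod; apply: eq_bigr => i _; rewrite FR.
  move: I1 E1; rewrite EF => -[j1 _].
  have -> := eq_bigr _ (fun (i : 'I_n) _ => FE i : cintegral leb setT (F i) = _).
  rewrite -rmorph_prod cintegral_real => /complexI.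
  by rewrite /Rintegral => <-; rewrite fineK//; exact: integrable_fin_num j1.
have f0 i x : 0 <= f i x by rewrite addr_ge0 ?expR_ge0.
have mf : measurable_fun setT (fun x : n.-tuple RT => (\prod_(i < n) f i (tnth x i))%:E).
  have [[h _] _] := (cintegrableTP _ _).1 I1.
  apply/measurable_EFinP; rewrite (_ : (fun x => _) = (fun x : n.-tuple RT => re (\prod_(i < n) F i (tnth x i))))//.
  by apply/funext => x; under [in RHS]eq_bigr do rewrite FR; rewrite -rmorph_prod.
have Kb0 : 0 <= K * expR (`|b 0%N| * tabs u) by rewrite mulr_ge0 ?expR_ge0.
rewrite /=.
apply: (@le_trans _ _ (\int[L n]_x ((K * expR (`|b 0%N| * tabs u))%:E * (\prod_(i < n) f i (tnth x i))%:E))%E).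
  apply: ge0_le_integral => //.
  - by move=> x _; exact: lamR_PhiR_ge0.
  - exact: measurable_lamR_PhiR.
  - exact: emeasurable_funM.
  move=> x _; apply: (@le_trans _ _ ((lamR (b 0%N) u x)%:E * (K * expR (N * tabs x))%:E)%E).
    by rewrite lee_wpmul2l ?lee_fin ?lamR_ge0.
  rewrite -!EFinM lee_fin mulrCA -mulrA ler_wpM2l//.
  (* Of the two decaying terms only the one that is effective for the sign of [x_i] is kept. *)
  have fE (i : 'I_n) : expR (P * `|nth 0 x i| - pi * (expR (nth 0 u i - nth 0 x i) + expR (nth 0 x i - nth 0 u i.+1))) <= f i (tnth x i).
    rewrite (tnth_nth 0) /f -!expRD; set y := nth 0 x i; set u1 := nth 0 u i; set u2 := nth 0 u i.+1.
    rewrite (addrC (- y)).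
    have e1 : 0 <= pi * expR (u1 - y) by rewrite mulr_ge0 ?expR_ge0// pi_ge0.
    have e2 : 0 <= pi * expR (y - u2) by rewrite mulr_ge0 ?expR_ge0// pi_ge0.
    have [y0|y0] := leP 0 y.
      rewrite ger0_norm// -[leLHS]addr0 lerD ?expR_ge0// ler_expR; lra.
    rewrite ltr0_norm// -[leLHS]add0r lerD ?expR_ge0// ler_expR; lra.
  apply: (@le_trans _ _ (expR (`|b 0%N| * tabs u) * \prod_(i < n) expR (P * `|nth 0 x i| - pi * (expR (nth 0 u i - nth 0 x i) + expR (nth 0 x i - nth 0 u i.+1))))); last first.
    rewrite ler_wpM2l ?expR_ge0//; apply: ler_prod => i _.
    by rewrite expR_ge0 fE.
  rewrite -expR_sum /lamR -!expRD ler_expR sumrB -!mulr_sumr -/(lamE u x) -/(tabs x).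
  have h1 : b 0%N * (tsum u - tsum x) <= `|b 0%N| * (tabs u + tabs x).
    apply: le_trans (ler_norm _) _; rewrite normrM ler_wpM2l//.
    by apply: le_trans (ler_normB _ _) _; rewrite lerD ?tsum_le.
  have := tabs_ge0 x; rewrite /P; lra.
rewrite (ge0_integralTZl (L n) mf _ Kb0); last by move=> x; rewrite lee_fin prodr_ge0.
rewrite [X in (_ * X)%E]fint -EFinM lee_fin.
have Hprod : \prod_(i < n) ((expR (P * nth 0 u i.+1) + expR (- P * nth 0 u i)) * g) <=
    (2 * g) ^+ n * expR (2 * P * tabs u).
  apply: (@le_trans _ _ (\prod_(i < n) (2 * g * expR (P * (`|nth 0 u i| + `|nth 0 u i.+1|))))).
    apply: ler_prod => i _; rewrite mulr_ge0 ?addr_ge0 ?expR_ge0//= mulrAC ler_wpM2r//.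
    set e := expR (P * (_ + _)).
    have h1 : expR (P * nth 0 u i.+1) <= e.
      rewrite ler_expR ler_pM2l//; have := ler_norm (nth 0 u i.+1).
      by have := normr_ge0 (nth 0 u i); lra.
    have h2 : expR (- P * nth 0 u i) <= e.
      rewrite ler_expR mulNr -mulrN ler_pM2l//; have := ler_norm (- nth 0 u i).
      by rewrite normrN; have := normr_ge0 (nth 0 u i.+1); lra.
    by lra.
  rewrite big_split /= prodr_const card_ord ler_wpM2l ?exprn_ge0 ?mulr_ge0//.
  rewrite -expR_sum ler_expR -mulr_sumr big_split /= -mulrA mulrCA ler_pM2l//.
  have h1 : \sum_(i < n) `|nth 0 u i| <= tabs u by rewrite /tabs big_ord_recr /= lerDl.
  have h2 : \sum_(i < n) `|nth 0 u i.+1| <= tabs u by rewrite /tabs big_ord_recl /= lerDr.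
  by lra.
apply: le_trans (ler_wpM2l Kb0 Hprod) _.
have -> : expR ((`|b 0%N| + 2 * P) * tabs u) = expR (`|b 0%N| * tabs u) * expR (2 * P * tabs u).
  by rewrite -expRD mulrDl.
by rewrite le_eqVlt; apply/orP; left; apply/eqP; ring.
Qed.

Lemma PhiR_fin n (b : nat -> R) (u : n.-tuple R) : (PhiR b u < +oo)%E.
Proof.
have [K [N [_ _ H]]] := PhiR_bound n b.
by apply: le_lt_trans (H u) _; rewrite ltry.
Qed.

Lemma cintegrable_lam_Phi n (b0 : C) (b : nat -> C) (u : n.+1.-tuple R) :
  cintegrable (L n) setT (fun x => lam b0 u x * Phi b x).
Proof.
(* With [b0] put in front, [PhiR] of the sequence is by definition the integral of the majorant. *)
pose b' i := re (if i is j.+1 then b j else b0).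
apply: (@cintegrable_dom _ (n.-tuple RT) R (L n) _
  (fun x => (lamR (re b0) u x)%:E * PhiR (fun i => re (b i)) x)%E).
- by apply: cmeasM; [apply: cmeas_lam => //; exact: measurable_cst|exact: cmeas_Phi].
- exact: measurable_lamR_PhiR.
- move=> x; rewrite normc_mul EFinM normc_lam lee_wpmul2l ?lee_fin ?lamR_ge0//.
  exact: normc_Phi_le.
- exact: (@PhiR_fin n.+1 b' u).
Qed.

Lemma PhiS n (b : nat -> C) (u : n.+1.-tuple R) : Phi b u =
  cintegral (L n) setT (fun x => lam (b 0%N) u x * Phi (fun i => b i.+1) x).
Proof. by []. Qed.

Lemma PhiRS n (b : nat -> R) (u : n.+1.-tuple R) : PhiR b u =
  (\int[L n]_x ((lamR (b 0%N) u x)%:E * PhiR (fun i => b i.+1) x))%E.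
Proof. by []. Qed.

(** Unfold one step of [PhiR], move [qR] past [lamR] at the price of one Gamma factor, and apply the
    induction hypothesis to the shorter function. *)
Lemma qR_PhiR n (c : R) (b : nat -> R) (v : n.-tuple R) :
  (forall k, (k < n)%N -> 0 < c + b k) ->
  (\int[L n]_u ((qR c v u)%:E * PhiR b u) =
   (\prod_(k < n) gamR (c + b k))%:E * PhiR b v)%E.
Proof.
elim: n b v => [|n IH] b v cb.
  rewrite integral_tuple0; last first.
    by under eq_fun do rewrite mule1; apply: measurable_qR => //; exact: measurable_cst.
  rewrite /= !mule1 big_ord0 /qR /tsum /qE !big_ord0 subrr mulr0 addr0 mulr0 subr0 expR0 //.
have p0 : 0 < c + b 0%N by exact: cb.
set b' := fun i => b i.+1; set g := gamR (c + b 0%N).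
have g0 : 0 <= g by apply: Rintegral_ge0 => x _; exact: expR_ge0.
have G0 : 0 <= \prod_(k < n) gamR (c + b' k).
  by apply: prodr_ge0 => k _; apply: Rintegral_ge0 => x _; exact: expR_ge0.
pose f1 (z : n.+1.-tuple RT * n.-tuple RT) : \bar R :=
  ((qR c v z.1 * lamR (b 0%N) z.1 z.2)%:E * PhiR b' z.2)%E.
pose f2 (z : n.-tuple RT * n.-tuple RT) : \bar R :=
  (g%:E * ((lamR (b 0%N) v z.2 * qR c z.2 z.1)%:E * PhiR b' z.1))%E.
have mf1 : measurable_fun setT f1.
  apply: emeasurable_funM; last exact: measurableT_comp (measurable_PhiR _) measurable_snd.
  under eq_fun do rewrite EFinM; apply: emeasurable_funM.
    by apply: measurable_qR; [exact: measurable_cst|exact: measurable_fst].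
  by apply: measurable_lamR; [exact: measurable_fst|exact: measurable_snd].
have mf2 : measurable_fun setT f2.
  apply: emeasurable_funM => //.
  apply: emeasurable_funM; last exact: measurableT_comp (measurable_PhiR _) measurable_fst.
  under eq_fun do rewrite EFinM; apply: emeasurable_funM.
    by apply: measurable_lamR; [exact: measurable_cst|exact: measurable_snd].
  by apply: measurable_qR; [exact: measurable_snd|exact: measurable_fst].
have f10 z : (0 <= f1 z)%E.
  apply: mule_ge0; last exact: PhiR_ge0.
  by rewrite lee_fin; apply: mulr_ge0; [exact: qR_ge0|exact: lamR_ge0].
have f20 z : (0 <= f2 z)%E.
  apply: mule_ge0; first by rewrite lee_fin.
  apply: mule_ge0; last exact: PhiR_ge0.
  by rewrite lee_fin; apply: mulr_ge0; [exact: lamR_ge0|exact: qR_ge0].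
transitivity (\int[L n.+1]_u \int[L n]_x f1 (u, x))%E.
  apply: eq_integral => u _; rewrite PhiRS -ge0_integralZl//; last 3 first.
  - exact: measurable_lamR_PhiR.
  - by move=> x _; exact: lamR_PhiR_ge0.
  - by rewrite lee_fin qR_ge0.
  by apply: eq_integral => x _; rewrite /f1 /= EFinM muleA.
rewrite (fubini_tonelli f1)//.
(* For fixed [x] the kernels are exchanged: the middle variable [u] with [n.+1] coordinates gives
   way to [w] with [n]. *)
transitivity (\int[L n]_x \int[L n]_w f2 (x, w))%E.
  apply: eq_integral => x _.
  transitivity ((\int[L n.+1]_u (qR c v u * lamR (b 0%N) u x)%:E) * PhiR b' x)%E.
    rewrite -ge0_integralZr ?PhiR_ge0//.
      under eq_fun do rewrite EFinM; apply: emeasurable_funM.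
        by apply: measurable_qR => //; exact: measurable_cst.
      by apply: measurable_lamR => //; exact: measurable_cst.
    by move=> u _; rewrite lee_fin; apply: mulr_ge0; [exact: qR_ge0|exact: lamR_ge0].
  rewrite kernel_exchangeR// -/g -muleA /f2 /=.
  have mq : measurable_fun setT (fun w : n.-tuple RT => (lamR (b 0%N) v w * qR c w x)%:E).
    under eq_fun do rewrite EFinM; apply: emeasurable_funM.
      by apply: measurable_lamR => //; exact: measurable_cst.
    by apply: measurable_qR => //; exact: measurable_cst.
  have q0 w : (0 <= (lamR (b 0%N) v w * qR c w x)%:E)%E.
    by rewrite lee_fin; apply: mulr_ge0; [exact: lamR_ge0|exact: qR_ge0].
  have mqP : measurable_fun setT (fun w : n.-tuple RT => (lamR (b 0%N) v w * qR c w x)%:E * PhiR b' x)%E.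
    by apply: emeasurable_funM => //; exact: measurable_cst.
  have qP0 (w : n.-tuple RT) : (0 <= (lamR (b 0%N) v w * qR c w x)%:E * PhiR b' x)%E.
    by apply: mule_ge0; [exact: q0|exact: PhiR_ge0].
  rewrite (ge0_integralTZl (L n) mqP qP0 g0); congr (_ * _)%E.
  by rewrite (ge0_integralTZr (L n) mq q0) ?PhiR_ge0.
rewrite (fubini_tonelli f2)//.
transitivity (\int[L n]_w ((g * \prod_(k < n) gamR (c + b' k))%:E *
    ((lamR (b 0%N) v w)%:E * PhiR b' w)))%E.
  apply: eq_integral => w _; rewrite /f2 /=.
  have mq : measurable_fun setT (fun x : n.-tuple RT => (qR c w x)%:E * PhiR b' x)%E.
    exact: measurable_qR_PhiR.
  have q0 x : (0 <= (qR c w x)%:E * PhiR b' x)%E.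
    by exact: qR_PhiR_ge0.
  under eq_integral do rewrite EFinM -muleA.
  have mlq : measurable_fun setT (fun x : n.-tuple RT => (lamR (b 0%N) v w)%:E * ((qR c w x)%:E * PhiR b' x))%E.
    by apply: emeasurable_funM => //; exact: measurable_cst.
  have lq0 x : (0 <= (lamR (b 0%N) v w)%:E * ((qR c w x)%:E * PhiR b' x))%E.
    by apply: mule_ge0; [rewrite lee_fin; exact: lamR_ge0|exact: q0].
  rewrite (ge0_integralTZl (L n) mlq lq0 g0).
  rewrite (ge0_integralTZl (L n) mq q0 (lamR_ge0 _ _ _)).
  rewrite IH; last by move=> k kn; exact: cb.
  by rewrite EFinM -!muleA; congr (_ * _)%E; rewrite muleCA.
have mlP : measurable_fun setT (fun w : n.-tuple RT => (lamR (b 0%N) v w)%:E * PhiR b' w)%E.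
  exact: measurable_lamR_PhiR.
have lP0 w : (0 <= (lamR (b 0%N) v w)%:E * PhiR b' w)%E.
  by exact: lamR_PhiR_ge0.
rewrite (ge0_integralTZl (L n) mlP lP0 (mulr_ge0 g0 G0)).
by rewrite big_ord_recl.
Qed.

Lemma qR_PhiR_fin n (c : R) (b : nat -> R) (v : n.-tuple R) :
  (forall k, (k < n)%N -> 0 < c + b k) ->
  (\int[L n]_u ((qR c v u)%:E * PhiR b u) < +oo)%E.
Proof.
move=> cb; rewrite (qR_PhiR v cb); apply: lte_mul_pinfty => //; last exact: PhiR_fin.
by rewrite lee_fin; apply: prodr_ge0 => k _; apply: Rintegral_ge0 => x _; exact: expR_ge0.
Qed.

Lemma cintegrable_qk_Phi n (c : C) (b : nat -> C) (v : n.-tuple R) :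
  (forall k, (k < n)%N -> 0 < re (c + b k)) ->
  cintegrable (L n) setT (fun u => qk c v u * Phi b u).
Proof.
move=> cb; apply: (@cintegrable_dom _ (n.-tuple RT) R (L n) _
  (fun x => (qR (re c) v x)%:E * PhiR (fun i => re (b i)) x)%E).
- by apply: cmeasM; [apply: cmeas_qk => //; exact: measurable_cst|exact: cmeas_Phi].
- exact: measurable_qR_PhiR.
- move=> x; rewrite normc_mul EFinM normc_qk; apply: lee_wpmul2l; last exact: normc_Phi_le.
  by rewrite lee_fin; exact: qR_ge0.
- by apply: qR_PhiR_fin => k kn; rewrite -ReD; exact: cb.
Qed.

(** The same computation as in [qR_PhiR], whose exact values at the real parts of the parameters
    bound the double integrals. *)
Lemma qk_Phi n (c : C) (b : nat -> C) (v : n.-tuple R) :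
  (forall k, (k < n)%N -> 0 < re (c + b k)) ->
  cintegral (L n) setT (fun u => qk c v u * Phi b u) =
  \prod_(k < n) gam (c + b k) * Phi b v.
Proof.
elim: n b v => [|n IH] b v cb.
  rewrite (cintegral_tuple0 _).1 big_ord0 /= !mulr1 /qk /tsum /qE !big_ord0 subrr !mulr0.
  by rewrite addr0 mulr0 subr0 cexp0.
have p0 : 0 < re (c + b 0%N) by exact: cb.
set b' := fun i => b i.+1; set g := gam (c + b 0%N).
have [ng ng0 ngE] : exists2 ng : R, 0 <= ng & ng = normc g.
  by exists (normc g) => //; exact: normc_ge0.
pose bR i := re (b i); pose b'R i := re (b' i); pose cR := re c.
have cb' k : (k < n)%N -> 0 < re (c + b' k) by move=> kn; exact: cb.
have cbR' k : (k < n)%N -> 0 < cR + b'R k by move=> kn; rewrite -ReD; exact: cb'.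
pose f1 (z : n.+1.-tuple RT * n.-tuple RT) : C := qk c v z.1 * (lam (b 0%N) z.1 z.2 * Phi b' z.2).
pose f2 (z : n.-tuple RT * n.-tuple RT) : C :=
  g * (lam (b 0%N) v z.1 * (qk c z.1 z.2 * Phi b' z.2)).
(* [g1] and [g2] dominate the integrands before and after the exchange of kernels, one for each use
   of Fubini. *)
pose g1 (z : n.+1.-tuple RT * n.-tuple RT) : \bar R :=
  ((qR cR v z.1)%:E * ((lamR (bR 0%N) z.1 z.2)%:E * PhiR b'R z.2))%E.
pose g2 (z : n.-tuple RT * n.-tuple RT) : \bar R :=
  (ng%:E * ((lamR (bR 0%N) v z.1)%:E * ((qR cR z.1 z.2)%:E * PhiR b'R z.2)))%E.
have mf1 : cmeas f1.
  apply: cmeasM; first by apply: cmeas_qk; [exact: measurable_cst|exact: measurable_fst].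
  apply: cmeasM; last exact: (cmeas_comp (@cmeas_Phi R n b') measurable_snd).
  by apply: cmeas_lam; [exact: measurable_fst|exact: measurable_snd].
have mf2 : cmeas f2.
  apply: cmeasM; first exact: cmeas_cst.
  apply: cmeasM; first by apply: cmeas_lam; [exact: measurable_cst|exact: measurable_fst].
  apply: cmeasM; last exact: (cmeas_comp (@cmeas_Phi R n b') measurable_snd).
  by apply: cmeas_qk; [exact: measurable_fst|exact: measurable_snd].
have mg1 : measurable_fun setT g1.
  apply: emeasurable_funM.
    by apply: measurable_qR; [exact: measurable_cst|exact: measurable_fst].
  apply: emeasurable_funM; last exact: measurableT_comp (measurable_PhiR _) measurable_snd.
  by apply: measurable_lamR; [exact: measurable_fst|exact: measurable_snd].
have mg2 : measurable_fun setT g2.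
  apply: emeasurable_funM; first exact: measurable_cst.
  apply: emeasurable_funM.
    by apply: measurable_lamR; [exact: measurable_cst|exact: measurable_fst].
  apply: emeasurable_funM; last exact: measurableT_comp (measurable_PhiR _) measurable_snd.
  by apply: measurable_qR; [exact: measurable_fst|exact: measurable_snd].
have fg1 z : ((normc (f1 z))%:E <= g1 z)%E.
  rewrite /f1 /g1 (normc_mul (qk _ _ _)) (normc_mul (lam _ _ _)) normc_qk normc_lam 2!EFinM.
  apply: lee_wpmul2l; first by rewrite lee_fin; exact: qR_ge0.
  apply: lee_wpmul2l; first by rewrite lee_fin; exact: lamR_ge0.
  exact: normc_Phi_le.
have fg2 z : ((normc (f2 z))%:E <= g2 z)%E.
  rewrite /f2 /g2 (normc_mul g) -ngE (normc_mul (lam _ _ _)) (normc_mul (qk _ _ _)) normc_qk normc_lam 3!EFinM.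
  apply: lee_wpmul2l; first by rewrite lee_fin.
  apply: lee_wpmul2l; first by rewrite lee_fin; exact: lamR_ge0.
  apply: lee_wpmul2l; first by rewrite lee_fin; exact: qR_ge0.
  exact: normc_Phi_le.
have ig1 : (\int[L n.+1]_u \int[L n]_x g1 (u, x) < +oo)%E.
  rewrite (_ : (\int[L n.+1]_u _)%E = (\int[L n.+1]_u ((qR cR v u)%:E * PhiR bR u))%E).
    by apply: qR_PhiR_fin => k kn; rewrite -ReD; exact: cb.
  apply: eq_integral => u _.
  exact: (ge0_integralTZl (L n) (measurable_lamR_PhiR _ _ _) (lamR_PhiR_ge0 _ _ _) (qR_ge0 _ _ _)).
have ig2 : (\int[L n]_w \int[L n]_x g2 (w, x) < +oo)%E.
  rewrite (_ : (\int[L n]_w _)%E = (\int[L n]_w ((ng * \prod_(k < n) gamR (cR + b'R k))%:E *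
      ((lamR (bR 0%N) v w)%:E * PhiR b'R w)))%E); last first.
    apply: eq_integral => w _; rewrite /g2 /=.
    have m1 := measurable_qR_PhiR cR b'R w; have z1 := qR_PhiR_ge0 cR b'R w.
    have m2 : measurable_fun setT (fun x : n.-tuple RT => (lamR (bR 0%N) v w)%:E *
        ((qR cR w x)%:E * PhiR b'R x))%E.
      by apply: emeasurable_funM => //; exact: measurable_cst.
    have z2 x : (0 <= (lamR (bR 0%N) v w)%:E * ((qR cR w x)%:E * PhiR b'R x))%E.
      by apply: mule_ge0; [rewrite lee_fin; exact: lamR_ge0|exact: z1].
    rewrite (ge0_integralTZl (L n) m2 z2 ng0).
    rewrite (ge0_integralTZl (L n) m1 z1 (lamR_ge0 _ _ _)) (qR_PhiR w cbR').
    by rewrite EFinM -!muleA; congr (_ * _)%E; rewrite muleCA.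
  have k0 : 0 <= ng * \prod_(k < n) gamR (cR + b'R k).
    apply: mulr_ge0 => //.
    by apply: prodr_ge0 => k _; apply: Rintegral_ge0 => x _; exact: expR_ge0.
  rewrite (ge0_integralTZl (L n) (measurable_lamR_PhiR _ _ _) (lamR_PhiR_ge0 _ _ _) k0).
  apply: lte_mul_pinfty => //.
  exact: (@PhiR_fin n.+1 bR v).
have E1 := cfubini mf1 mg1 fg1 ig1; have E2 := cfubini mf2 mg2 fg2 ig2.
transitivity (cintegral (L n.+1) setT (fun u => cintegral (L n) setT (fun x => f1 (u, x)))).
  apply: eq_cintegral => u _; rewrite PhiS; apply: esym.
  exact: (cintegralZl (qk c v u) (cintegrable_lam_Phi (b 0%N) b' u)).
rewrite E1.
transitivity (cintegral (L n) setT (fun x => cintegral (L n) setT (fun w => f2 (w, x)))).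
  apply: eq_cintegral => x _; have [J1 J2 E] := kernel_exchange v x p0.
  transitivity (cintegral (L n.+1) setT (fun u => qk c v u * lam (b 0%N) u x) * Phi b' x).
    rewrite -(cintegralZr (Phi b' x) J1); apply: eq_cintegral => u _.
    by rewrite /f1 [LHS]mulrA.
  have J3 : cintegrable (L n) setT (fun w => lam (b 0%N) v w * qk c w x * Phi b' x).
    have := cintegrableZl (Phi b' x) J2; congr (cintegrable _ _ _).
    by apply/funext => w; rewrite [LHS]mulrC.
  rewrite E -/g -mulrA -(cintegralZr (Phi b' x) J2) -(cintegralZl g J3).
  apply: eq_cintegral => w _; congr (g * _); exact: esym (mulrA _ _ _).
have J4 := cintegrable_lam_Phi (b 0%N) b' v.
rewrite -E2 big_ord_recl -mulrA PhiS -(cintegralZl _ J4) -(cintegralZl _ (cintegrableZl _ J4)).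
apply: eq_cintegral => w _.
have iqP := cintegrable_qk_Phi w cb'.
have e1 : cintegral (L n) setT (fun x => f2 (w, x)) = _ :=
  cintegralZl g (cintegrableZl (lam (b 0%N) v w) iqP).
rewrite e1 (cintegralZl (lam (b 0%N) v w) iqP).
by rewrite (IH b' w cb') /g; congr (_ * _); rewrite [LHS]mulrCA.
Qed.

End Phi_eigenfunction.

(** * Rankin-Selberg integrals of Phi *)

Section rankin_selberg.
Context {R : realType}.
Local Notation RT := (measurableTypeR R).
Local Notation L := (@lebesgue_tuple R).
Local Notation C := R[i].

Lemma Phi_twist n (b : nat -> C) (t : C) (u : n.-tuple R) :
  Phi (fun i => b i + t) u = cexp (t * ((tsum u)%:C)%C) * Phi b u.
Proof.
elim: n b u => [|n IH] b u; first by rewrite /= /tsum big_ord0 mulr0 cexp0 mulr1.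
rewrite !PhiS -cintegralZl; last exact: cintegrable_lam_Phi.
apply: eq_cintegral => x _; rewrite (IH (fun i => b i.+1)) mulrA [RHS]mulrA.
congr (_ * _); rewrite /lam -!cexpD; congr cexp; rewrite !(RCD, RCN); ring.
Qed.

Definition addt (t : R) n (x : n.-tuple RT) : n.-tuple RT := [tuple t + tnth x i | i < n].

Lemma nth_addt t n (x : n.-tuple RT) i : (i < n)%N -> nth 0 (addt t x) i = t + nth 0 x i.
Proof.
move=> ni; have := tnth_mktuple (fun i => t + tnth x i) (Ordinal ni).
by rewrite !(tnth_nth 0).
Qed.

Lemma tsum_addt t n (x : n.-tuple RT) : tsum (addt t x) = n%:R * t + tsum x.
Proof.
rewrite /tsum; under eq_bigr => i _ do rewrite nth_addt//.
by rewrite big_split /= sumr_const card_ord mulr_natl.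
Qed.

(** A translation is the composite of two reflections. *)
Lemma cintegral_addt t n (f : n.-tuple RT -> C) : cmeas f ->
  cintegral (L n) setT f = cintegral (L n) setT (fun x => f (addt t x)).
Proof.
move=> mf; rewrite (cintegral_trefl (fun=> t) mf).
rewrite (cintegral_trefl (fun=> 0) (cmeas_comp mf (@measurable_trefl R (fun=> t) n))).
apply: eq_cintegral => x _; congr f; apply/eq_from_tnth => i.
by rewrite !tnth_mktuple sub0r opprK.
Qed.

(** The central character: [lamE] is unchanged when both arguments are translated by [t], so only
    the powers contribute. *)
Lemma Phi_addt n (b : nat -> C) (t : R) (u : n.-tuple R) :
  Phi b (addt t u) = cexp (\sum_(i < n) b i * (t%:C)%C) * Phi b u.
Proof.
elim: n b u => [|n IH] b u; first by rewrite /= big_ord0 cexp0 mulr1.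
rewrite !PhiS -cintegralZl; last exact: cintegrable_lam_Phi.
have mF : cmeas (fun x : n.-tuple RT => lam (b 0%N) (addt t u) x * Phi (fun i => b i.+1) x).
  by apply: cmeasM; [apply: cmeas_lam => //; exact: measurable_cst|exact: cmeas_Phi].
rewrite (cintegral_addt t mF); apply: eq_cintegral => x _; rewrite IH mulrA [RHS]mulrA.
congr (_ * _); rewrite /lam -!cexpD; congr cexp.
have -> : lamE (addt t u) (addt t x) = lamE u x.
  apply: eq_bigr => i _; rewrite !nth_addt ?ltnS// 1?ltnW//.
  by congr (expR _ + expR _); ring.
rewrite !tsum_addt big_ord_recl -natr1 !(RCD, RCN, RCM) /=; ring.
Qed.

(** In the coordinates [u] this is the padding of [y] by a last entry 1. *)
Definition rcons0 n (u : n.-tuple R) : n.+1.-tuple R := [tuple of rcons u 0].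

(** This is [y_n^2], because the last coordinate of [u] is [2 log y_n]; [weq] below contains the
    Gaussian [e^(- pi y_n^2)]. *)
Definition lastE n (u : n.-tuple R) : R := if n is m.+1 then expR (nth 0 u m) else 0.

Lemma nth_rcons0 n (u : n.-tuple R) i : nth 0 (rcons0 u) i = nth 0 u i.
Proof.
rewrite nth_rcons size_tuple; case: ltnP => // ni; rewrite nth_default ?size_tuple//.
by case: ifP.
Qed.

Lemma tsum_rcons0 n (u : n.-tuple R) : tsum (rcons0 u) = tsum u.
Proof.
rewrite /tsum big_ord_recr /= nth_rcons0 [X in _ + X]nth_default ?size_tuple// addr0.
by apply: eq_bigr => i _; exact: nth_rcons0.
Qed.

Lemma lamE_rcons0 n (u v : n.-tuple R) : lamE (rcons0 u) v = qE v u + lastE v.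
Proof.
rewrite /lamE /qE big_split /= -addrA; congr (_ + _).
  by apply: eq_bigr => i _; rewrite nth_rcons0.
case: n u v => [|n] u v; first by rewrite !big_ord0 addr0.
rewrite big_ord_recr /= nth_rcons0 [X in _ - X]nth_default ?size_tuple// subr0; congr (_ + _).
by apply: eq_bigr => i _; rewrite nth_rcons0.
Qed.

Lemma qE_rcons0 n (v : n.-tuple R) (u : n.+1.-tuple R) :
  qE (rcons0 v) u = lamE u v + lastE u.
Proof.
rewrite /lamE /qE big_split /= big_ord_recr /= nth_rcons0.
rewrite [X in _ + expR (_ - X) + _]nth_default ?size_tuple// subr0 addrAC; congr (_ + _ + _).
  by apply: eq_bigr => i _; rewrite nth_rcons0.
by apply: eq_bigr => i _; rewrite nth_rcons0.
Qed.

Definition wlt (s : C) n (u : n.-tuple R) : C := cexp (s * ((tsum u)%:C)%C).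
Definition weq (s : C) n (u : n.-tuple R) : C :=
  cexp (s * ((tsum u)%:C)%C - ((pi * lastE u)%:C)%C).
Definition wltR (s : R) n (u : n.-tuple R) : R := expR (s * tsum u).
Definition weqR (s : R) n (u : n.-tuple R) : R := expR (s * tsum u - pi * lastE u).

Lemma normc_wlt s n (u : n.-tuple R) : normc (wlt s u) = wltR (re s) u.
Proof. by rewrite normc_cexp ReM /= mulr0 subr0. Qed.

Lemma normc_weq s n (u : n.-tuple R) : normc (weq s u) = weqR (re s) u.
Proof. by rewrite normc_cexp ReD ReN ReM /= mulr0 subr0. Qed.

(** With 0 as last coordinate of the first argument, [lamE] exceeds [qE] by [e^(v_n)]: the Gaussian
    in [v] appears. *)
Lemma lam_wlt b s n (u v : n.-tuple R) :
  lam b (rcons0 u) v * wlt s u = qk (s + b) v u * weq s v.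
Proof.
rewrite /lam /wlt /qk /weq -!cexpD; congr cexp.
by rewrite lamE_rcons0 tsum_rcons0 !(RCD, RCN, RCM); ring.
Qed.

(** Conversely, the Gaussian in [u] is the one term that [qE] has beyond [lamE] when [v] is padded
    by 0. *)
Lemma lam_weq b s n (u : n.+1.-tuple R) (v : n.-tuple R) :
  lam b u v * weq s u = qk (s + b) (rcons0 v) u * wlt s v.
Proof.
rewrite /lam /wlt /qk /weq -!cexpD; congr cexp.
by rewrite qE_rcons0 tsum_rcons0 !(RCD, RCN, RCM); ring.
Qed.

Lemma lamR_wltR b s n (u v : n.-tuple R) :
  lamR b (rcons0 u) v * wltR s u = qR (s + b) v u * weqR s v.
Proof.
rewrite /lamR /wltR /qR /weqR -!expRD; congr expR.
by rewrite lamE_rcons0 tsum_rcons0; ring.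
Qed.

Lemma lamR_weqR b s n (u : n.+1.-tuple R) (v : n.-tuple R) :
  lamR b u v * weqR s u = qR (s + b) (rcons0 v) u * wltR s v.
Proof.
rewrite /lamR /wltR /qR /weqR -!expRD; congr expR.
by rewrite qE_rcons0 tsum_rcons0; ring.
Qed.

Lemma measurable_rcons0 n : measurable_fun setT (@rcons0 n : n.-tuple RT -> n.+1.-tuple RT).
Proof.
apply/measurable_fun_tnthP => i.
rewrite (_ : _ \o _ = (fun x : n.-tuple RT => nth 0 (x : n.-tuple R) i)); last first.
  by apply/funext => x /=; rewrite (tnth_nth 0) nth_rcons0.
exact: measurable_tnth0.
Qed.

Let measurable_lastE n : measurable_fun setT (fun x : n.-tuple RT => lastE x).
Proof.
case: n => [|n]; first exact: measurable_cst.
by apply: (measurableT_comp (@measurable_expR R)); exact: measurable_tnth0.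
Qed.

Lemma cmeas_wlt s n : cmeas (@wlt s n : n.-tuple RT -> C).
Proof.
apply: cmeas_cexp; apply: cmeasM; first exact: cmeas_cst.
by apply: cmeas_real; exact: measurable_tsum.
Qed.

Lemma cmeas_weq s n : cmeas (@weq s n : n.-tuple RT -> C).
Proof.
apply: cmeas_cexp; apply: cmeasD.
  by apply: cmeasM; [exact: cmeas_cst|apply: cmeas_real; exact: measurable_tsum].
apply: cmeasN; apply: cmeas_real; apply: measurable_funM => //.
exact: measurable_lastE.
Qed.

Lemma measurable_wltR s n : measurable_fun setT (fun u : n.-tuple RT => (wltR s u)%:E).
Proof.
have := measurable_normc (cmeas_wlt (s%:C)%C n).
by under eq_fun do rewrite normc_wlt; move=> /= H; exact/measurable_EFinP.
Qed.

Lemma measurable_weqR s n : measurable_fun setT (fun u : n.-tuple RT => (weqR s u)%:E).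
Proof.
have := measurable_normc (cmeas_weq (s%:C)%C n).
by under eq_fun do rewrite normc_weq; move=> /= H; exact/measurable_EFinP.
Qed.

Lemma wltR_ge0 s n (u : n.-tuple R) : 0 <= wltR s u.
Proof. exact: expR_ge0. Qed.

Lemma weqR_ge0 s n (u : n.-tuple R) : 0 <= weqR s u.
Proof. exact: expR_ge0. Qed.

Lemma gamR_ge0 (a : R) : 0 <= gamR a.
Proof. by apply: Rintegral_ge0 => x _; exact: expR_ge0. Qed.

(** * Integrating out [Phi] against [qk] inside a double integral *)

Section qswap.
Variables (k m : nat) (w : k.-tuple R -> m.-tuple R).
Hypothesis mw : measurable_fun setT (w : k.-tuple RT -> m.-tuple RT).

(** Stated with a map [w] to cover both reductions: [w] is the identity from ranks [(n+1, n)] to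
    [(n, n)], and [rcons0] from [(n+1, n+1)] to [(n+1, n)]. *)
Lemma qR_swap (c : R) (b : nat -> R) (A : k.-tuple R -> \bar R) :
  measurable_fun setT (A : k.-tuple RT -> \bar R) -> (forall v, (0 <= A v)%E) ->
  (forall i, (i < m)%N -> 0 < c + b i) ->
  (\int[L m]_u \int[L k]_v ((qR c (w v) u)%:E * PhiR b u * A v) =
   (\prod_(i < m) gamR (c + b i))%:E * \int[L k]_v (A v * PhiR b (w v)))%E.
Proof.
move=> mA A0 cb.
pose f (z : m.-tuple RT * k.-tuple RT) : \bar R :=
  ((qR c (w z.2) z.1)%:E * PhiR b z.1 * A z.2)%E.
have mf : measurable_fun setT f.
  apply: emeasurable_funM; last exact: measurableT_comp mA measurable_snd.
  apply: emeasurable_funM; last exact: measurableT_comp (measurable_PhiR _) measurable_fst.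
  by apply: measurable_qR; [exact: measurableT_comp mw measurable_snd|exact: measurable_fst].
have f0 z : (0 <= f z)%E by apply: mule_ge0; [exact: qR_PhiR_ge0|exact: A0].
rewrite [LHS](fubini_tonelli f mf f0).
have mAP : measurable_fun setT (fun v : k.-tuple RT => A v * PhiR b (w v))%E.
  by apply: emeasurable_funM => //; exact: measurableT_comp (measurable_PhiR _) mw.
have AP0 v : (0 <= A v * PhiR b (w v))%E.
  by apply: mule_ge0; [exact: A0|exact: PhiR_ge0].
have G0 : 0 <= \prod_(i < m) gamR (c + b i) by apply: prodr_ge0 => i _; exact: gamR_ge0.
rewrite -(ge0_integralTZl (L k) mAP AP0 G0); apply: eq_integral => v _.
rewrite (ge0_integralTZr (L m) (measurable_qR_PhiR c b (w v)) (qR_PhiR_ge0 c b (w v)) (A0 v)).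
by rewrite (qR_PhiR (w v) cb) -muleA; congr (_ * _)%E; rewrite muleC.
Qed.

Lemma qk_swap (c : C) (b : nat -> C) (A : k.-tuple R -> C) (AR : k.-tuple R -> \bar R) :
  cmeas (A : k.-tuple RT -> C) -> measurable_fun setT (AR : k.-tuple RT -> \bar R) ->
  (forall v, ((normc (A v))%:E <= AR v)%E) ->
  (forall i, (i < m)%N -> 0 < re (c + b i)) ->
  (\int[L k]_v (AR v * PhiR (fun i => re (b i)) (w v)) < +oo)%E ->
  cintegral (L m) setT (fun u => cintegral (L k) setT (fun v => qk c (w v) u * Phi b u * A v)) =
  \prod_(i < m) gam (c + b i) * cintegral (L k) setT (fun v => A v * Phi b (w v)).
Proof.
move=> mA mAR AAR cb iA.
set bR := fun i => re (b i); pose cR := re c.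
have A0 v : (0 <= AR v)%E by apply: le_trans (AAR v); rewrite lee_fin; exact: normc_ge0.
pose f (z : m.-tuple RT * k.-tuple RT) : C := qk c (w z.2) z.1 * Phi b z.1 * A z.2.
pose g (z : m.-tuple RT * k.-tuple RT) : \bar R :=
  ((qR cR (w z.2) z.1)%:E * PhiR bR z.1 * AR z.2)%E.
have mf : cmeas f.
  apply: cmeasM; last exact: (cmeas_comp mA measurable_snd).
  apply: cmeasM; last exact: (cmeas_comp (@cmeas_Phi R m b) measurable_fst).
  by apply: cmeas_qk; [exact: measurableT_comp mw measurable_snd|exact: measurable_fst].
have mg : measurable_fun setT g.
  apply: emeasurable_funM; last exact: measurableT_comp mAR measurable_snd.
  apply: emeasurable_funM; last exact: measurableT_comp (measurable_PhiR _) measurable_fst.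
  by apply: measurable_qR; [exact: measurableT_comp mw measurable_snd|exact: measurable_fst].
have fg z : ((normc (f z))%:E <= g z)%E.
  rewrite /f /g (normc_mul (_ * _)) (normc_mul (qk _ _ _)) normc_qk 2!EFinM.
  apply: lee_pmul; [|by rewrite lee_fin; exact: normc_ge0| |exact: AAR].
    by rewrite -EFinM lee_fin; apply: mulr_ge0; [exact: qR_ge0|exact: normc_ge0].
  by apply: lee_wpmul2l; [rewrite lee_fin; exact: qR_ge0|exact: normc_Phi_le].
have cbR i : (i < m)%N -> 0 < cR + bR i by move=> lt_im; rewrite -ReD; exact: cb.
have ig : (\int[L m]_u \int[L k]_v g (u, v) < +oo)%E.
  rewrite [X in (X < _)%E](qR_swap mAR A0 cbR); apply: lte_mul_pinfty => //.
  by rewrite lee_fin; apply: prodr_ge0 => i _; exact: gamR_ge0.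
rewrite [LHS](cfubini mf mg fg ig) -cintegralZl; last first.
  apply: (@cintegrable_dom _ (k.-tuple RT) R (L k) _ (fun v => AR v * PhiR bR (w v))%E) => //.
  - by apply: cmeasM => //; exact: (cmeas_comp (@cmeas_Phi R m b) mw).
  - by apply: emeasurable_funM => //; exact: measurableT_comp (measurable_PhiR _) mw.
  move=> v; rewrite normc_mul EFinM; apply: lee_pmul; [| |exact: AAR|exact: normc_Phi_le].
    by rewrite lee_fin; exact: normc_ge0.
  by rewrite lee_fin; exact: normc_ge0.
apply: eq_cintegral => v _; rewrite /f /= cintegralZr; last exact: cintegrable_qk_Phi.
by rewrite (qk_Phi (w v) cb) -mulrA; congr (_ * _); rewrite mulrC.
Qed.

End qswap.

Definition RSlt (s : C) (b b' : nat -> C) n (u : n.-tuple R) : C :=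
  Phi b (rcons0 u) * (Phi b' u * wlt s u).
Definition RSeq (s : C) (b b' : nat -> C) n (u : n.-tuple R) : C :=
  Phi b u * (Phi b' u * weq s u).
Definition RSltR (s : R) (b b' : nat -> R) n (u : n.-tuple R) : \bar R :=
  (PhiR b (rcons0 u) * (PhiR b' u * (wltR s u)%:E))%E.
Definition RSeqR (s : R) (b b' : nat -> R) n (u : n.-tuple R) : \bar R :=
  (PhiR b u * (PhiR b' u * (weqR s u)%:E))%E.

Lemma cmeas_RSlt s b b' n : cmeas (@RSlt s b b' n : n.-tuple RT -> C).
Proof.
apply: cmeasM; first exact: (cmeas_comp (@cmeas_Phi R n.+1 b) (@measurable_rcons0 n)).
by apply: cmeasM; [exact: cmeas_Phi|exact: cmeas_wlt].
Qed.

Lemma cmeas_RSeq s b b' n : cmeas (@RSeq s b b' n : n.-tuple RT -> C).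
Proof.
by apply: cmeasM; [exact: cmeas_Phi|apply: cmeasM; [exact: cmeas_Phi|exact: cmeas_weq]].
Qed.

Lemma measurable_RSltR s b b' n : measurable_fun setT (@RSltR s b b' n : n.-tuple RT -> \bar R).
Proof.
apply: emeasurable_funM.
  exact: measurableT_comp (measurable_PhiR _) (@measurable_rcons0 n).
by apply: emeasurable_funM; [exact: measurable_PhiR|exact: measurable_wltR].
Qed.

Lemma measurable_RSeqR s b b' n : measurable_fun setT (@RSeqR s b b' n : n.-tuple RT -> \bar R).
Proof.
apply: emeasurable_funM; first exact: measurable_PhiR.
by apply: emeasurable_funM; [exact: measurable_PhiR|exact: measurable_weqR].
Qed.

Lemma normc_RSlt_le s b b' n (u : n.-tuple R) : ((normc (RSlt s b b' u))%:E <=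
  RSltR (re s) (fun i => re (b i)) (fun i => re (b' i)) u)%E.
Proof.
have n0 (z : C) : (0 <= (normc z)%:E)%E by rewrite lee_fin; exact: normc_ge0.
rewrite (normc_mul (Phi _ _)) (normc_mul (Phi _ _)) normc_wlt 2!EFinM.
apply: lee_pmul => //; [|exact: normc_Phi_le|].
  by apply: mule_ge0 => //; rewrite lee_fin; exact: wltR_ge0.
by apply: lee_wpmul2r; [rewrite lee_fin; exact: wltR_ge0|exact: normc_Phi_le].
Qed.

Lemma normc_RSeq_le s b b' n (u : n.-tuple R) : ((normc (RSeq s b b' u))%:E <=
  RSeqR (re s) (fun i => re (b i)) (fun i => re (b' i)) u)%E.
Proof.
have n0 (z : C) : (0 <= (normc z)%:E)%E by rewrite lee_fin; exact: normc_ge0.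
rewrite (normc_mul (Phi _ _)) (normc_mul (Phi _ _)) normc_weq 2!EFinM.
apply: lee_pmul => //; [|exact: normc_Phi_le|].
  by apply: mule_ge0 => //; rewrite lee_fin; exact: weqR_ge0.
by apply: lee_wpmul2r; [rewrite lee_fin; exact: weqR_ge0|exact: normc_Phi_le].
Qed.

Let ACA (x y q e : R) (P P' : \bar R) : x * y = q * e ->
  (x%:E * P * (P' * y%:E) = q%:E * P' * (P * e%:E))%E.
Proof.
move=> xy; rewrite (muleC P') muleACA -EFinM xy EFinM (muleC P) [RHS]muleACA.
by congr (_ * _)%E; rewrite muleC.
Qed.

Lemma RSltR_step (s : R) (b b' : nat -> R) n : (forall i, (i < n)%N -> 0 < s + b 0%N + b' i) ->
  (\int[L n]_u RSltR s b b' u =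
   (\prod_(i < n) gamR (s + b 0%N + b' i))%:E * \int[L n]_u RSeqR s (fun i => b i.+1) b' u)%E.
Proof.
move=> sb; pose A (v : n.-tuple R) : \bar R := (PhiR (fun i => b i.+1) v * (weqR s v)%:E)%E.
have mA : measurable_fun setT (A : n.-tuple RT -> \bar R).
  by apply: emeasurable_funM; [exact: measurable_PhiR|exact: measurable_weqR].
have A0 v : (0 <= A v)%E.
  by apply: mule_ge0; [exact: PhiR_ge0|rewrite lee_fin; exact: weqR_ge0].
have := @qR_swap n n id (@measurable_id _ _ _) _ _ A mA A0 sb.
rewrite (_ : (\int[L n]_v (A v * PhiR b' v))%E = (\int[L n]_u RSeqR s (fun i => b i.+1) b' u)%E).
  move=> <-; apply: eq_integral => u _; rewrite /RSltR PhiRS -ge0_integralTZr.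
  - by apply: eq_integral => v _; rewrite /A; apply: ACA; exact: lamR_wltR.
  - exact: measurable_lamR_PhiR.
  - by move=> v; exact: lamR_PhiR_ge0.
  - by apply: mule_ge0; [exact: PhiR_ge0|rewrite lee_fin; exact: wltR_ge0].
by apply: eq_integral => v _; rewrite /A /RSeqR muleAC -muleA.
Qed.

(** The function with parameters [b] loses one rank and becomes the smaller one, so the two
    sequences change places on the right. *)
Lemma RSeqR_step (s : R) (b b' : nat -> R) n : (forall i, (i < n.+1)%N -> 0 < s + b 0%N + b' i) ->
  (\int[L n.+1]_u RSeqR s b b' u =
   (\prod_(i < n.+1) gamR (s + b 0%N + b' i))%:E * \int[L n]_u RSltR s b' (fun i => b i.+1) u)%E.
Proof.
move=> sb; pose A (v : n.-tuple R) : \bar R := (PhiR (fun i => b i.+1) v * (wltR s v)%:E)%E.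
have mA : measurable_fun setT (A : n.-tuple RT -> \bar R).
  by apply: emeasurable_funM; [exact: measurable_PhiR|exact: measurable_wltR].
have A0 v : (0 <= A v)%E.
  by apply: mule_ge0; [exact: PhiR_ge0|rewrite lee_fin; exact: wltR_ge0].
have := qR_swap (@measurable_rcons0 n) mA A0 sb.
rewrite (_ : (\int[L n]_v (A v * _))%E = (\int[L n]_u RSltR s b' (fun i => b i.+1) u)%E).
  move=> <-; apply: eq_integral => u _; rewrite /RSeqR PhiRS -ge0_integralTZr.
  - by apply: eq_integral => v _; rewrite /A; apply: ACA; exact: lamR_weqR.
  - exact: measurable_lamR_PhiR.
  - by move=> v; exact: lamR_PhiR_ge0.
  - by apply: mule_ge0; [exact: PhiR_ge0|rewrite lee_fin; exact: weqR_ge0].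
by apply: eq_integral => v _; rewrite /A /RSltR muleC.
Qed.

Let cACA (x y q e P P' : C) : x * y = q * e -> x * P * (P' * y) = q * P' * (P * e).
Proof. by move=> xy; rewrite (mulrC P') mulrACA xy; ring. Qed.

Lemma RSlt_step (s : C) (b b' : nat -> C) n :
  (forall i, (i < n)%N -> 0 < re (s + b 0%N + b' i)) ->
  (\int[L n]_u RSeqR (re s) (fun i => re (b i.+1)) (fun i => re (b' i)) u < +oo)%E ->
  cintegral (L n) setT (fun u => RSlt s b b' u) =
  \prod_(i < n) gam (s + b 0%N + b' i) *
    cintegral (L n) setT (fun u => RSeq s (fun i => b i.+1) b' u).
Proof.
move=> sb fin; pose A (v : n.-tuple R) : C := Phi (fun i => b i.+1) v * weq s v.
pose AR (v : n.-tuple R) : \bar R :=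
  (PhiR (fun i => re (b i.+1)) v * (weqR (re s) v)%:E)%E.
have mA : cmeas (A : n.-tuple RT -> C) by apply: cmeasM; [exact: cmeas_Phi|exact: cmeas_weq].
have mAR : measurable_fun setT (AR : n.-tuple RT -> \bar R).
  by apply: emeasurable_funM; [exact: measurable_PhiR|exact: measurable_weqR].
have AAR v : ((normc (A v))%:E <= AR v)%E.
  rewrite (normc_mul (Phi _ _)) EFinM normc_weq; apply: lee_wpmul2r; last exact: normc_Phi_le.
  by rewrite lee_fin; exact: weqR_ge0.
have := @qk_swap n n id (@measurable_id _ _ _) _ _ A AR mA mAR AAR sb.
rewrite (_ : (\int[L n]_v (AR v * _))%E = (\int[L n]_u RSeqR (re s) (fun i => re (b i.+1)) (fun i => re (b' i)) u)%E); last first.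
  by apply: eq_integral => v _; rewrite /AR /RSeqR muleAC -muleA.
move=> /(_ fin) E.
transitivity (\prod_(i < n) gam (s + b 0%N + b' i) * cintegral (L n) setT (fun v => A v * Phi b' v)).
  rewrite -[RHS]E; apply: eq_cintegral => u _; rewrite /RSlt PhiS -cintegralZr; last exact: cintegrable_lam_Phi.
  by apply: eq_cintegral => v _; apply: cACA; exact: lam_wlt.
by congr (_ * _); apply: eq_cintegral => v _; rewrite /A /RSeq mulrAC -mulrA.
Qed.

Lemma RSeq_step (s : C) (b b' : nat -> C) n :
  (forall i, (i < n.+1)%N -> 0 < re (s + b 0%N + b' i)) ->
  (\int[L n]_u RSltR (re s) (fun i => re (b' i)) (fun i => re (b i.+1)) u < +oo)%E ->
  cintegral (L n.+1) setT (fun u => RSeq s b b' u) =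
  \prod_(i < n.+1) gam (s + b 0%N + b' i) *
    cintegral (L n) setT (fun u => RSlt s b' (fun i => b i.+1) u).
Proof.
move=> sb fin; pose A (v : n.-tuple R) : C := Phi (fun i => b i.+1) v * wlt s v.
pose AR (v : n.-tuple R) : \bar R :=
  (PhiR (fun i => re (b i.+1)) v * (wltR (re s) v)%:E)%E.
have mA : cmeas (A : n.-tuple RT -> C) by apply: cmeasM; [exact: cmeas_Phi|exact: cmeas_wlt].
have mAR : measurable_fun setT (AR : n.-tuple RT -> \bar R).
  by apply: emeasurable_funM; [exact: measurable_PhiR|exact: measurable_wltR].
have AAR v : ((normc (A v))%:E <= AR v)%E.
  rewrite (normc_mul (Phi _ _)) EFinM normc_wlt; apply: lee_wpmul2r; last exact: normc_Phi_le.
  by rewrite lee_fin; exact: wltR_ge0.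
have := qk_swap (@measurable_rcons0 n) mA mAR AAR sb.
rewrite (_ : (\int[L n]_v (AR v * _))%E = (\int[L n]_u RSltR (re s) (fun i => re (b' i)) (fun i => re (b i.+1)) u)%E); last first.
  by apply: eq_integral => v _; rewrite /AR /RSltR muleC.
move=> /(_ fin) E.
transitivity (\prod_(i < n.+1) gam (s + b 0%N + b' i) * cintegral (L n) setT (fun v => A v * Phi b' (rcons0 v))).
  rewrite -[RHS]E; apply: eq_cintegral => u _; rewrite /RSeq PhiS -cintegralZr; last exact: cintegrable_lam_Phi.
  by apply: eq_cintegral => v _; apply: cACA; exact: lam_weq.
by congr (_ * _); apply: eq_cintegral => v _; rewrite /A /RSlt mulrC.
Qed.

End rankin_selberg.

(** * Whittaker functions in terms of Phi *)

Section whittaker_Phi.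
Context {R : realType}.
Local Notation leb := (@lebesgue_measure R).
Local Notation RT := (measurableTypeR R).
Local Notation L := (@lebesgue_tuple R).
Local Notation C := R[i].

Let prod_gamR_ge0 n (f : nat -> R) : (0 <= (\prod_(i < n) gamR (f i))%:E)%E.
Proof. by rewrite lee_fin; apply: prodr_ge0 => i _; exact: gamR_ge0. Qed.

Let fin_step n (f : nat -> R) (y : \bar R) : (y < +oo)%E ->
  ((\prod_(i < n) gamR (f i))%:E * y < +oo)%E.
Proof. by move=> yoo; apply: lte_mul_pinfty => //; exact: prod_gamR_ge0. Qed.

(** Two steps lower the rank by one; each multiplies by a finite product, and rank 0 is a point
    mass. *)
Lemma RSeqR_fin (s : R) n (b b' : nat -> R) :
  (forall j k, (j < n)%N -> (k < n)%N -> 0 < s + b j + b' k) ->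
  (\int[L n]_u RSeqR s b b' u < +oo)%E.
Proof.
elim: n b b' => [|n IH] b b' sb.
  rewrite integral_tuple0; last exact: measurable_RSeqR.
  by rewrite /RSeqR /= !mul1e ltry.
rewrite RSeqR_step; last by move=> i ni; exact: sb.
apply: (@fin_step n.+1 (fun i => s + b 0%N + b' i)).
rewrite RSltR_step; last by move=> i ni; rewrite addrAC; exact: sb.
apply: (@fin_step n (fun i => s + b' 0%N + b i.+1)).
by apply: IH => j k jn kn; rewrite addrAC; exact: sb.
Qed.

Lemma RSltR_fin (s : R) n (b b' : nat -> R) :
  (forall j k, (j < n.+1)%N -> (k < n)%N -> 0 < s + b j + b' k) ->
  (\int[L n]_u RSltR s b b' u < +oo)%E.
Proof.
move=> sb; rewrite RSltR_step; last by move=> i ni; exact: sb.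
apply: (@fin_step n (fun i => s + b 0%N + b' i)).
by apply: RSeqR_fin => j k jn kn; exact: sb.
Qed.

Lemma RSeq_closed (s : C) n (b b' : nat -> C) :
  (forall j k, (j < n)%N -> (k < n)%N -> 0 < re (s + b j + b' k)) ->
  cintegral (L n) setT (fun u => RSeq s b b' u) =
  \prod_(j < n) \prod_(k < n) gam (s + b j + b' k).
Proof.
elim: n b b' => [|n IH] b b' sb.
  rewrite (cintegral_tuple0 _).1 big_ord0 /RSeq /= !mul1r /weq /tsum /lastE big_ord0.
  by rewrite !mulr0 subr0 cexp0.
rewrite RSeq_step; [|by move=> i ni; exact: sb|]; last first.
  by apply: RSltR_fin => j k jn kn; rewrite -!ReD addrAC; exact: sb.
rewrite RSlt_step; [|by move=> i ni; rewrite addrAC; exact: sb|]; last first.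
  by apply: RSeqR_fin => j k jn kn; rewrite -!ReD addrAC; exact: sb.
rewrite IH; last by move=> j k jn kn; rewrite addrAC; exact: sb.
(* The first step has removed the row of [b 0] from the array of factors, the second the column of
   [b' 0]. The remaining block is transposed, since the sequences have changed places. *)
rewrite [RHS]big_ord_recl; congr (_ * _).
under [RHS]eq_bigr do rewrite big_ord_recl.
rewrite [RHS]big_split /=; congr (_ * _).
  by apply: eq_bigr => i _; rewrite addrAC.
rewrite exchange_big /=; apply: eq_bigr => i _; apply: eq_bigr => j _.
by rewrite addrAC.
Qed.

Lemma RSlt_closed (s : C) n (b b' : nat -> C) :
  (forall j k, (j < n.+1)%N -> (k < n)%N -> 0 < re (s + b j + b' k)) ->
  cintegral (L n) setT (fun u => RSlt s b b' u) =
  \prod_(j < n.+1) \prod_(k < n) gam (s + b j + b' k).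
Proof.
move=> sb; rewrite RSlt_step; [|by move=> i ni; exact: sb|]; last first.
  by apply: RSeqR_fin => j k jn kn; rewrite -!ReD; exact: sb.
rewrite RSeq_closed; last by move=> j k jn kn; exact: sb.
by rewrite [RHS]big_ord_recl.
Qed.

Lemma cintegrable_RSlt (s : C) n (b b' : nat -> C) :
  (forall j k, (j < n.+1)%N -> (k < n)%N -> 0 < re (s + b j + b' k)) ->
  cintegrable (L n) setT (fun u => RSlt s b b' u).
Proof.
move=> sb; apply: (@cintegrable_dom _ (n.-tuple RT) R (L n) _ (@RSltR R (re s)
  (fun i => re (b i)) (fun i => re (b' i)) n)).
- exact: cmeas_RSlt.
- exact: measurable_RSltR.
- by move=> u; exact: normc_RSlt_le.
by apply: RSltR_fin => j k jn kn; rewrite -!ReD; exact: sb.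
Qed.

Lemma cintegrable_RSeq (s : C) n (b b' : nat -> C) :
  (forall j k, (j < n)%N -> (k < n)%N -> 0 < re (s + b j + b' k)) ->
  cintegrable (L n) setT (fun u => RSeq s b b' u).
Proof.
move=> sb; apply: (@cintegrable_dom _ (n.-tuple RT) R (L n) _ (@RSeqR R (re s)
  (fun i => re (b i)) (fun i => re (b' i)) n)).
- exact: cmeas_RSeq.
- exact: measurable_RSeqR.
- by move=> u; exact: normc_RSeq_le.
by apply: RSeqR_fin => j k jn kn; rewrite -!ReD; exact: sb.
Qed.

Lemma Phi_ext n (b b' : nat -> C) (u : n.-tuple R) :
  (forall i, (i < n)%N -> b i = b' i) -> Phi b u = Phi b' u.
Proof.
elim: n b b' u => // n IH b b' u bb'; rewrite !PhiS; apply: eq_cintegral => x _.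
by rewrite (bb' 0%N)//; congr (_ * _); apply: IH => i ni; exact: bb'.
Qed.

Lemma Phi1 (b : nat -> C) (u : 1.-tuple R) : Phi b u = cexp (b 0%N * ((nth 0 u 0)%:C)%C).
Proof.
rewrite PhiS (cintegral_tuple0 _).1 mulr1 /lam /lamE /tsum big_ord1 !big_ord0 mulr0.
by rewrite !subr0.
Qed.

Lemma nth_tailsum n (x : n.-tuple RT) i :
  nth 0 (tailsum x) i = 2 * \sum_(j < n | (i <= j)%N) tnth x j.
Proof.
have [ni|ni] := ltnP i n.
  have := tnth_mktuple (fun i : 'I_n => 2 * \sum_(j < n | (i <= j)%N) tnth x j) (Ordinal ni).
  by rewrite (tnth_nth 0).
rewrite nth_default ?size_tuple// big1 ?mulr0// => j ij.
by have := leq_trans ni ij; rewrite leqNgt ltn_ord.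
Qed.

Lemma nth_tailsum_rec n (x : n.-tuple RT) (i : 'I_n) :
  nth 0 (tailsum x) i = 2 * tnth x i + nth 0 (tailsum x) i.+1.
Proof.
rewrite !nth_tailsum (bigD1 i)//= mulrDr; congr (_ + 2 * _).
by apply: eq_bigl => j; rewrite ltn_neqAle andbC eq_sym.
Qed.

Lemma tsum_tailsum n (x : n.-tuple RT) :
  tsum (tailsum x) = \sum_(i < n) 2 * (i.+1%:R * tnth x i).
Proof.
rewrite /tsum; under eq_bigr do rewrite nth_tailsum.
rewrite -!mulr_sumr; congr (_ * _).
rewrite (exchange_big_dep predT)//=; apply: eq_bigr => j _.
rewrite -(big_ord_widen _ (fun=> tnth x j) (ltn_ord j)) sumr_const card_ord.
by rewrite mulr_natl.
Qed.

Lemma tsum_tailsumS n (x : n.-tuple RT) :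
  \sum_(i < n) nth 0 (tailsum x) i.+1 = \sum_(i < n) 2 * (i%:R * tnth x i).
Proof.
transitivity (tsum (tailsum x) - \sum_(i < n) 2 * tnth x i).
  rewrite /tsum -sumrB; apply: eq_bigr => i _; rewrite nth_tailsum_rec; ring.
rewrite tsum_tailsum -sumrB; apply: eq_bigr => i _; rewrite -natr1; ring.
Qed.

Lemma sqrt_expR (x : R) : Num.sqrt (expR x) = expR (x / 2).
Proof.
have -> : expR x = expR (x / 2) ^+ 2 by rewrite expr2 -expRD -splitr.
by rewrite sqrtr_sqr ger0_norm ?expR_ge0.
Qed.

Lemma cpow_piM (h : R) (z : C) : cpow (pi * expR h) z = cexp (z * ((ln pi + h)%:C)%C).
Proof. by rewrite cpowE lnM ?posrE ?pi_gt0 ?expR_gt0// expRK. Qed.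

Let expR_pi (x : R) : pi * expR x = expR (ln pi + x).
Proof. by rewrite expRD lnK// posrE pi_gt0. Qed.

(** A factor [pi] is pulled out of both terms of the exponent, to match the [pi] in front of
    [lamE]. *)
Lemma hatW1_factor (h t : R) (A B : C) :
  ((expR (- (pi * expR h) ^+ 2 * expR t - (expR t)^-1))%:C)%C *
    cpow (pi * expR h) A * cpow (expR t) B =
  cexp (A * ((ln pi + h)%:C)%C + B * (t%:C)%C -
    ((pi * (expR (ln pi + 2 * h + t) + expR (- ln pi - t)))%:C)%C).
Proof.
rewrite cpow_piM cpow_expR -cexp_real -!cexpD; congr cexp.
have -> : - (pi * expR h) ^+ 2 * expR t - (expR t)^-1 =
    - (pi * (expR (ln pi + 2 * h + t) + expR (- ln pi - t))).
  rewrite mulrDr !expR_pi expr2 -expRN mulNr -!expRD -opprD; congr (- (expR _ + expR _)); ring.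
by rewrite RCN -addrA addrC.
Qed.

(** The reason why the powers of [pi] in the recursion cancel. *)
Let gauss (n : nat) : \sum_(i < n) (2 * (n%:R - i%:R) - (n%:R + 1)) = 0 :> R.
Proof.
have H m : \sum_(i < m) 2 * (i%:R : R) = m%:R * (m%:R - 1).
  elim: m => [|m IH]; first by rewrite big_ord0 mul0r.
  rewrite big_ord_recr /= IH -natr1; ring.
transitivity (\sum_(i < n) (n%:R - 1 : R) - \sum_(i < n) 2 * (i%:R : R)).
  by rewrite -sumrB; apply: eq_bigr => i _; ring.
rewrite H sumr_const card_ord -[_ *+ n]mulr_natl; ring.
Qed.

Let hatW1_exponent (n i : nat) (c : C) (l h t : R) : (i <= n)%N -> n%:R != 0 :> C ->
  (n.+1 - i.+1)%:R * c / n%:R * ((l + h)%:C)%C + n.+1%:R * c / (2 * n%:R) * (t%:C)%C =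
  c / 2 / n%:R * ((2 * (n%:R - i%:R) * (l + h) + (n%:R + 1) * t)%:C)%C.
Proof.
move=> ni; rewrite subSS (natrB _ ni) -(natr1 n) !(RCD, RCN, RCM, RCnat) rmorph1.
move: (n%:R : C) (i%:R : C) => N I N0.
by field.
Qed.

(** For rank 2 the integral defining [Phi] runs over one variable and is the integral representation
    of the K-Bessel function. *)
Lemma hatW1_Phi2 (a : 2.-tuple C) (x : 1.-tuple RT) :
  hatW1 a (texp x) = Phi (fun i => nth 0 a i / 2) (rcons0 (tailsum x)).
Proof.
set h := nth 0 x 0; set a1 := nth 0 a 0; set a2 := nth 0 a 1.
set nu := (a1 - a2) / 2.
have p0 : 0 < expR h by exact: expR_gt0.
have Jnu p : cintegrable leb setT (bker p (expR h) (expR h) : RT -> C).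
  by apply: cintegrable_bker; [exact: p0|exact: ltW|left].
have K : besselK nu (2 * pi * expR h) =
    2^-1 * cintegral leb setT (bker nu (expR h) (expR h) : RT -> C).
  rewrite /besselK; congr (_ * _); apply: cintegral_halfline; first exact: cmeas_bker.
  move=> y; rewrite cpow_expR /bker cexpD -mulrA; congr (_ * _).
  rewrite -RCM mulfVK ?gt_eqF ?expR_gt0// -RCN cexp_real -expRN; congr ((expR _)%:C)%C.
  by field.
have -> : hatW1 a (texp x) = cexp ((a1 + a2) / 2 * (h%:C)%C) *
    cintegral leb setT (bker nu (expR h) (expR h) : RT -> C).
  have tx : tnth (texp x) ord0 = expR h by rewrite tnth_mktuple (tnth_nth 0).
  rewrite /hatW1 tx cpow_expR !(tnth_nth 0) -/a1 -[nth 0 a ord_max]/a2 -/nu K.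
  by field.
(* With equal coefficients the reflection says [K_nu = K_(-nu)]. *)
have E1 := cintegral_bker_reflect (- nu) p0 p0.
rewrite opprK subrr mulr0 cexp0 mul1r in E1; rewrite -E1.
have u0 : nth 0 (tailsum x) 0 = 2 * h.
  by rewrite nth_tailsum big_ord1_cond /= (tnth_nth 0).
have u1 : nth 0 (tailsum x) 1 = 0 by rewrite nth_default ?size_tuple.
pose F (i : nat) (y : R) : C := cexp ((a1 / 2) * ((2 * h)%:C)%C) *
  bker (- nu) 1 (expR (2 * h)) y.
have J1 : cintegrable leb setT (bker (- nu) 1 (expR (2 * h)) : RT -> C).
  by apply: cintegrable_bker; [exact: ltr01|exact: expR_ge0|left; exact: expR_gt0].
have iF i : cintegrable leb setT (F i : RT -> C) by exact: cintegrableZl.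
have [_ EF] := cintegral_tuple_prod 1 iF.
rewrite big_ord1 in EF.
rewrite PhiS; transitivity (cintegral (L 1) setT (fun y => \prod_(i < 1) F i (tnth y i))); last first.
  apply: eq_cintegral => y _; rewrite big_ord1 Phi1 /F /lam /bker -!cexpD; congr cexp.
  rewrite tsum_rcons0 /lamE /tsum !big_ord1 !nth_rcons0 u0.
  rewrite u1 (tnth_nth 0) /= subr0 -/a1 -/a2.
  by rewrite (expRD (2 * h)) mulr1 /nu !(RCD, RCN, RCM); field.
have EF0 : cintegral leb setT (F 0%N : RT -> C) = _ :=
  cintegralZl (cexp ((a1 / 2) * ((2 * h)%:C)%C)) J1.
(* Translating by [h] turns the coefficients [1] and [e^(2 h)] both into [e^h]. *)
rewrite [RHS]EF [RHS]EF0 (cintegral_shift h (cmeas_bker (- nu) 1 (expR (2 * h)))).1.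
transitivity (cexp (a1 / 2 * ((2 * h)%:C)%C) * (cexp (- nu * (h%:C)%C) *
  cintegral leb setT (bker (- nu) (expR h) (expR h) : RT -> C))).
  by rewrite mulrA -cexpD; congr (cexp _ * _); rewrite /nu RCM RCnat; field.
congr (_ * _); rewrite -(cintegralZl _ (Jnu (- nu))).
apply: eq_cintegral => y _; rewrite /bker -cexpD; congr cexp.
rewrite mulr1 -!expRD.
have -> : - (y + h) + 2 * h = - y + h by ring.
by rewrite !(RCD, RCN, RCM); ring.
Qed.

(** In suitable logarithmic variables the exponential factors of the recursion form [lamE]. The
    inner function is evaluated at a translate of the new variable with twisted parameters, and
    [Phi_addt] and [Phi_twist] remove both. *)
Lemma hatW1_Phi m (a : m.+1.-tuple C) (x : m.-tuple RT) :
  hatW1 a (texp x) = Phi (fun i => nth 0 a i / 2) (rcons0 (tailsum x)).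
Proof.
elim: m a x => [|[|p] IH] a x.
- rewrite Phi1 nth_rcons0 (_ : nth 0 (tailsum x) 0 = 0) ?mulr0 ?cexp0//.
  by rewrite nth_default ?size_tuple.
- exact: hatW1_Phi2.
set N := p.+2 in a x *; set u := tailsum x; set a1 := nth 0 a 0; set lp : R := ln pi.
pose b' i := nth 0 a i.+1 / 2.
(* The new variable is [y_i = u_(i+1) - ln pi - log t_i], chosen so that
   [1 / t_i = pi e^(y_i - u_(i+1))]; then [(pi e^(x_i))^2 t_i] is [pi e^(u_i - y_i)]. *)
pose al (i : nat) : R := nth 0 u i.+1 - lp.
pose G (y : N.-tuple RT) : C := lam (a1 / 2) (rcons0 u) y * Phi b' y.
have mG : cmeas G by apply: cmeasM; [apply: cmeas_lam => //; exact: measurable_cst|exact: cmeas_Phi].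
have mGt : cmeas (fun t : N.-tuple RT => G (trefl al t)).
  exact: (cmeas_comp mG (@measurable_trefl R al N)).
pose f (t : N.-tuple R) : C :=
  hatW1 (par_tilde a) [tuple tnth (texp x) (lift ord0 i) *
     Num.sqrt (tnth t (lift ord0 i) / tnth t (widen_ord (leqnSn p.+1) i)) | i < p.+1] *
  (\prod_(i < N) ((((expR (- (pi * tnth (texp x) i) ^+ 2 * tnth t i - (tnth t i)^-1))%:C)%C) *
     cpow (pi * tnth (texp x) i) ((N.+1 - i.+1)%:R * tnth a ord0 / N%:R) *
     cpow (tnth t i) (N.+1%:R * tnth a ord0 / (2 * N%:R)))) *
  cpow (pi * tnth t ord_max) (- par_sum a / 2) *
  \prod_(i < N) (((tnth t i)^-1)%:C)%C.
transitivity (cintegral (L N) (@positive_orthant R N) f); first by [].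
rewrite PhiS; transitivity (cintegral (L N) setT G); last by [].
rewrite (cintegral_trefl al mG); apply: (cintegral_orthant mGt _).1 => t.
set y := trefl al t.
have N0 : N%:R != 0 :> C by rewrite pnatr_eq0.
have tnthE n (z : n.-tuple RT) (i : 'I_n) : tnth z i = nth 0 z i by exact: tnth_nth.
have yE (i : 'I_N) : nth 0 y i = nth 0 u i.+1 - lp - nth 0 t i.
  by rewrite -tnth_nth tnth_mktuple tnthE.
pose xi : p.+1.-tuple RT := [tuple tnth x (lift ord0 i) +
  (tnth t (lift ord0 i) - tnth t (widen_ord (leqnSn p.+1) i)) / 2 | i < p.+1].
have xiE : [tuple tnth (texp x) (lift ord0 i) *
     Num.sqrt (tnth (texp t) (lift ord0 i) / tnth (texp t) (widen_ord (leqnSn p.+1) i)) | i < p.+1]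
   = texp xi.
  apply/eq_from_tnth => i; rewrite !tnth_mktuple -expRN -expRD sqrt_expR -expRD.
  by [].
have xis i : (i <= p.+1)%N -> nth 0 (tailsum xi) i = nth 0 u i.+1 - nth 0 t i + nth 0 t p.+1.
  (* Downward induction on [i]: the tail sums build up from the end, and the differences of the
     [t_i] telescope. *)
  move=> ip; have [k] := ubnP (p.+1 - i)%N; elim: k i ip => // k IHk i ip.
  rewrite ltnS => pk; move: ip; rewrite leq_eqVlt => /orP[/eqP ->|ip].
    by rewrite subrK !nth_default ?size_tuple.
  rewrite (nth_tailsum_rec xi (Ordinal ip)) /= IHk//; last first.
    by rewrite subnS -ltnS prednK ?subn_gt0// (leq_trans _ pk)// ltnS.
  have ip' : (i.+1 < N)%N by [].
  rewrite tnth_mktuple !tnthE /= /bump /= add1n.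
  have -> : nth 0 u i.+1 = 2 * nth 0 x i.+1 + nth 0 u i.+2.
    by have := nth_tailsum_rec x (Ordinal ip'); rewrite tnthE.
  by field.
(* The inner argument is thus [y] up to a translation in all coordinates by [ln pi] and the last
   [t]. *)
have XE : rcons0 (tailsum xi) = addt (nth 0 t p.+1) (addt lp y).
  apply/eq_from_tnth => i; rewrite !tnthE nth_rcons0 xis -1?ltnS// !nth_addt// yE; ring.
have sumb' : \sum_(i < N) b' i = (par_sum a - a1) / 2.
  rewrite /b' -mulr_suml /par_sum [in RHS]big_ord_recl; congr (_ / _).
  rewrite (tnth_nth 0) /= addrAC subrr add0r; apply: eq_bigr => i _.
  by rewrite (tnth_nth 0).
have sumc : \sum_(i < N) (b' i + a1 / 2 / N%:R) = par_sum a / 2.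
  by rewrite big_split /= sumb' sumr_const card_ord -(mulr_natr _ N); field.
have PhiE : Phi (fun i => nth 0 (par_tilde a) i / 2) (rcons0 (tailsum xi)) =
    cexp (par_sum a / 2 * ((nth 0 t p.+1)%:C)%C + a1 / 2 / N%:R * ((N%:R * lp + tsum y)%:C)%C +
      (par_sum a - a1) / 2 * (lp%:C)%C) * Phi b' y.
  rewrite XE.
  (* The term [a_1 / (k - 1)] in [par_tilde] is a twist by a power of the determinant. *)
  have -> : Phi (fun i => nth 0 (par_tilde a) i / 2) (addt (nth 0 t p.+1) (addt lp y)) =
      Phi (fun i => b' i + a1 / 2 / N%:R) (addt (nth 0 t p.+1) (addt lp y)).
    apply: Phi_ext => i iN.
    have -> : nth 0 (par_tilde a) i = nth 0 a i.+1 + a1 / N%:R.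
      transitivity (tnth (par_tilde a) (Ordinal iN)); first by rewrite (tnth_nth 0).
      by rewrite tnth_mktuple !(tnth_nth 0).
    by rewrite /b'; field.
  rewrite Phi_addt Phi_twist Phi_addt tsum_addt.
  rewrite (mulrA (cexp _) (cexp _)) -cexpD (mulrA (cexp _) (cexp _)) -cexpD; congr (cexp _ * _).
  by rewrite -mulr_suml sumc -mulr_suml sumb'.
rewrite /f xiE IH PhiE.
have -> : \prod_(i < N) (((tnth (texp t) i)^-1)%:C)%C = (((\prod_(i < N) expR (tnth t i))^-1)%:C)%C.
  rewrite -prodfV rmorph_prod; apply: eq_bigr => i _.
  by rewrite tnth_mktuple.
rewrite -[RHS]mulrA -RCM mulVf ?mulr1; last first.
  by rewrite prodf_seq_neq0; apply/allP => i _; rewrite gt_eqF ?expR_gt0.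
have -> : \prod_(i < N)
    ((((expR (- (pi * tnth (texp x) i) ^+ 2 * tnth (texp t) i - (tnth (texp t) i)^-1))%:C)%C) *
              cpow (pi * tnth (texp x) i) ((N.+1 - i.+1)%:R * tnth a ord0 / N%:R) *
              cpow (tnth (texp t) i) (N.+1%:R * tnth a ord0 / (2 * N%:R))) =
   cexp (a1 / 2 / N%:R * ((N%:R * tsum u - (N%:R + 1) * tsum y)%:C)%C - ((pi * lamE (rcons0 u) y)%:C)%C).
  have tE n (z : n.-tuple RT) (i : 'I_n) : tnth (texp z) i = expR (nth 0 z i).
    by rewrite tnth_mktuple tnthE.
  under eq_bigr => i _ do rewrite !tE hatW1_factor.
  rewrite -cexp_sum; congr cexp; rewrite sumrB; congr (_ - _); last first.
    rewrite -RCsum -mulr_sumr; congr ((_ * _)%:C)%C; apply: eq_bigr => i _.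
    rewrite !nth_rcons0 yE (nth_tailsum_rec x i) !tnthE -/u -/lp.
    by congr (expR _ + expR _); ring.
  transitivity (\sum_(i < N) (a1 / 2 / N%:R * ((2 * (N%:R - i%:R) * (lp + nth 0 x i) + (N%:R + 1) * nth 0 t i)%:C)%C)).
    by apply: eq_bigr => i _; rewrite (tnth_nth 0); apply: hatW1_exponent => //; exact: ltnW.
  rewrite -mulr_sumr -RCsum; congr (_ * (_)%:C)%C.
  have -> : tsum y = \sum_(i < N) nth 0 u i.+1 - \sum_(i < N) (lp + nth 0 t i).
    by rewrite /tsum -sumrB; apply: eq_bigr => i _; rewrite yE; ring.
  rewrite /u tsum_tailsumS tsum_tailsum; set rhs := RHS.
  (* The multiples of [ln pi] cancel only in the sum; adding this vanishing sum permits a comparison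
     term by term. *)
  transitivity (rhs + lp * \sum_(i < N) (2 * (N%:R - i%:R) - (N%:R + 1))); last first.
    by rewrite gauss mulr0 addr0.
  rewrite /rhs mulrBr !mulr_sumr opprB -sumrB -!big_split /=; apply: eq_bigr => i _.
  by rewrite tnthE -(natr1 i); ring.
have -> : tnth (texp t) ord_max = expR (nth 0 t p.+1) by rewrite tnth_mktuple tnthE.
rewrite cpow_piM /G [RHS]mulrAC -[in RHS]mulrA [RHS]mulrAC; congr (_ * _).
rewrite -!cexpD; congr cexp.
by rewrite tsum_rcons0 -/lp !(RCD, RCN, RCM, RCnat); field.
Qed.

(** A last coordinate [y_n] other than 1 translates all of [u] by [2 log y_n], and the central
    character of [Phi] accounts for the power of [y_n]. *)
Lemma hatW_Phi n (a : n.-tuple C) (x : n.-tuple RT) :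
  hatW a (texp x) = Phi (fun i => nth 0 a i / 2) (tailsum x).
Proof.
case: n a x => [//|m] a x; rewrite /hatW.
pose x' : m.-tuple RT := [tuple tnth x (widen_ord (leqnSn m) i) | i < m].
have -> : [tuple tnth (texp x) (widen_ord (leqnSn m) i) | i < m] = texp x'.
  by apply/eq_from_tnth => i; rewrite !tnth_mktuple.
rewrite hatW1_Phi.
have -> : tailsum x = addt (2 * nth 0 x m) (rcons0 (tailsum x')).
  apply/eq_from_tnth => i; rewrite [RHS]tnth_mktuple !(tnth_nth 0) nth_rcons0 !nth_tailsum.
  rewrite big_mkcond big_ord_recr /= -big_mkcond /= -ltnS ltn_ord mulrDr addrC.
  rewrite (tnth_nth 0); congr (_ + 2 * _); apply: eq_bigr => j _.
  by rewrite tnth_mktuple.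
rewrite Phi_addt; congr (_ * _).
rewrite tnth_mktuple cpow_expR (tnth_nth 0) -mulr_suml -mulr_suml; congr cexp.
rewrite RCM RCnat mulrA mulfVK ?pnatr_eq0//; congr (_ * _).
by apply: eq_bigr => i _; rewrite (tnth_nth 0).
Qed.

End whittaker_Phi.

(** * Convergence and continuation *)

Section continuation.
Context {R : realType}.
Local Notation RT := (measurableTypeR R).
Local Notation L := (@lebesgue_tuple R).
Local Notation C := R[i].

(** Convergence is carried in both directions: one serves the identity, which starts from
    convergence of the given integral, the other the existence of a half-plane. *)
Lemma cintegral_orthant_tailsum n (f F : n.-tuple RT -> C) : cmeas F ->
  (forall x, F (tailsum x) = f (texp x) * ((\prod_(i < n) expR (tnth x i))%:C)%C) ->
  (cintegrable (L n) (@positive_orthant R n) f <-> cintegrable (L n) setT F) /\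
  (cintegrable (L n) setT F ->
   2 ^+ n * cintegral (L n) (@positive_orthant R n) f = cintegral (L n) setT F).
Proof.
move=> mF FE; have mg := cmeas_comp mF (@measurable_tailsum R n).
have [E1 I1] := cintegral_orthant mg FE; have [E2 I2] := cintegral_tailsum mF.
set k := ((2 ^+ n)%:C)%C in E2 I2.
have k0 : k != 0 by rewrite fmorph_eq0 expf_neq0.
have kE : k = 2 ^+ n by rewrite /k rmorphXn /= RCnat.
have I3 : cintegrable (L n) setT (fun x => F (tailsum x)) <->
    cintegrable (L n) setT (fun x => F (tailsum x) * k).
  split=> H.
    have := cintegrableZl k H; congr (cintegrable _ _ _).
    by apply/funext => x; rewrite [LHS]mulrC.
  have := cintegrableZl k^-1 H; congr (cintegrable _ _ _).
  by apply/funext => x; rewrite [LHS]mulrC mulfK.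
split.
  split=> [/I1 /I3 /I2 //|/I2 /I3 /I1 //].
move=> /I2 /I3 H; rewrite E1 E2 (cintegralZr k H) -kE; exact: mulrC.
Qed.

Let expR_between (t0 t t1 x : R) : t0 <= t -> t <= t1 ->
  expR (t * x) <= expR (t0 * x) + expR (t1 * x).
Proof.
move=> t0t tt1; have [x0|x0] := leP 0 x.
  rewrite -[leLHS]add0r lerD ?expR_ge0// ler_expR.
  exact: ler_wpM2r.
rewrite -[leLHS]addr0 lerD ?expR_ge0// ler_expR.
by rewrite ler_wnM2r// ltW.
Qed.

(* Near the rightmost pole of the product of Gamma factors the integrals stay
   bounded, by monotonicity of [|wlt z u|] in [Re z] for fixed [u], if one of
   them converges to the left of the pole. *)
Lemma cintegrable_gt_poles (I : finType) (zeta : I -> C) n (W : n.-tuple R -> C) :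
  cmeas (W : n.-tuple RT -> C) ->
  (forall z, (forall i, 0 < re (z + zeta i)) ->
    cintegrable (L n) setT (fun u => W u * wlt z u) /\
    cintegral (L n) setT (fun u => W u * wlt z u) = \prod_i gam (z + zeta i)) ->
  forall z0, cintegrable (L n) setT (fun u => W u * wlt z0 u) ->
  forall i, 0 < re (z0 + zeta i).
Proof.
move=> mW H z0 iz0 i; rewrite ltNge; apply/negP => le0.
(* [p = - zeta j] is a rightmost pole of the product, so every [p + zeta k] has real part at least
   0. *)
case: (Order.TotalTheory.arg_minP (fun j => re (zeta j)) (erefl : xpredT i)) => j _ jmin.
have {}le0 : re z0 <= - re (zeta j).
  by move: le0 (jmin i isT); rewrite ReD; lra.
set p := - zeta j.
have Rep : re p = - re (zeta j) by rewrite /p ReN.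
have conv (e : R) : 0 < e -> forall k, 0 < re (p + (e%:C)%C + zeta k).
  by move=> e0 k; rewrite !ReD Rep /=; have := jmin k isT; lra.
have mWw z : cmeas (fun u : n.-tuple RT => W u * wlt z u).
  by apply: cmeasM => //; exact: cmeas_wlt.
have mn z : measurable_fun setT (fun u : n.-tuple RT => (normc (W u * wlt z u))%:E).
  by apply/measurable_EFinP; exact: measurable_normc.
have nn z u : (0 <= (normc (W u * wlt z u))%:E)%E by rewrite lee_fin; exact: normc_ge0.
have [_ J0] := (cintegrableTP _ _).1 iz0.
have [_ J1] := (cintegrableTP _ _).1 (H _ (conv 1 ltr01)).1.
set I0 := (\int[L n]_u (normc (W u * wlt z0 u))%:E)%E in J0.
set I1 := (\int[L n]_u (normc (W u * wlt (p + (1%:C)%C) u))%:E)%E in J1.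
have I00 : (0 <= I0)%E by apply: integral_ge0 => u _.
have I10 : (0 <= I1)%E by apply: integral_ge0 => u _.
have fI : (I0 + I1)%E \is a fin_num by rewrite fin_numD !ge0_fin_numE// J0 J1.
pose M := fine (I0 + I1)%E.
have M0 : 0 <= M by rewrite fine_ge0// adde_ge0.
have bound (e : R) : 0 < e -> e <= 1 ->
    normc (\prod_k gam (p + (e%:C)%C + zeta k)) <= M.
  move=> e0 e1; rewrite -(H _ (conv e e0)).2 -lee_fin fineK//.
  apply: le_trans (normc_cintegral_le (L n) (mWw _)) _.
  rewrite /I0 /I1 -ge0_integralD//; apply: ge0_le_integral => //.
    by apply: emeasurable_funD.
  move=> u _; rewrite -EFinD lee_fin !(normc_mul (W u)) !normc_wlt -mulrDr.
  apply: ler_wpM2l; first exact: normc_ge0.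
  by apply: expR_between; rewrite !ReD Rep /=; lra.
(* Other factors may have a pole at [p] as well; a positive lower bound for each of them is
   enough. *)
have /choice[d Hd] : forall k, exists d, 0 < d /\
    forall e, 0 < e -> e <= 1 -> d <= normc (gam (p + (e%:C)%C + zeta k)).
  move=> k; have [|d d0 Hd] := @gam_lbound R (p + zeta k).
    by rewrite ReD Rep; have := jmin k isT; lra.
  by exists d; split => // e e0 e1; rewrite addrAC; exact: Hd.
have [d0 d00 Hd0] := @gam_pole R.
pose D := d0 * \prod_(k | k != j) d k.
have D0 : 0 < D by rewrite mulr_gt0// prodr_gt0// => k _; exact: (Hd k).1.
have lower (e : R) : 0 < e -> e <= 1 -> D / e <= M.
  move=> e0 e1; apply: le_trans (bound e e0 e1); rewrite normc_prod (bigD1 j)//= /D mulrAC.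
  apply: ler_pM.
  - by rewrite ltW// divr_gt0.
  - by apply: prodr_ge0 => k _; rewrite ltW//; exact: (Hd k).1.
  - rewrite (_ : p + (e%:C)%C + zeta j = (e%:C)%C); first exact: Hd0.
    by rewrite addrAC /p addNr add0r.
  - apply: ler_prod => k _; rewrite (ltW (Hd k).1) /=; exact: (Hd k).2.
have M1 : 0 < M + 1 by rewrite ltr_wpDl.
(* At this [e] the lower bound [D / e] is at least [M + 1], which exceeds the upper bound [M]. *)
have e0 : 0 < Num.min 1 (D / (M + 1)) by rewrite lt_min ltr01 divr_gt0.
have := lower _ e0; rewrite ge_min lexx => /(_ isT); apply/negP; rewrite -ltNge.
apply: (@lt_le_trans _ _ (M + 1)); first by rewrite ltrDl.
rewrite ler_pdivlMr// mulrC -ler_pdivlMr// ge_min lexx orbT //.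
Qed.

(** Common to both ranks: [W] is the part of the integrand independent of [s], and [s] enters only
    through [wlt], whose modulus is monotone in [re s] for fixed [u]. *)
Lemma identity_and_continuation_gam n N1 N2 (a : N1.-tuple C) (a' : N2.-tuple C)
    (W : n.-tuple R -> C) (f : C -> n.-tuple R -> C) :
  cmeas (W : n.-tuple RT -> C) ->
  (forall s (x : n.-tuple RT), W (tailsum x) * wlt (s / 2) (tailsum x) =
    f s (texp x) * ((\prod_(i < n) expR (tnth x i))%:C)%C) ->
  (forall z, (forall j k, (j < N1)%N -> (k < N2)%N ->
      0 < re (z + nth 0 a j / 2 + nth 0 a' k / 2)) ->
    cintegrable (L n) setT (fun u => W u * wlt z u) /\
    cintegral (L n) setT (fun u => W u * wlt z u) =
    \prod_(j < N1) \prod_(k < N2) gam (z + nth 0 a j / 2 + nth 0 a' k / 2)) ->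
  identity_and_continuation
    (fun s => cintegrable (L n) (@positive_orthant R n) (f s))
    (fun s => 2 ^+ n * cintegral (L n) (@positive_orthant R n) (f s))
    (fun s => \prod_(j < N1) \prod_(k < N2) GammaR (s + tnth a j + tnth a' k)).
Proof.
move=> mW WE HW.
have mWw z : cmeas (fun u : n.-tuple RT => W u * wlt z u).
  by apply: cmeasM => //; exact: cmeas_wlt.
have tr s := cintegral_orthant_tailsum (mWw (s / 2)) (WE s).
pose zeta (q : 'I_N1 * 'I_N2) : C := nth 0 a q.1 / 2 + nth 0 a' q.2 / 2.
have HI z : (forall q, 0 < re (z + zeta q)) ->
    cintegrable (L n) setT (fun u => W u * wlt z u) /\
    cintegral (L n) setT (fun u => W u * wlt z u) = \prod_q gam (z + zeta q).
  move=> zq; have [|iW ->] := HW z.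
    by move=> j k jN kN; have := zq (Ordinal jN, Ordinal kN); rewrite /zeta addrA.
  split => //; rewrite pair_bigA /=; apply: eq_bigr => q _.
  by rewrite /zeta addrA.
split.
- move=> s /(tr s).1 cs; rewrite ((tr s).2 cs).
  (* Places [s] in the half-plane of the closed formula, where [GammaR_gam] applies with shift 0. *)
  have pos := cintegrable_gt_poles mW HI cs.
  rewrite (HI _ pos).2 pair_bigA /=; apply: eq_bigr => q _.
  have E : s / 2 + zeta q = (s + tnth a q.1 + tnth a' q.2) / 2.
    by rewrite /zeta !(tnth_nth 0) !mulrDl addrA.
  have := pos q; rewrite E => posq.
  by rewrite (@GammaR_gam _ _ 0) ?addr0// big_ord0 mulr1.
(* A larger real part makes [re (s + a_j + a'_k)] positive for all pairs at once. *)
- exists (\sum_(j < N1) `|re (tnth a j)| + \sum_(k < N2) `|re (tnth a' k)|).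
  move=> s hs; apply/(tr s).1; apply: (HI _ _).1 => -[j k].
  have -> : s / 2 + zeta (j, k) = (s + tnth a j + tnth a' k) / 2.
    by rewrite /zeta !(tnth_nth 0) !mulrDl addrA.
  rewrite Re_half !ReD divr_gt0//.
  have h1 : `|re (tnth a j)| <= \sum_(j < N1) `|re (tnth a j)|.
    by rewrite (bigD1 j)//= lerDl sumr_ge0.
  have h2 : `|re (tnth a' k)| <= \sum_(k < N2) `|re (tnth a' k)|.
    by rewrite (bigD1 k)//= lerDl sumr_ge0.
  have := ler_norm (- re (tnth a j)); have := ler_norm (- re (tnth a' k)).
  by rewrite !normrN; lra.
- move=> z; apply: meromorphic_prod => j; apply: meromorphic_prod => k.
  under eq_fun do rewrite -addrA; exact: meromorphic_GammaR.
Qed.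

Lemma prod_cpow_texp n (x : n.-tuple RT) (E : 'I_n -> C) :
  \prod_(i < n) cpow (tnth (texp x) i) (E i) = cexp (\sum_(i < n) E i * ((tnth x i)%:C)%C).
Proof. by rewrite cexp_sum; apply: eq_bigr => i _; rewrite tnth_mktuple cpow_expR. Qed.

Lemma prod_cpow_texp_jacobian n (x : n.-tuple RT) (E : 'I_n -> C) :
  \prod_(i < n) (cpow (tnth (texp x) i) (E i) * (((tnth (texp x) i)^-1)%:C)%C) *
    ((\prod_(i < n) expR (tnth x i))%:C)%C =
  cexp (\sum_(i < n) E i * ((tnth x i)%:C)%C).
Proof.
rewrite rmorph_prod -big_split /= -prod_cpow_texp; apply: eq_bigr => i _.
by rewrite -mulrA -RCM tnth_mktuple mulVf ?mulr1// gt_eqF ?expR_gt0.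
Qed.

Lemma whittaker_texp n (a : n.-tuple C) (x : n.-tuple RT) :
  whittaker a (texp x) =
  cexp (\sum_(i < n) (i.+1 * (n - i.+1))%:R / 2 * ((tnth x i)%:C)%C) *
  Phi (fun i => nth 0 a i / 2) (tailsum x).
Proof. by rewrite /whittaker hatW_Phi prod_cpow_texp. Qed.

Lemma whittaker_pad1_texp n (a : n.+1.-tuple C) (x : n.-tuple RT) :
  whittaker a (pad1 n.+1 (texp x)) =
  cexp (\sum_(i < n) (i.+1 * (n - i))%:R / 2 * ((tnth x i)%:C)%C) *
  Phi (fun i => nth 0 a i / 2) (rcons0 (tailsum x)).
Proof.
have padw (i : 'I_n) : tnth (pad1 n.+1 (texp x)) (widen_ord (leqnSn n) i) = tnth (texp x) i.
  by rewrite tnth_mktuple (tnth_nth 1).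
have padm : tnth (pad1 n.+1 (texp x)) ord_max = 1.
  by rewrite tnth_mktuple nth_default// size_tuple.
have cpow1 (z : C) : cpow 1 z = 1 by rewrite cpowE ln1 mulr0 cexp0.
rewrite /whittaker /hatW padm cpow1 mul1r big_ord_recr padm cpow1 /= mulr1.
have -> : [tuple tnth (pad1 n.+1 (texp x)) (widen_ord (leqnSn n) i) | i < n] = texp x.
  by apply/eq_from_tnth => i; rewrite tnth_mktuple padw.
rewrite -[hatW1 _ _]/(hatW1 a (texp x)) hatW1_Phi -prod_cpow_texp; congr (_ * _).
by apply: eq_bigr => i _; rewrite padw subSS.
Qed.

(** Splits off the Gaussian, so that the equal rank integrand also depends on [s] through [wlt]
    alone. *)
Lemma weqE (s : C) n (u : n.-tuple R) : weq s u = weq 0 u * wlt s u.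
Proof. by rewrite /weq /wlt -cexpD; congr cexp; rewrite mul0r; ring. Qed.

Lemma RSltE (s : C) b b' n (u : n.-tuple R) :
  RSlt s b b' u = Phi b (rcons0 u) * Phi b' u * wlt s u.
Proof. exact: mulrA. Qed.

Lemma RSeqE (s : C) b b' n (u : n.-tuple R) :
  RSeq s b b' u = Phi b u * Phi b' u * weq 0 u * wlt s u.
Proof. by rewrite /RSeq weqE !mulrA. Qed.

(** The powers of [y_j] cancel up to [y_j^(j s)]: with [n+1] and [n] as ranks,
    [j(n+1-j)/2 + j(n-j)/2 - j/2 - j(n-j) = 0]. *)
Lemma RS_integrand_lt_texp n (a : n.+1.-tuple C) (a' : n.-tuple C) s (x : n.-tuple RT) :
  RSlt (s / 2) (fun i => nth 0 a i / 2) (fun i => nth 0 a' i / 2) (tailsum x) =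
  RS_integrand_lt a a' s (texp x) * ((\prod_(i < n) expR (tnth x i))%:C)%C.
Proof.
rewrite /RS_integrand_lt -[RHS]mulrA prod_cpow_texp_jacobian whittaker_pad1_texp whittaker_texp.
have alg (c1 c2 c3 P1 P2 : C) : c1 * P1 * (c2 * P2) * c3 = P1 * (P2 * (c1 * c2 * c3)) by ring.
rewrite alg /RSlt; congr (_ * (_ * _)); rewrite -!cexpD.
rewrite /wlt tsum_tailsum RCsum mulr_sumr -!big_split; congr cexp; apply: eq_bigr => i _ /=.
rewrite subSnn !natrM !natrB ?(ltnW (ltn_ord i))// -natr1.
by rewrite !(RCM, RCnat); field.
Qed.

(** Here the two half powers from the Whittaker functions cancel the power in the measure, and the
    Gaussian in [y_n] is [weq 0]. *)
Lemma RS_integrand_eq_texp n (a a' : n.+1.-tuple C) s (x : n.+1.-tuple RT) :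
  RSeq (s / 2) (fun i => nth 0 a i / 2) (fun i => nth 0 a' i / 2) (tailsum x) =
  RS_integrand_eq a a' s (texp x) * ((\prod_(i < n.+1) expR (tnth x i))%:C)%C.
Proof.
rewrite /RS_integrand_eq -[RHS]mulrA prod_cpow_texp_jacobian !whittaker_texp.
have lastx : last 1 (texp x) = expR (nth 0 x n).
  rewrite (last_nth 1) size_tuple /=.
  rewrite -[nth _ _ _]/(nth 1 (texp x) (@ord_max n)) -tnth_nth tnth_mktuple.
  by rewrite (tnth_nth 0).
have lE : lastE (tailsum x) = expR (nth 0 x n) ^+ 2.
  have xn : nth 0 (tailsum x) n.+1 = 0 by rewrite nth_default ?size_tuple.
  rewrite -[lastE _]/(expR (nth 0 (tailsum x) (@ord_max n))) nth_tailsum_rec xn addr0 (tnth_nth 0).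
  by rewrite -expRM_natl.
have alg (e c1 c2 c3 P1 P2 : C) : e * (c1 * P1) * (c2 * P2) * c3 = P1 * (P2 * (c1 * c2 * c3 * e)).
  by ring.
rewrite alg /RSeq; congr (_ * (_ * _)).
rewrite lastx /weq lE -cexp_real -!cexpD; congr cexp; rewrite mulNr RCN; congr (_ + _).
rewrite tsum_tailsum RCsum mulr_sumr -!big_split; apply: eq_bigr => i _ /=.
by rewrite !(RCM, RCnat) subSS; field.
Qed.

End continuation.

Theorem theorem2p2 (R : realType) :
  (forall (n : nat) (a : n.-tuple R[i]) (a' : n.-1.-tuple R[i]), (2 <= n)%N ->
     identity_and_continuation (RS_converges_lt a a') (RS_integral_lt a a')
       (fun s => \prod_(j < n) \prod_(k < n.-1)
                   GammaR (s + tnth a j + tnth a' k))) /\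
  (forall (n : nat) (a a' : n.-tuple R[i]), (1 <= n)%N ->
     identity_and_continuation (RS_converges_eq a a') (RS_integral_eq a a')
       (fun s => \prod_(j < n) \prod_(k < n)
                   GammaR (s + tnth a j + tnth a' k))).
Proof.
split=> -[//|n] a a' _.
  pose b i := nth 0 a i / 2; pose b' i := nth 0 a' i / 2.
  apply: (@identity_and_continuation_gam R n n.+1 n a a' (fun u => Phi b (rcons0 u) * Phi b' u)
    (RS_integrand_lt a a')).
  - apply: cmeasM; last exact: cmeas_Phi.
    exact: (cmeas_comp (@cmeas_Phi R n.+1 b) (@measurable_rcons0 R n)).
  - by move=> s x; rewrite -RSltE RS_integrand_lt_texp.
  - move=> z zp; rewrite -(RSlt_closed zp); have := cintegrable_RSlt zp.
    rewrite (_ : (fun u => RSlt z _ _ u) = (fun u : n.-tuple R => Phi b (rcons0 u) * Phi b' u * wlt z u)) //.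
    by apply/funext => u; exact: RSltE.
pose b i := nth 0 a i / 2; pose b' i := nth 0 a' i / 2.
apply: (@identity_and_continuation_gam R n.+1 n.+1 n.+1 a a' (fun u => Phi b u * Phi b' u * weq 0 u)
  (RS_integrand_eq a a')).
- apply: cmeasM; last exact: cmeas_weq.
  by apply: cmeasM; exact: cmeas_Phi.
- by move=> s x; rewrite -RSeqE RS_integrand_eq_texp.
- move=> z zp; rewrite -(RSeq_closed zp); have := cintegrable_RSeq zp.
  rewrite (_ : (fun u => RSeq z _ _ u) = (fun u : n.+1.-tuple R => Phi b u * Phi b' u * weq 0 u * wlt z u)) //.
  by apply/funext => u; exact: RSeqE.
Qed.
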